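(* Let $p$ be a prime, let $\mathbb{F}_q$ be a finite field of characteristic $p$ with $q$ elements, let $\delta$ denote Kronecker's delta function, and let $\tau$ be the number of positive divisors of $p-1$. Let $D_{p^2}(\mathbb{F}_q)$ be the set of decomposable monic original polynomials of degree $p^2$ in $\mathbb{F}_q[x]$. Then $$\# D_{p^{2}}(\mathbb{F}_q) = q^{2p-2} - q^{p-1} + 1 - \frac{(\tau q - q + 1)(q-1)(qp-p-2)}{2(p+1)} - (1-\delta_{p,2})\,\frac{q(q-1)(q-2)(p-3)}{4}.$$
   Context: A polynomial in $F[x]$ is monic original if its leading coefficient is $1$ and its constant coefficient is $0$. A polynomial $f\in F[x]$ is decomposable if $f = g\circ h = g(h)$ for some $g,h\in F[x]$ of degree at least $2$. (For $f$ monic original, $g$ and $h$ can then be taken to be monic original.) *)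

(* Defs.v *)
From mathcomp Require Import all_boot all_order all_algebra.
From mathcomp Require Import finmap.
From mathcomp Require Import all_classical.

Set Implicit Arguments.
Unset Strict Implicit.
Unset Printing Implicit Defensive.

Import GRing.Theory.

Local Open Scope ring_scope.
Local Open Scope classical_set_scope.

Definition monic_original (F : fieldType) (f : {poly F}) : Prop :=
  f \is monic /\ f`_0 = 0.

(* [2 < size g] says that the degree of [g] is at least 2. *)
Definition decomposable (F : fieldType) (f : {poly F}) : Prop :=
  exists g h : {poly F}, [/\ (2 < size g)%N, (2 < size h)%N & f = g \Po h].

(* [size f = n.+1] says that [f] has degree exactly [n]. *)
Definition decomposables (F : fieldType) (n : nat) : set {poly F} :=
  [set f | [/\ monic_original f, size f = n.+1 & decomposable f]].
Arguments decomposables : clear implicits.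

(* Main.v *)
(* A composition of degree p^2 whose derivative vanishes is 'X^p \Po h = g \Po 'X^p,
   and these collide pairwise in the obvious way. For any other collision
   g1 \Po h1 = g2 \Po h2, put k = h2 - h1. Comparing degrees modulo p in
   g1 \Po h1 = g2 \Po (h1 + k) shows that all four components have derivatives
   of degree deg k - 1. Since 1, k, ..., k^(p-1) are independent over K[h1], the
   norm of X - h2 from K(x) to K(h1) is g2(X) - g1(h1); specializing h1, one
   finds that the indices of h1 at the points above a pair (y, z) with
   g1(y) = g2(z) sum up to the index of g2 at z. As these indices sum up to the
   prime p over each fiber, the ramification of h1 is at least that of g2, and
   the equality of the degrees of the derivatives forces equality in every local
   estimate. Hence there is at most one critical value c, and over it both g1 and
   g2 have indices (1, m, ..., m) or (m, p - m). This determines h1 and h2 up to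
   a few parameters, which are unique and therefore rational. Finally, the number
   of compositions is the sum of 1/k_x over all pairs x = (g, h), where k_x counts
   the pairs with the same composition; k_x is 1, 2 or p + 1. *)
Require Import Defs.
From mathcomp Require Import all_boot all_order all_algebra all_field.
From mathcomp Require Import ring zify.

Set Implicit Arguments.
Unset Strict Implicit.
Unset Printing Implicit Defensive.

Import GRing.Theory.

Local Open Scope ring_scope.

(** * Degrees in a collision *)

(** Degree [p ^ 2] is the wild case, where the classical theory of tame decompositions does not
    apply. What saves the argument is that the derivative of a polynomial of degree [p] has degree
    below [p]: if it is nonzero, no index is divisible by [p], multiplicities in the derivative are
    indices minus one, and the degree of the derivative plays the part of the Riemann-Hurwitz
    formula. Function fields are avoided: the norm formula is checked as an identity of polynomials,
    by interpolation. Ramification needs all roots, hence an algebraically closed field; the way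
    back to the finite field is its q-power Frobenius, which fixes [h1] and [h2] and therefore their
    parameters. In the first family [k_x] is 1, 2 or [p + 1] because the partners of a pair
    correspond to the solutions [s] of the affine equation [b s^p - c s = 1], whose solution set is
    empty or a coset of a space of dimension at most 1 over the prime field. The factor
    [tau q - q + 1] counts the pairs [(m, w)]: [m] runs through the divisors of [p - 1], and [w] is
    arbitrary except for [m = 1], where it has no effect. *)

Section CompositionDegrees.
Variables (K : fieldType) (p : nat).
Hypothesis charKp : p \in [pchar K].
Implicit Types u v y t : {poly K}.

Let p_pr : prime p. Proof. exact: pcharf_prime charKp. Qed.
Let p_gt0 : (0 < p)%N. Proof. exact: prime_gt0. Qed.

Lemma natf_small_neq0 i : (0 < i < p)%N -> i%:R != 0 :> K.
Proof.
by case/andP=> i0 ip; rewrite -(dvdn_pcharf charKp) gtnNdvd.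
Qed.

Lemma size_monic_exp y n i : y \is monic -> size y = n.+1 ->
  size (y ^+ i) = (n * i).+1.
Proof.
move=> ym sy; have := size_exp y i; rewrite sy /= mulnC => <-.
by rewrite prednK // size_poly_gt0 monic_neq0 ?rpredX.
Qed.

(** Factoring out [t] leaves a sum of [i.+1] monic terms of degree [p * i]; their leading
    coefficients add up to [i.+1], which is nonzero in [K] because [i.+1 < p]. *)
Lemma size_expB y t r i : y \is monic -> size y = p.+1 ->
    size t = r.+1 -> (r < p)%N -> (i.+1 < p)%N ->
  size ((y + t) ^+ i.+1 - y ^+ i.+1) = (p * i + r).+1.
Proof.
move=> ym sy st rp ip.
have syt : size (y + t) = p.+1 by rewrite size_polyDl sy // st ltnS.
have ytm : y + t \is monic.
  by rewrite monicE lead_coefDl -?monicE // sy st ltnS.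
rewrite subrXX addrAC subrr add0r.
set S := \sum_(_ < _) _.
have sterm (j : 'I_i.+1) : size ((y + t) ^+ (i.+1.-1 - j) * y ^+ j) = (p * i).+1
    /\ ((y + t) ^+ (i.+1.-1 - j) * y ^+ j)`_(p * i) = 1.
  have m1 : (y + t) ^+ (i.+1.-1 - j) * y ^+ j \is monic by rewrite rpredM ?rpredX.
  have s1 : size ((y + t) ^+ (i.+1.-1 - j) * y ^+ j) = (p * i).+1.
    rewrite size_monicM ?rpredX ?monic_neq0 ?rpredX //.
    rewrite (size_monic_exp _ ytm syt) (size_monic_exp _ ym sy).
    have := ltn_ord j; rewrite ltnS /= => ji.
    by rewrite -[in RHS](subnK ji) mulnDr addnS.
  by split=> //; move/monicP: m1; rewrite /lead_coef s1.
have sS : size S = (p * i).+1.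
  apply/eqP; rewrite eqn_leq; apply/andP; split.
    by apply: (leq_trans (size_sum _ _ _)); apply/bigmax_leqP => j _; rewrite (sterm j).1.
  apply: contraR (natf_small_neq0 (i := i.+1) _); last exact: ip.
  rewrite -leqNgt => sS.
  have : S`_(p * i) = 0 by rewrite nth_default.
  rewrite coef_sum (eq_bigr (fun=> 1)); last by move=> j _; rewrite (sterm j).2.
  by rewrite sumr_const card_ord => ->.
have t0 : t != 0 by rewrite -size_poly_gt0 st.
by rewrite size_mul -?size_poly_gt0 ?st ?sS // /= addnS addnC.
Qed.

(** The top term of [u] dominates, since [p * i + r] grows with [i]. As [0 < r < p], both [n] and
    [r] can be recovered from the degree of the increment by division by [p]. *)
Lemma size_comp_polyDB u y t n r : y \is monic -> size y = p.+1 ->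
    size t = r.+1 -> (0 < r < p)%N -> size u = n.+2 -> (n.+1 < p)%N ->
  size ((u \Po (y + t)) - (u \Po y)) = (p * n + r).+1.
Proof.
move=> ym sy st /andP[r0 rp] su np.
rewrite !comp_polyE -sumrB su big_ord_recr /= addrC.
have un0 : u`_n.+1 != 0.
  by rewrite -[n.+1]/(n.+2.-1) -su -/(lead_coef u) lead_coef_eq0 -size_poly_gt0 su.
have big_size : size (u`_n.+1 *: (y + t) ^+ n.+1 - u`_n.+1 *: y ^+ n.+1) = (p * n + r).+1.
  by rewrite -scalerBr size_scale // (size_expB ym sy st rp np).
rewrite size_polyDl // big_size ltnS.
apply: (leq_trans (size_sum _ _ _)); apply/bigmax_leqP => -[[|i] /= ip _].
  by rewrite !expr0 subrr size_poly0.
rewrite -scalerBr (leq_trans (size_scale_leq _ _)) //.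
rewrite (size_expB ym sy st rp) ?(leq_trans ip) ?(ltnW np) //.
rewrite ltn_add2r ltn_mul2l p_gt0 /=; lia.
Qed.

Lemma size_comp_monic u y : size y = p.+1 -> u != 0 ->
  size (u \Po y) = (p * (size u).-1).+1.
Proof.
move=> sy u0; have := size_comp_poly u y; rewrite sy /= mulnC => <-.
by rewrite prednK // lt0n size_poly_eq0 comp_poly_eq0 // sy ltnS.
Qed.

End CompositionDegrees.

Section CollisionDegrees.
Variables (K : fieldType) (p : nat).
Hypothesis charKp : p \in [pchar K].
Implicit Types (u v y t g h : {poly K}).

Let p_pr : prime p. Proof. exact: pcharf_prime charKp. Qed.
Let p_gt0 : (0 < p)%N. Proof. exact: prime_gt0. Qed.

Definition monic_deg u := (u \is monic) && (size u == p.+1).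

(* The last two clauses exclude [h1 = h2] up to constants and the Frobenius
   collisions ['X^p \Po h = g \Po 'X^p]. *)
Definition collision g1 h1 g2 h2 :=
  [/\ [/\ monic_deg g1, monic_deg h1, monic_deg g2 & monic_deg h2],
      g1 \Po h1 = g2 \Po h2, (1 < size (h2 - h1)%R)%N
    & (g1 \Po h1)^`() != 0].

Lemma collision_sym g1 h1 g2 h2 :
  collision g1 h1 g2 h2 -> collision g2 h2 g1 h1.
Proof.
case=> -[? ? ? ?] E s d; split=> //; first by rewrite -opprB size_polyN.
by rewrite -E.
Qed.

Lemma size_deriv_small u : (size u <= p)%N -> size u^`() = (size u).-1.
Proof.
move=> sup; case su: (size u) => [|[|n]]; rewrite su in sup.
- by move/eqP: su; rewrite size_poly_eq0 => /eqP->; rewrite deriv0 size_poly0.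
- by rewrite [u]size1_polyC ?su // derivC size_poly0.
have u0 : u != 0 by rewrite -size_poly_gt0 su.
have := lt_size_deriv u0; rewrite su ltnS => le.
apply/eqP; rewrite eqn_leq le /= ltnNge; apply/negP => /leq_sizeP/(_ _ (leqnn _)) /eqP.
rewrite coef_deriv -mulr_natr mulf_eq0 -[n.+1]/(n.+2.-1) -su -/(lead_coef u).
rewrite lead_coef_eq0 (negPf u0) su /=.
by apply/negP/(natf_small_neq0 charKp).
Qed.

Lemma poly_expp u :
  u ^+ p = map_poly (pFrobenius_aut charKp) u \Po 'X^p.
Proof.
have charP : p \in [pchar {poly K}] by rewrite pchar_poly.
elim/poly_ind: u => [|u c IH].
  by rewrite rmorph0 comp_poly0 expr0n eqn0Ngt p_gt0.
rewrite rmorphD rmorphM /= map_polyX map_polyC comp_poly_MXaddC -IH.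
rewrite -!(pFrobenius_autE charP) rmorphD rmorphM /= !pFrobenius_autE.
by rewrite -polyC_exp.
Qed.

Lemma deriv_subXp u : (u - 'X^p)^`() = u^`().
Proof.
by rewrite derivB derivXn -mulr_natr -polyC_natr (pcharf0 charKp) mulr0 subr0.
Qed.

Lemma size_subXp u : monic_deg u -> (size (u - 'X^p)%R <= p)%N.
Proof.
case/andP=> um /eqP su; apply/leq_sizeP => j.
rewrite leq_eqVlt => /orP[/eqP<-|pj].
  by rewrite coefB coefXn eqxx; move/monicP: um; rewrite /lead_coef su => ->; rewrite subrr.
by rewrite nth_default // (leq_trans (size_polyD _ _)) // size_polyN size_polyXn su maxnn.
Qed.

Lemma size_subp u v : monic_deg u -> monic_deg v -> (size (u - v)%R <= p)%N.
Proof.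
move=> up vp; have -> : u - v = (u - 'X^p) - (v - 'X^p) by ring.
by rewrite (leq_trans (size_polyD _ _)) // size_polyN geq_max !size_subXp.
Qed.

Lemma monic_deg_subC h (c : K) : monic_deg h -> monic_deg (h - c%:P).
Proof.
case/andP=> hm /eqP sh; have lt : (size (- c%:P : {poly K}) < size h)%N.
  by rewrite size_polyN sh (leq_ltn_trans (size_polyC_leq1 _)).
by rewrite /monic_deg monicE lead_coefDl // -monicE hm size_polyDl // sh /=.
Qed.

(** Additivity of [p]-th powers turns the collision into an identity between a polynomial in [h2],
    of degree divisible by [p], and a sum of two increments of degrees [p * e + m.+1] and
    [p * n + e.+1], neither divisible by [p]. Their leading terms must cancel, and division with
    remainder by [p] gives [m = e = n]. *)
Lemma collision_degrees_lr g1 h1 g2 h2 : collision g1 h1 g2 h2 ->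
  size g1^`() = (size (h2 - h1)).-1 /\ size h2^`() = (size (h2 - h1)).-1.
Proof.
case=> -[g1p h1p g2p h2p] E sk f'0.
set k := h2 - h1 in sk *.
have skp : (size k <= p)%N by exact: size_subp.
have h1m : h1 \is monic by case/andP: h1p.
have sh1 : size h1 = p.+1 by case/andP: h1p => _ /eqP.
have h2m : h2 \is monic by case/andP: h2p.
have sh2 : size h2 = p.+1 by case/andP: h2p => _ /eqP.
have g1'0 : g1^`() != 0.
  by apply: contraNneq f'0; rewrite deriv_comp => ->; rewrite comp_poly0 mul0r.
have h2'0 : h2^`() != 0.
  by apply: contraNneq f'0; rewrite E deriv_comp => ->; rewrite mulr0.
set a := g1 - 'X^p; set b := h2 - 'X^p.
have sa : (size a <= p)%N by exact: size_subXp.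
have sb : (size b <= p)%N by exact: size_subXp.
have sda : size g1^`() = (size a).-1 by rewrite -deriv_subXp size_deriv_small.
have sdb : size h2^`() = (size b).-1 by rewrite -deriv_subXp size_deriv_small.
have [n san] : exists n, size a = n.+2.
  have : size g1^`() != 0%N by rewrite size_poly_eq0.
  by rewrite sda; case: (size a) => [|[|n]] //; exists n.
have [m sbm] : exists m, size b = m.+2.
  have : size h2^`() != 0%N by rewrite size_poly_eq0.
  by rewrite sdb; case: (size b) => [|[|m]] //; exists m.
have [e ske] : exists e, size k = e.+2.
  by case: (size k) sk => [|[|e]] // _; exists e.
rewrite sda sdb san sbm ske /=.
rewrite san in sa; rewrite sbm in sb; rewrite ske in skp.
set kt := map_poly (pFrobenius_aut charKp) k.
have skt : size kt = e.+2 by rewrite size_map_poly.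
(* Expand [g1 = 'X^p + a] and use [h1 ^+ p = h2 ^+ p - k ^+ p], where [k ^+ p] is [kt] composed with
   ['X^p = h2 - b]. *)
have key : (g1 - g2 - kt) \Po h2 =
   ((kt \Po (h2 + - b)) - (kt \Po h2)) + ((a \Po (h1 + k)) - (a \Po h1)).
  have h1k : h1 + k = h2 by rewrite /k; ring.
  have h2b : h2 + - b = 'X^p by rewrite /b; ring.
  rewrite h1k h2b -poly_expp /a !comp_polyB -E !comp_Xn_poly.
  have charP : p \in [pchar {poly K}] by rewrite pchar_poly.
  have -> : k ^+ p = h2 ^+ p - h1 ^+ p.
    by rewrite /k -!(pFrobenius_autE charP) rmorphB.
  by ring.
have s1 : size ((kt \Po (h2 + - b)) - (kt \Po h2)) = (p * e + m.+1).+1.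
  by apply: size_comp_polyDB; rewrite ?size_polyN.
have s2 : size ((a \Po (h1 + k)) - (a \Po h1)) = (p * n + e.+1).+1.
  by apply: size_comp_polyDB.
set A := (kt \Po (h2 + - b)) - (kt \Po h2) in key s1.
set B := (a \Po (h1 + k)) - (a \Po h1) in key s2.
have sAB : size A = size B.
  apply/eqP; apply/negPn/negP => nAB.
  have [w [r [r0 rp sS]]] : exists w r, [/\ (0 < r)%N, (r < p)%N & size (A + B) = (p * w + r).+1].
    have := nAB; rewrite neq_ltn => /orP[lt|gt].
      by exists n, e.+1; rewrite addrC size_polyDl.
    by exists e, m.+1; rewrite size_polyDl.
  move: sS; rewrite -key.
  have [->|n0] := eqVneq (g1 - g2 - kt) 0; first by rewrite comp_poly0 size_poly0.
  rewrite (size_comp_monic charKp sh2) // => -[] eq.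
  have := congr1 (modn^~ p) eq; rewrite modnMr mulnC modnMDl modn_small // => r00.
  by rewrite -r00 in r0.
have eq : (p * e + m.+1 = p * n + e.+1)%N by move: sAB; rewrite s1 s2; case.
have e1 := congr1 (modn^~ p) eq; have e2 := congr1 (divn^~ p) eq.
move: e1 e2; rewrite !(mulnC p) !modnMDl !divnMDl // !modn_small ?divn_small //.
by rewrite !addn0 => -[->] ->.
Qed.

Lemma collision_degrees g1 h1 g2 h2 : collision g1 h1 g2 h2 ->
  [/\ size g1^`() = (size (h2 - h1)).-1, size h1^`() = (size (h2 - h1)).-1,
      size g2^`() = (size (h2 - h1)).-1 & size h2^`() = (size (h2 - h1)).-1].
Proof.
move=> C; have [-> ->] := collision_degrees_lr C.
have [] := collision_degrees_lr (collision_sym C).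
by rewrite -opprB size_polyN => -> ->.
Qed.

End CollisionDegrees.

(** * The norm formula: fibers of [h1] seen through [h2] *)

Section FiberProduct.
Variables (K : closedFieldType) (p : nat).
Hypothesis charKp : p \in [pchar K].
Implicit Types (u v y t g h k : {poly K}).

Let p_pr : prime p. Proof. exact: pcharf_prime charKp. Qed.
Let p_gt0 : (0 < p)%N. Proof. exact: prime_gt0. Qed.

Lemma closed_notin (s : seq K) : exists z, z \notin s.
Proof.
have /closed_nonrootP[x] : \prod_(z <- s) ('X - z%:P) != 0.
  by rewrite monic_neq0 ?monic_prod_XsubC.
by rewrite root_prod_XsubC; exists x.
Qed.

(** Supplies the interpolation nodes for [fiber_product]. *)
Lemma closed_injective_nat : exists x : nat -> K, injective x.
Proof.
pose pts := fix pts n := if n is m.+1 then xchoose (closed_notin (pts m)) :: pts m else [::].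
exists (fun n => xchoose (closed_notin (pts n))).
have x_pts m n : (m < n)%N -> xchoose (closed_notin (pts m)) \in pts n.
  elim: n => // n IH; rewrite ltnS leq_eqVlt inE => /orP[/eqP->|/IH->].
    by rewrite eqxx.
  by rewrite orbT.
move=> m n; have [lt|lt|//] := ltngtP m n => E.
  by have := xchooseP (closed_notin (pts n)); rewrite -E x_pts.
by have := xchooseP (closed_notin (pts m)); rewrite E x_pts.
Qed.

Lemma poly_horner_eq0 u : (forall x, u.[x] = 0) -> u = 0.
Proof.
by move=> u0; apply/eqP; apply: contraT => /closed_nonrootP[x]; rewrite /root u0 eqxx.
Qed.

Lemma modn_mul_inj e (i j : 'I_p) : (0 < e)%N -> (e < p)%N ->
  (e * i = e * j %[mod p])%N -> i = j :> nat.
Proof.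
move=> e0 ep; wlog le : i j / (i <= j)%N.
  by move=> H E; case/orP: (leq_total i j) => le; [|apply: esym]; apply: H.
move=> /esym/eqP; rewrite eqn_mod_dvd ?leq_mul // -mulnBr Euclid_dvdM //.
rewrite gtnNdvd //= => dv; apply/eqP; rewrite eqn_leq le /= -subn_eq0.
by move: dv; apply: contraTT; rewrite -lt0n => ?; rewrite gtnNdvd // ltn_subLR // ltn_addl.
Qed.

(* The terms of the sum have degrees that are pairwise distinct modulo p. *)
Lemma comp_exp_free h k e (c : 'I_p -> {poly K}) : size h = p.+1 ->
    size k = e.+1 -> (0 < e < p)%N ->
  \sum_(i < p) (c i \Po h) * k ^+ i = 0 -> forall i, c i = 0.
Proof.
move=> sh sk /andP[e0 ep] sum0 i0; apply/eqP; apply/negPn/negP => ci0.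
have k0 : k != 0 by rewrite -size_poly_gt0 sk.
pose T i := (c i \Po h) * k ^+ i.
have sT i : c i != 0 -> size (T i) = (p * (size (c i)).-1 + e * i).+1.
  move=> ci; rewrite size_mul ?expf_neq0 //; last first.
    by rewrite comp_poly_eq0 // sh ltnS.
  rewrite (size_comp_monic charKp sh) //.
  have := size_exp k i; rewrite sk /= => <-.
  by rewrite -[size (k ^+ i)]prednK ?addnS // size_poly_gt0 expf_neq0.
case: (@arg_maxnP _ i0 (fun i => c i != 0) (fun i => size (T i)) ci0) => j cj jmax.
move: sum0; rewrite (bigD1 j) //= -/(T j) => /(congr1 (size \o val)) /=.
rewrite size_polyDl; first by rewrite sT ?size_poly0.
apply: (leq_ltn_trans (size_sum _ _ _)).
rewrite [X in (_ < X)%N]sT // ltnS; apply/bigmax_leqP => i ij.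
rewrite -/(T i); have [ci|ci] := eqVneq (c i) 0.
  by rewrite /T ci comp_poly0 mul0r size_poly0.
have {jmax} /= := jmax _ ci; rewrite !sT // ltnS leq_eqVlt => /orP[/eqP E|//].
have := congr1 (modn^~ p) E; rewrite !(mulnC p) !modnMDl.
by move=> /(modn_mul_inj e0 ep) /val_inj /eqP; rewrite (negPf ij).
Qed.

Lemma monic_deg_compXaddC h c : monic_deg p h -> monic_deg p (h \Po ('X + c%:P)).
Proof.
case/andP=> hm /eqP sh; rewrite /monic_deg size_comp_poly2 ?size_XaddC // sh eqxx andbT.
by rewrite monicE lead_coef_comp ?size_XaddC // lead_coefXaddC expr1n mulr1 -monicE.
Qed.

(* The preimages of [c] under [h], with multiplicity. *)
Definition fiber h c : seq K := sval (closed_field_poly_normal (h - c%:P)).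

Lemma fiberE h c : monic_deg p h -> h - c%:P = \prod_(z <- fiber h c) ('X - z%:P).
Proof.
move=> /(monic_deg_subC charKp c)/andP[/monicP hm _].
by rewrite /fiber; case: closed_field_poly_normal => r /=; rewrite hm scale1r.
Qed.

Lemma size_fiber h c : monic_deg p h -> size (fiber h c) = p.
Proof.
move=> hp; apply: succn_inj; rewrite -(size_prod_XsubC _ id) -fiberE //.
by case/andP: (monic_deg_subC charKp c hp) => _ /eqP.
Qed.

Lemma mem_fiber h c x : monic_deg p h -> (x \in fiber h c) = (h.[x] == c).
Proof.
by move=> hp; rewrite -root_prod_XsubC -fiberE // /root !hornerE subr_eq0.
Qed.

(* As functions of the fiber, the two sides agree on the curve parametrized by
   (h1, h2); their difference, of degree < p in k = h2 - h1, is interpolated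
   by polynomials in h1 and hence vanishes by [comp_exp_free]. *)
Lemma fiber_product g1 h1 g2 h2 c : collision p g1 h1 g2 h2 ->
  \prod_(z <- fiber h1 c) ('X - h2.[z]%:P) = g2 - g1.[c]%:P.
Proof.
move=> C; have [[g1p h1p g2p h2p] E sk _] := C.
set k := h2 - h1 in sk *.
have skp : (size k <= p)%N by exact: size_subp.
have sh1 : size h1 = p.+1 by case/andP: h1p => _ /eqP.
(* The claim at [a], translated by [a]: for [z] above [a], [h2.[z] - a] equals [k.[z]]. The
   translation replaces [h2] by [k], whose degree is below [p] as [comp_exp_free] requires. *)
pose D a := \prod_(z <- fiber h1 a) ('X - k.[z]%:P)
              - ((g2 \Po ('X + a%:P)) - g1.[a]%:P).
have sD a : (size (D a) <= p)%N.
  apply: size_subp; last exact/(monic_deg_subC charKp)/monic_deg_compXaddC.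
  rewrite /monic_deg -(big_map (fun z => k.[z]) predT (fun z => 'X - z%:P)).
  by rewrite monic_prod_XsubC (size_prod_XsubC _ id) size_map size_fiber /=.
(* Reciprocity of the resultant: the value at [b] of the product over the roots of [h1 - a] is, up
   to sign and leading coefficient, a product over the roots of [b - k]. So for fixed [b] it is
   polynomial in [a], and [w b] is that polynomial for all of [D]. *)
pose q b : {poly K} := b%:P - k.
pose rho b := sval (closed_field_poly_normal (q b)).
have qE b : q b = lead_coef (q b) *: \prod_(z <- rho b) ('X - z%:P).
  by rewrite /rho; case: closed_field_poly_normal.
pose w b := lead_coef (q b) ^+ p *:
   \prod_(z <- rho b) ((-1) ^+ p *: (h1.[z]%:P - 'X)) - ((g2 \Po ('X + b%:P)) - g1).
have wD b a : (w b).[a] = (D a).[b].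
  rewrite /w /D !hornerE horner_comp !hornerE horner_prod.
  rewrite [in RHS]horner_prod [a + b]addrC; congr (_ - _); last by rewrite horner_comp !hornerE.
  have -> : \prod_(z <- fiber h1 a) ('X - k.[z]%:P).[b] =
            \prod_(z <- fiber h1 a) (q b).[z].
    by apply: eq_bigr => z _; rewrite /q !hornerE.
  rewrite [in RHS]qE.
  under [in RHS]eq_bigr do rewrite hornerZ horner_prod.
  rewrite big_split /= big_const_seq count_predT size_fiber // iter_mulr_1.
  congr (_ * _); rewrite exchange_big /=; apply: eq_bigr => z _.
  rewrite !hornerE; have -> : h1.[z] - a = (h1 - a%:P).[z] by rewrite !hornerE.
  rewrite fiberE // horner_prod -(size_fiber a h1p) -count_predT -iter_mulr_1.
  rewrite -big_const_seq -big_split /=; apply: eq_bigr => t _.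
  by rewrite mulN1r !hornerXsubC opprB.
have D_h x : (D h1.[x]).[k.[x]] = 0.
  rewrite /D !hornerE horner_comp !hornerE horner_prod.
  rewrite (big_rem x) ?mem_fiber //= !hornerE subrr mul0r sub0r.
  by rewrite subrK -!horner_comp E subrr oppr0.
have [x x_inj] := closed_injective_nat.
have D_lag a : D a = \sum_(i < p) (w (x i)).[a] *: (tnth (lagrange p x) i : {poly K}).
  rewrite {1}(lagrange_gen p_gt0 x_inj (sD a)); apply: eq_bigr => i _.
  by rewrite wD mul_polyC.
(* The coefficient of degree [j] of [D a], as a polynomial in [a]: by Lagrange interpolation, a
   fixed linear combination of the [w (x i)]. *)
pose cf (j : 'I_p) := \sum_(i < p) (tnth (lagrange p x) i : {poly K})`_j *: w (x i).
have cf_eval j a : (cf j).[a] = (D a)`_j.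
  rewrite D_lag horner_sum coef_sum; apply: eq_bigr => i _.
  by rewrite hornerZ coefZ mulrC.
have cf0 : forall j, cf j = 0.
  have [e ske] : exists e, size k = e.+2.
    by case: (size k) sk => [|[|e]] // _; exists e.
  apply: (@comp_exp_free h1 k e.+1) => //; first by rewrite -ske.
  apply: poly_horner_eq0 => z; rewrite horner_sum -[RHS](D_h z).
  rewrite [in RHS](horner_coef_wide _ (sD _)); apply: eq_bigr => j _.
  by rewrite hornerM horner_comp horner_exp cf_eval.
have D0 : D c = 0.
  apply/polyP => j; rewrite coef0; have [jp|pj] := ltnP j p.
    by rewrite -(cf_eval (Ordinal jp)) cf0 horner0.
  by rewrite nth_default // (leq_trans (sD c)).
have := congr1 (fun v => v \Po ('X - c%:P)) (subr0_eq D0).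
rewrite comp_polyB comp_polyXaddC_K comp_polyC => <-.
rewrite rmorph_prod /=; apply: eq_big_seq => z; rewrite mem_fiber // => /eqP hz.
rewrite comp_polyB comp_polyX comp_polyC /k !hornerE hz -addrA; congr (_ + _).
by rewrite -opprD -rmorphD /= addrC subrK.
Qed.

End FiberProduct.

(** * Ramification indices *)

Lemma sum_count_mem (T : eqType) (s : seq T) (P : pred T) :
  (\sum_(x <- undup s | P x) count_mem x s = count P s)%N.
Proof.
under eq_bigr do rewrite -sum1_count big_mkcond.
rewrite exchange_big /= -sum1_count [RHS]big_mkcond; apply: eq_big_seq => z zs.
rewrite -big_mkcondr big_mkcond /= (bigD1_seq z) ?mem_undup ?undup_uniq //= eqxx andbT.
by rewrite big1 ?addn0 // => x /negPf; rewrite eq_sym => ->; rewrite andbF.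
Qed.

Lemma dvdn_prime_lt p d : prime p -> (d %| p)%N -> (d < p)%N -> d = 1%N.
Proof.
move=> p_pr dp; have [->//|d1] := eqVneq d 1%N.
by move/prime_nt_dvdP: dp => -> //; rewrite ltnn.
Qed.

Lemma gcdn_proper_half i j : (0 < j)%N -> ~~ (j %| i)%N -> (2 * gcdn i j <= j)%N.
Proof.
move=> j0 nd; have /dvdnP[[|[|q]] E] := dvdn_gcdr i j.
- by rewrite E in j0.
- by move: (dvdn_gcdl i j); rewrite -[gcdn i j]mul1n -E (negPf nd).
- by rewrite [leqRHS]E leq_mul2r orbT.
Qed.

(** Numerical core of the local estimates. Since the [i a] add up to the prime [p > j], some [i a]
    is not divisible by [j]. Two such [a] lose at least [j / 2] each, which exceeds [j.-1] in total.
    If there is only one, its gcd with [j] divides [p], hence is 1, and the loss is at least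
    [j.-1]. *)
Lemma gcdn_prime_sum (I : eqType) (A : seq I) (i n : I -> nat) (p j : nat) :
    prime p -> (1 < j < p)%N -> uniq A -> (\sum_(a <- A) i a = p)%N ->
    {in A, forall a, n a <= gcdn (i a) j}%N ->
  (j.-1 <= \sum_(a <- A) (j - n a))%N /\
  ((\sum_(a <- A) (j - n a) = j.-1)%N ->
    exists a0, [/\ a0 \in A, ~~ (j %| i a0)%N, n a0 = 1%N
      & {in A, forall a, a != a0 -> (j %| i a)%N /\ n a = j}]).
Proof.
move=> p_pr /andP[j1 jp] uA sumA nle.
have j0 : (0 < j)%N by exact: ltnW.
have /hasP[a0 a0A /= bad0] : has (fun a => ~~ (j %| i a)%N) A.
  apply: contraT; rewrite -all_predC => /allP alld.
  suff dj : (j %| p)%N by rewrite (dvdn_prime_lt p_pr dj jp) in j1.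
  rewrite -sumA big_seq; apply: dvdn_sum => a aA.
  by have /= := alld a aA; rewrite negbK.
have mem_rem a : (a \in rem a0 A) = (a != a0) && (a \in A) by rewrite mem_rem_uniq.
rewrite (big_rem a0) //=.
have [/hasP[a1 a1A /= bad1]|good] := boolP (has (fun a => ~~ (j %| i a)%N) (rem a0 A)).
  have h0 := gcdn_proper_half j0 bad0; have h1 := gcdn_proper_half j0 bad1.
  have n0 := nle _ a0A; have /nle n1 : a1 \in A by move: a1A; rewrite mem_rem => /andP[].
  rewrite (big_rem a1) //=; set S := (\sum_(_ <- _) _)%N.
  have lt : (j.-1 < (j - n a0) + (j - n a1))%N by lia.
  by split; [lia | move=> E; lia].
have {}good : {in A, forall a, a != a0 -> (j %| i a)%N}.
  move=> a aA aa0; move: good; rewrite -all_predC => /allP /(_ a).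
  by rewrite mem_rem aa0 aA /= negbK; apply.
have cop : gcdn (i a0) j = 1%N.
  apply: (dvdn_prime_lt p_pr); last exact: leq_ltn_trans (dvdn_leq j0 (dvdn_gcdr _ _)) jp.
  rewrite -sumA (big_rem a0) //= dvdn_addr ?dvdn_gcdl // big_seq.
  apply: dvdn_sum => a; rewrite mem_rem => /andP[aa0 aA].
  by apply: dvdn_trans (dvdn_gcdr _ _) _; apply: good.
have n0 : (n a0 <= 1)%N by rewrite -cop nle.
split; first lia.
move=> E; exists a0.
have rest0 : (\sum_(a <- rem a0 A) (j - n a) = 0)%N by lia.
split=> //; first lia.
move=> a aA aa0; split; first exact: good.
have : (j - n a = 0)%N.
  have arem : a \in rem a0 A by rewrite mem_rem aa0.
  by move/eqP: rest0; rewrite (big_rem a) //= addn_eq0 => /andP[/eqP].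
have := nle _ aA; have := dvdn_leq j0 (dvdn_gcdr (i a) j); lia.
Qed.

Section Ramification.
Variables (K : closedFieldType) (p : nat).
Hypothesis charKp : p \in [pchar K].
Implicit Types (q g h : {poly K}) (x y c : K).

Let p_pr : prime p. Proof. exact: pcharf_prime charKp. Qed.
Let p_gt0 : (0 < p)%N. Proof. exact: prime_gt0. Qed.

Definition ram q x := mup x (q - q.[x]%:P).

Lemma subC_neq0 q c : (1 < size q)%N -> q - c%:P != 0.
Proof.
by move=> sq; rewrite subr_eq0; apply: contraTneq sq => ->; rewrite -leqNgt size_polyC_leq1.
Qed.

Lemma root_subC q x : root (q - q.[x]%:P) x.
Proof. by rewrite /root !hornerE subrr. Qed.

Lemma ram_gt0 q x : (1 < size q)%N -> (0 < ram q x)%N.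
Proof.
by move=> sq; rewrite /ram -XsubC_dvd ?subC_neq0 // dvdp_XsubCl root_subC.
Qed.

Lemma mup_exp x q n : q != 0 -> mup x (q ^+ n) = (n * mup x q)%N.
Proof.
move=> q0; elim: n => [|n IH]; first by rewrite expr0 mupNroot // root1.
by rewrite exprS mupM ?expf_neq0 // IH mulSn.
Qed.

Lemma ram_comp g h x : (1 < size g)%N -> (1 < size h)%N ->
  ram (g \Po h) x = (ram h x * ram g h.[x])%N.
Proof.
move=> sg sh; rewrite /ram horner_comp; set y := h.[x].
have [i [u]] := multiplicity_XsubC (g - g.[y]%:P) y.
rewrite subC_neq0 //= => nroot E.
have -> : mup y (g - g.[y]%:P) = i.
  by rewrite E mupMr // mup_XsubCX eqxx.
have -> : (g \Po h) - g.[y]%:P = (u \Po h) * (h - y%:P) ^+ i.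
  rewrite -[g.[y]%:P](comp_polyC _ h) -comp_polyB E comp_polyM.
  by rewrite rmorphXn /= comp_polyB comp_polyX comp_polyC.
rewrite mupMr; last by rewrite /root horner_comp.
by rewrite mup_exp ?subC_neq0 // mulnC.
Qed.

Lemma monic_deg_size_gt1 q : monic_deg p q -> (1 < size q)%N.
Proof. by case/andP=> _ /eqP->; rewrite ltnS. Qed.

Lemma size_deriv_monic_deg q : monic_deg p q -> (size q^`() <= p)%N.
Proof.
case/andP=> qm /eqP sq; have := lt_size_deriv (monic_neq0 qm).
by rewrite sq ltnS.
Qed.

(** Excludes wild ramification: if [p] divided the index, the full power of ['X - x%:P] would divide
    the derivative, which is nonzero of degree below [p]. *)
Lemma mup_deriv q x : monic_deg p q -> q^`() != 0 -> ram q x = (mup x q^`()).+1.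
Proof.
move=> qp q'0; have sq := monic_deg_size_gt1 qp.
have := ram_gt0 x sq; rewrite /ram.
have [i [u]] := multiplicity_XsubC (q - q.[x]%:P) x.
rewrite subC_neq0 //= => nroot E.
have -> : mup x (q - q.[x]%:P) = i by rewrite E mupMr // mup_XsubCX eqxx.
have -> : q^`() = (q - q.[x]%:P)^`() by rewrite derivB derivC subr0.
case: i E => // i E _; rewrite E derivM deriv_exp derivXsubC mul1r /= exprS.
have -> : u^`() * (('X - x%:P) * ('X - x%:P) ^+ i)
    + u * (('X - x%:P) ^+ i *+ i.+1) =
    (u^`() * ('X - x%:P) + u *+ i.+1) * ('X - x%:P) ^+ i.
  by rewrite [RHS]mulrDl mulrnAr mulrnAl mulrA.
have pi : ~~ (p %| i.+1)%N.
  apply/negP=> dv; have ip := dvdn_leq (ltn0Sn i) dv.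
  have : ('X - x%:P) ^+ i.+1 %| q^`().
    have -> : q^`() = (q - q.[x]%:P)^`() by rewrite derivB derivC subr0.
    rewrite E derivM deriv_exp -mulr_natr.
    have -> : i.+1%:R = 0 :> {poly K}.
      by apply/eqP; rewrite -(dvdn_pcharf (_ : p \in [pchar {poly K}])) // pchar_poly.
    by rewrite !mulr0 addr0 dvdp_mull.
  move/dvdp_leq => /(_ q'0); rewrite size_exp_XsubC ltnNge.
  by rewrite (leq_trans (size_deriv_monic_deg qp)).
congr S; rewrite mupMr ?mup_XsubCX ?eqxx //.
rewrite /root !hornerE subrr mulr0 add0r hornerMn -mulr_natr mulf_eq0 negb_or.
by rewrite -(dvdn_pcharf charKp) pi andbT.
Qed.

End Ramification.

Lemma sum_partition_seq (T I : eqType) (s : seq T) (A : seq I) (f : T -> I) (F : T -> nat) :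
    uniq A -> {in s, forall x, f x \in A} ->
  (\sum_(a <- A) \sum_(x <- s | f x == a) F x = \sum_(x <- s) F x)%N.
Proof.
move=> uA fA; under eq_bigr do rewrite big_mkcond.
rewrite exchange_big /=; apply: eq_big_seq => x /fA fxA.
rewrite (bigD1_seq (f x)) //= eqxx big1 ?addn0 // => a.
by rewrite eq_sym => /negPf->.
Qed.

Section RamificationStructure.
Variables (K : closedFieldType) (p : nat).
Hypothesis charKp : p \in [pchar K].
Implicit Types (q g h : {poly K}) (a b c x y : K).

Let p_pr : prime p. Proof. exact: pcharf_prime charKp. Qed.
Let p_gt0 : (0 < p)%N. Proof. exact: prime_gt0. Qed.

Definition pts h c := undup (fiber h c).

Lemma mem_pts h c x : monic_deg p h -> (x \in pts h c) = (h.[x] == c).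
Proof. by move=> hp; rewrite mem_undup (mem_fiber charKp). Qed.

Lemma pts_uniq h c : uniq (pts h c). Proof. exact: undup_uniq. Qed.

Lemma ram_count h x c : monic_deg p h -> h.[x] = c -> ram h x = count_mem x (fiber h c).
Proof. by move=> hp <-; rewrite /ram (fiberE charKp) // mu_prod_XsubC. Qed.

Lemma sum_ram h c : monic_deg p h -> (\sum_(x <- pts h c) ram h x = p)%N.
Proof.
move=> hp; rewrite -(size_fiber charKp c hp) -count_predT -sum_count_mem.
by apply: eq_big_seq => x; rewrite mem_pts // => /eqP; apply: ram_count.
Qed.

(** Compares the multiplicities of the root [b] on the two sides of [fiber_product]. *)
Lemma sum_ram_fiber g1 h1 g2 h2 b c : collision p g1 h1 g2 h2 -> g1.[c] = g2.[b] ->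
  (\sum_(x <- pts h1 c | h2.[x] == b) ram h1 x = ram g2 b)%N.
Proof.
move=> C E; have [[_ h1p _ _] _ _ _] := C.
rewrite /ram -E -(fiber_product charKp c C).
rewrite -(big_map (fun z => h2.[z]) predT (fun z => 'X - z%:P)) mu_prod_XsubC.
rewrite count_map -sum_count_mem big_seq_cond [RHS]big_seq_cond.
apply: eq_bigr => x /andP[]; rewrite mem_pts // => /eqP hx _.
by rewrite -(ram_count h1p hx).
Qed.

Lemma sum_ram_fiber_swap g1 h1 g2 h2 b c : collision p g1 h1 g2 h2 -> g1.[c] = g2.[b] ->
  (\sum_(x <- pts h2 b | h1.[x] == c) ram h1 x = ram g2 b)%N.
Proof.
move=> C E; have [[_ h1p _ h2p] _ _ _] := C.
rewrite -(sum_ram_fiber C E) -big_filter -[RHS]big_filter; apply: perm_big.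
apply: uniq_perm; rewrite ?filter_uniq ?pts_uniq // => x.
by rewrite !mem_filter !mem_pts // andbC.
Qed.

Lemma ram_collision g1 h1 g2 h2 x : collision p g1 h1 g2 h2 ->
  (ram h1 x * ram g1 h1.[x] = ram h2 x * ram g2 h2.[x])%N.
Proof.
case=> -[g1p h1p g2p h2p] E _ _.
by rewrite -!ram_comp ?E //; apply: (monic_deg_size_gt1 charKp).
Qed.

(** The Riemann-Hurwitz formula of a polynomial without wild ramification. *)
Lemma sum_ram_deriv q (X : seq K) : monic_deg p q -> q^`() != 0 -> uniq X ->
    (forall x, root q^`() x -> x \in X) ->
  (\sum_(x <- X) (ram q x).-1 = (size q^`()).-1)%N.
Proof.
move=> qp q'0 uX qX; have [r Er] := closed_field_poly_normal q^`().
have l0 : lead_coef q^`() != 0 by rewrite lead_coef_eq0.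
have mr x : mup x q^`() = count_mem x r.
  by rewrite Er -mul_polyC mupMr ?mu_prod_XsubC // rootC.
rewrite [in RHS]Er size_scale // (size_prod_XsubC _ id) /=.
under eq_bigr do rewrite (mup_deriv charKp) // mr /=.
rewrite -count_predT -(sum_count_mem r predT) /=.
rewrite [RHS](bigID (mem X)) /= [X in (_ + X)%N]big1_seq ?addn0; last first.
  move=> x /andP[/negP nX]; rewrite mem_undup -root_prod_XsubC => rx.
  by case: nX; apply: qX; rewrite Er rootZ.
rewrite (bigID (mem r)) /= addnC big1 ?add0n; last first.
  by move=> x /count_memPn.
rewrite -big_filter -[RHS]big_filter; apply: perm_big; apply: uniq_perm.
- exact: filter_uniq.
- by rewrite filter_uniq ?undup_uniq.
by move=> x; rewrite !mem_filter mem_undup andbC.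
Qed.

Lemma ram_le_size q x : monic_deg p q -> q^`() != 0 -> (ram q x <= size q^`())%N.
Proof.
move=> qp q'0; rewrite (mup_deriv charKp) // -(size_exp_XsubC _ x).
by rewrite dvdp_leq // -mup_geq.
Qed.

Lemma collision_deriv g1 h1 g2 h2 : collision p g1 h1 g2 h2 ->
  [/\ g1^`() != 0, h1^`() != 0, g2^`() != 0 & h2^`() != 0].
Proof.
move=> C; have [e1 e2 e3 e4] := collision_degrees charKp C.
have [_ _ sk _] := C.
by split; rewrite -size_poly_gt0 ?e1 ?e2 ?e3 ?e4; case: (size _) sk => [|[|]].
Qed.

Lemma collision_ram_lt g1 h1 g2 h2 x : collision p g1 h1 g2 h2 -> (ram g2 x < p)%N.
Proof.
move=> C; have [[g1p h1p g2p h2p] _ sk _] := C.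
have [_ _ g2'0 _] := collision_deriv C.
have [_ _ sg2 _] := collision_degrees charKp C.
apply: (leq_ltn_trans (ram_le_size _ g2p g2'0)); rewrite sg2.
by have := size_subp h2p h1p; case: (size _) sk => // n _.
Qed.

(** Group the points of [h2] above [b] by their image [a] under [h1]. Each group has total index
    [j], so it contributes [j] minus its number of points, and [gcdn_prime_sum] applies to the
    indices of [g1] above [g2.[b]], whose sum is [p]. *)
Lemma fiber_ram_sum g1 h1 g2 h2 b : collision p g1 h1 g2 h2 ->
  let T := (\sum_(x <- pts h2 b) (ram h1 x).-1)%N in
  ((ram g2 b).-1 <= T)%N /\
  ((1 < ram g2 b)%N -> T = (ram g2 b).-1 ->
   exists x0, [/\ h2.[x0] = b, ram h1 x0 = ram g2 b,
     ~~ (ram g2 b %| ram g1 h1.[x0])%N,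
     forall y, g1.[y] = g2.[b] -> y != h1.[x0] -> (ram g2 b %| ram g1 y)%N
     & forall x, h2.[x] = b -> x != x0 -> ram h1 x = 1%N]).
Proof.
move=> C T; have [[g1p h1p g2p h2p] E _ _] := C.
have s1 := monic_deg_size_gt1 charKp h1p.
set j := ram g2 b.
have [j1|j1] := leqP j 1; first by split=> //; lia.
have jp : (j < p)%N := collision_ram_lt b C.
set c := g2.[b].
have h1A : {in pts h2 b, forall x, h1.[x] \in pts g1 c}.
  by move=> x; rewrite !mem_pts // -horner_comp E horner_comp => /eqP->.
pose n a := count (fun x => h1.[x] == a) (pts h2 b).
have sumj a : a \in pts g1 c -> (\sum_(x <- pts h2 b | h1.[x] == a) ram h1 x = j)%N.
  by rewrite mem_pts // => /eqP; apply: sum_ram_fiber_swap.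
have sum1 a : a \in pts g1 c ->
    (\sum_(x <- pts h2 b | h1.[x] == a) (ram h1 x).-1 = j - n a)%N.
  move=> /sumj <-; rewrite /n -sum1_count -sumnB; last by move=> x _; exact: ram_gt0.
  by apply: eq_bigr => x _; rewrite subn1.
have TE : T = (\sum_(a <- pts g1 c) (j - n a))%N.
  rewrite /T -(sum_partition_seq _ (pts_uniq g1 c) h1A).
  by apply: eq_big_seq => a /sum1.
(* By multiplicativity of indices, [j / d] divides [ram h1 x] at every point [x] of the group of
   [a]; as these indices add up to [j], there are at most [d] points. *)
have nle : {in pts g1 c, forall a, n a <= gcdn (ram g1 a) j}%N.
  move=> a aA; set d := gcdn _ _.
  have d0 : (0 < d)%N by rewrite gcdn_gt0 (ltnW j1) orbT.
  have [j' jE] : exists j', j = (j' * d)%N by apply/dvdnP; exact: dvdn_gcdr.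
  have [i' iE] : exists i', ram g1 a = (i' * d)%N by apply/dvdnP; exact: dvdn_gcdl.
  have cop : coprime j' i'.
    have : (gcdn i' j' * d = 1 * d)%N by rewrite muln_gcdl -iE -jE mul1n.
    by rewrite coprime_sym => /eqP; rewrite eqn_pmul2r.
  have j'0 : (0 < j')%N by move: (ltnW j1); rewrite jE; case: (j').
  have rj x : x \in pts h2 b -> h1.[x] == a -> (j' <= ram h1 x)%N.
    rewrite mem_pts // => /eqP hx /eqP h1x; apply: dvdn_leq; first exact: ram_gt0.
    rewrite -(Gauss_dvdl _ cop); apply/dvdnP; exists (ram h2 x).
    have := ram_collision x C; rewrite hx h1x iE -/j jE !mulnA => /eqP.
    by rewrite eqn_pmul2r // => /eqP.
  rewrite -(leq_pmul2r j'0) [(d * j')%N]mulnC -jE -[leqRHS](sumj _ aA).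
  rewrite /n -sum1_count big_distrl /= big_seq_cond [leqRHS]big_seq_cond.
  by apply: leq_sum => x /andP[xb h1x]; rewrite mul1n rj.
have [|Tge Teq] := gcdn_prime_sum p_pr _ (pts_uniq g1 c) (sum_ram c g1p) nle.
  by rewrite j1.
rewrite TE; split=> // _ /Teq[a0 [a0A nd n1 good]].
have [x0 fE] : exists x0, [seq x <- pts h2 b | h1.[x] == a0] = [:: x0].
  by move: n1; rewrite /n -size_filter; case: [seq _ <- _ | _] => [|z [|]] //= _; exists z.
have mem_f x : (x == x0) = (h1.[x] == a0) && (h2.[x] == b).
  by rewrite -(mem_seq1 x x0) -fE mem_filter mem_pts.
have := mem_f x0; rewrite eqxx => /esym/andP[/eqP h1x0 /eqP h2x0].
exists x0; rewrite h1x0; split=> //.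
- by rewrite -(sumj _ a0A) -big_filter fE big_seq1.
- by move=> y gy ya0; have [] := good y _ ya0; rewrite // mem_pts // gy.
move=> x h2x xx0.
have xb : x \in pts h2 b by rewrite mem_pts // h2x.
have aA := h1A _ xb.
have aa0 : h1.[x] != a0.
  by apply: contra xx0 => /eqP h1x; rewrite mem_f h1x h2x !eqxx.
(* A group of [j] points with total index [j] consists of points of index 1. *)
have [_ nj] := good _ aA aa0; have := sum1 _ aA; rewrite nj subnn => /eqP.
rewrite (big_rem x) //= eqxx addn_eq0 => /andP[/eqP r0 _].
by move: (ram_gt0 x s1) r0; case: (ram h1 x) => // n' _ /= ->.
Qed.

(* The inequalities of [fiber_ram_sum] add up to deg h1' >= deg g2', and these
   degrees are equal, so every one of them is an equality. *)
Lemma fiber_ram_sum_eq g1 h1 g2 h2 b : collision p g1 h1 g2 h2 ->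
  (\sum_(x <- pts h2 b) (ram h1 x).-1 = (ram g2 b).-1)%N.
Proof.
move=> C; have [[g1p h1p g2p h2p] _ _ _] := C.
have [_ h1'0 g2'0 _] := collision_deriv C.
have [_ s1 s2 _] := collision_degrees charKp C.
have [r1 E1] := closed_field_poly_normal h1^`().
have [r2 E2] := closed_field_poly_normal g2^`().
have rootE (q : {poly K}) r : q != 0 -> q = lead_coef q *: \prod_(z <- r) ('X - z%:P) ->
    forall x, root q x = (x \in r).
  by move=> q0 -> x; rewrite rootZ ?lead_coef_eq0 // root_prod_XsubC.
(* [Y] holds [b], the critical points of [g2] and the [h2]-images of those of [h1], so that the sums
   over [Y] exhaust the degrees of both derivatives. *)
pose X := undup r1; pose Y := undup (b :: r2 ++ map (fun x => h2.[x]) r1).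
pose T c := (\sum_(x <- pts h2 c) (ram h1 x).-1)%N.
have bY : b \in Y by rewrite mem_undup inE eqxx.
have uY : uniq Y by exact: undup_uniq.
have noncrit x : x \notin r1 -> (ram h1 x).-1 = 0%N.
  by move=> nx; rewrite (mup_deriv charKp) // mupNroot // (rootE _ r1).
have TE c : T c = (\sum_(x <- X | h2.[x] == c) (ram h1 x).-1)%N.
  rewrite /T (bigID (mem X)) /= [X in (_ + X)%N]big1 ?addn0; last first.
    by move=> x; rewrite mem_undup => /noncrit.
  rewrite -big_filter -[RHS]big_filter; apply: perm_big; apply: uniq_perm.
  - by rewrite filter_uniq ?pts_uniq.
  - by rewrite filter_uniq ?undup_uniq.
  by move=> x; rewrite !mem_filter mem_pts // andbC.
have sumT : (\sum_(c <- Y) T c = \sum_(c <- Y) (ram g2 c).-1)%N.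
  rewrite (sum_ram_deriv g2p g2'0 uY); last first.
    by move=> x; rewrite (rootE _ r2) // mem_undup inE mem_cat => ->; rewrite orbT.
  rewrite s2 -s1 -(@sum_ram_deriv h1 X) ?undup_uniq //; last first.
    by move=> x; rewrite (rootE _ r1) // mem_undup.
  rewrite -(@sum_partition_seq _ _ X Y (fun x => h2.[x])) //.
    by apply: eq_bigr => c _; rewrite TE.
  move=> x; rewrite !mem_undup => xr; rewrite inE mem_cat (map_f (fun x => h2.[x]) xr).
  by rewrite !orbT.
have Tge c : ((ram g2 c).-1 <= T c)%N by have [] := fiber_ram_sum c C.
apply/eqP; rewrite eqn_leq Tge andbT -/(T b).
move: sumT; rewrite (bigD1_seq b) //= [in RHS](bigD1_seq b) //= => sumT.
rewrite -(leq_add2r (\sum_(c <- Y | c != b) T c)%N) sumT leq_add2l.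
by apply: leq_sum.
Qed.

Lemma ram_structure g1 h1 g2 h2 b : collision p g1 h1 g2 h2 -> (1 < ram g2 b)%N ->
   exists x0, [/\ h2.[x0] = b, ram h1 x0 = ram g2 b,
     ~~ (ram g2 b %| ram g1 h1.[x0])%N,
     forall y, g1.[y] = g2.[b] -> y != h1.[x0] -> (ram g2 b %| ram g1 y)%N
     & forall x, h2.[x] = b -> x != x0 -> ram h1 x = 1%N].
Proof.
move=> C j1; have [_] := fiber_ram_sum b C.
by apply=> //; exact: fiber_ram_sum_eq C.
Qed.

Lemma ram_structure1 g1 h1 g2 h2 x : collision p g1 h1 g2 h2 ->
  ram g2 h2.[x] = 1%N -> ram h1 x = 1%N.
Proof.
move=> C j1; have [[g1p h1p g2p h2p] _ _ _] := C.
have := fiber_ram_sum_eq h2.[x] C; rewrite j1 => /eqP.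
rewrite (big_rem x) ?mem_pts //= addn_eq0 => /andP[/eqP r0 _].
by move: (ram_gt0 x (monic_deg_size_gt1 charKp h1p)) r0; case: (ram h1 x) => // n' _ /= ->.
Qed.

End RamificationStructure.

Lemma sum_all_but_one (I : eqType) (A : seq I) (f : I -> nat) a0 M :
    uniq A -> a0 \in A -> {in A, forall a, a != a0 -> f a = M} ->
  (\sum_(a <- A) f a = f a0 + (size A).-1 * M)%N.
Proof.
move=> uA a0A fM; rewrite (big_rem a0) //= -(size_rem a0A); congr addn.
rewrite (eq_big_seq (fun=> M)) => [|a].
  by rewrite big_const_seq count_predT iter_addn_0 mulnC.
by rewrite mem_rem_uniq // => /andP[aa0 aA]; apply: fM.
Qed.

Lemma seq_argmax (I : eqType) (s : seq I) (f : I -> nat) : s != [::] ->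
  exists2 x, x \in s & {in s, forall y, f y <= f x}%N.
Proof.
elim: s => // a [|b s] IH _.
  by exists a; rewrite ?mem_head // => y; rewrite inE => /eqP->.
have [//|x xs xmax] := IH; have [le|lt] := leqP (f a) (f x).
  exists x; first by rewrite inE xs orbT.
  by move=> y; rewrite inE => /predU1P[->|/xmax].
exists a; first exact: mem_head.
move=> y; rewrite inE => /predU1P[->//|/xmax le].
exact: leq_trans le (ltnW lt).
Qed.

(** * Critical values of the left components *)

Section CriticalValues.
Variables (K : closedFieldType) (p : nat).
Hypothesis charKp : p \in [pchar K].
Implicit Types (q g h : {poly K}) (a b c x y z : K).

Let p_pr : prime p. Proof. exact: pcharf_prime charKp. Qed.
Let p_gt0 : (0 < p)%N. Proof. exact: prime_gt0. Qed.

(* Over [c] both [g1] and [g2] have one point of index [i] and [l] of index [M]. *)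
Definition profile g1 g2 c M i l y0 z0 :=
  [/\ [/\ p = (i + l * M)%N, (0 < i < M)%N & (0 < l)%N],
      [/\ g1.[y0] = c, ram g1 y0 = i, size (pts g1 c) = l.+1
        & forall y, g1.[y] = c -> y != y0 -> ram g1 y = M]
    & [/\ g2.[z0] = c, ram g2 z0 = i, size (pts g2 c) = l.+1
        & forall z, g2.[z] = c -> z != z0 -> ram g2 z = M]].

Lemma profile_sym g1 g2 c M i l y0 z0 :
  profile g1 g2 c M i l y0 z0 -> profile g2 g1 c M i l z0 y0.
Proof. by case. Qed.

(** By [ram_structure] the maximal index [M] divides, hence equals, all indices of [g2] above the
    value except one. Such a point of [g2] gives the same statement for [g1]. The exceptional index
    is below [M], so on both sides it is the remainder of [p] modulo [M], and [l] is the
    quotient. *)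
Lemma max_ram_profile g1 h1 g2 h2 b : collision p g1 h1 g2 h2 ->
    (1 < ram g1 b)%N ->
    (forall y, g1.[y] = g1.[b] -> ram g1 y <= ram g1 b)%N ->
    (forall z, g2.[z] = g1.[b] -> ram g2 z <= ram g1 b)%N ->
  exists M i l y0 z0, profile g1 g2 g1.[b] M i l y0 z0.
Proof.
move=> C; set M := ram g1 b; set c := g1.[b] => M1 le1 le2.
have [[g1p h1p g2p h2p] E _ _] := C.
have sg1 := monic_deg_size_gt1 charKp g1p; have sg2 := monic_deg_size_gt1 charKp g2p.
have gh x : g2.[h2.[x]] = g1.[h1.[x]] by rewrite -!horner_comp E.
have [x0 [hx0 _ nd0 good0 _]] := ram_structure charKp (collision_sym C) M1.
set z0 := h2.[x0] in nd0 good0; rewrite -/M -/c in nd0 good0.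
have gz0 : g2.[z0] = c by rewrite gh hx0.
have M2 z : g2.[z] = c -> z != z0 -> ram g2 z = M.
  move=> gz zz0; apply/eqP; rewrite eqn_leq le2 //=.
  by apply: dvdn_leq; [exact: ram_gt0 | exact: good0].
have z0A : z0 \in pts g2 c by rewrite (mem_pts charKp) // gz0.
have sum2 := sum_all_but_one (pts_uniq g2 c) z0A (f := ram g2) (M := M) _.
have {}sum2 : p = (ram g2 z0 + (size (pts g2 c)).-1 * M)%N.
  rewrite -sum2 ?(sum_ram charKp) // => z; rewrite (mem_pts charKp) // => /eqP; exact: M2.
have /hasP[b2 b2A /= b2z0] : has (fun z => z != z0) (pts g2 c).
  apply: contraT; rewrite -all_predC => /allP all0.
  have sz : (size (pts g2 c) <= 1)%N.
    apply: (@uniq_leq_size _ _ [:: z0]); rewrite ?pts_uniq // => z /all0 /=.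
    by rewrite negbK inE.
  move: sum2; have -> : (size (pts g2 c)).-1 = 0%N by move: sz; case: (size _) => [|[]].
  by rewrite mul0n addn0 => pE; have := collision_ram_lt charKp z0 C; rewrite -pE ltnn.
have gb2 : g2.[b2] = c by apply/eqP; rewrite -(mem_pts charKp).
have rb2 := M2 _ gb2 b2z0.
have b2M : (1 < ram g2 b2)%N by rewrite rb2.
have [x1 [hx1 _ nd1 good1 _]] := ram_structure charKp C b2M.
set y0 := h1.[x1] in nd1 good1; rewrite rb2 gb2 in nd1 good1.
have gy0 : g1.[y0] = c by rewrite -gh hx1.
have M1' y : g1.[y] = c -> y != y0 -> ram g1 y = M.
  move=> gy yy0; apply/eqP; rewrite eqn_leq le1 //=.
  by apply: dvdn_leq; [exact: ram_gt0 | exact: good1].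
have y0A : y0 \in pts g1 c by rewrite (mem_pts charKp) // gy0.
have sum1 := sum_all_but_one (pts_uniq g1 c) y0A (f := ram g1) (M := M) _.
have {}sum1 : p = (ram g1 y0 + (size (pts g1 c)).-1 * M)%N.
  rewrite -sum1 ?(sum_ram charKp) // => z; rewrite (mem_pts charKp) // => /eqP; exact: M1'.
have lt2 : (ram g2 z0 < M)%N.
  by rewrite ltn_neqAle le2 // andbT; apply: contraNneq nd0 => ->; exact: dvdnn.
have lt1 : (ram g1 y0 < M)%N.
  by rewrite ltn_neqAle le1 // andbT; apply: contraNneq nd1 => ->; exact: dvdnn.
have M0 : (0 < M)%N by exact: ltnW.
have eqi : ram g1 y0 = ram g2 z0.
  have := congr1 (modn^~ M) sum1; rewrite {1}sum2.
  by rewrite ![(_ + _ * M)%N]addnC !modnMDl !modn_small.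
have eql : (size (pts g1 c)).-1 = (size (pts g2 c)).-1.
  by apply/eqP; rewrite -(eqn_pmul2r M0) -(eqn_add2l (ram g1 y0)) -sum1 eqi -sum2.
have s1 : (0 < size (pts g1 c))%N by case: (pts g1 c) y0A.
have s2 : (0 < size (pts g2 c))%N by case: (pts g2 c) z0A.
have l0 : (0 < (size (pts g2 c)).-1)%N.
  rewrite lt0n; apply: contraTneq (collision_ram_lt charKp z0 C) => l0.
  by rewrite [X in (_ < X)%N]sum2 l0 mul0n addn0 ltnn.
exists M, (ram g2 z0), (size (pts g2 c)).-1, y0, z0; split; split=> //.
- by rewrite lt2 ram_gt0.
- by rewrite -eql prednK.
- by rewrite prednK.
Qed.

Lemma pts_neq0 g c : monic_deg p g -> pts g c != [::].
Proof.
move=> gp; apply: contraTneq p_gt0 => E.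
by rewrite -(sum_ram charKp c gp) E big_nil.
Qed.

Lemma exists_profile g1 h1 g2 h2 b : collision p g1 h1 g2 h2 -> (1 < ram g1 b)%N ->
  exists M i l y0 z0, profile g1 g2 g1.[b] M i l y0 z0.
Proof.
move=> C b1; set c := g1.[b]; have [[g1p h1p g2p h2p] E _ _] := C.
have [y1] := seq_argmax (ram g1) (pts_neq0 c g1p).
rewrite (mem_pts charKp) // => /eqP gy1 max1.
have [z1] := seq_argmax (ram g2) (pts_neq0 c g2p).
rewrite (mem_pts charKp) // => /eqP gz1 max2.
have y1_gt1 : (1 < ram g1 y1)%N.
  by apply: leq_trans b1 (max1 _ _); rewrite (mem_pts charKp).
have {}max1 y : g1.[y] = c -> (ram g1 y <= ram g1 y1)%N.
  by move=> gy; apply: max1; rewrite (mem_pts charKp) // gy.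
have {}max2 z : g2.[z] = c -> (ram g2 z <= ram g2 z1)%N.
  by move=> gz; apply: max2; rewrite (mem_pts charKp) // gz.
have [le|lt] := leqP (ram g2 z1) (ram g1 y1).
  rewrite -gy1; apply: (max_ram_profile C) => //; rewrite gy1 // => z /max2 lez.
  exact: leq_trans lez le.
have [||M [i [l [z0 [y0 P]]]]] := max_ram_profile (collision_sym C) (ltn_trans y1_gt1 lt).
- by rewrite gz1.
- by rewrite gz1 => y /max1 ley; apply: leq_trans ley (ltnW lt).
by exists M, i, l, y0, z0; rewrite -gz1; apply: profile_sym.
Qed.

Lemma profile_sum g1 g2 c M i l y0 z0 : monic_deg p g1 ->
  profile g1 g2 c M i l y0 z0 -> (\sum_(y <- pts g1 c) (ram g1 y).-1 = p.-1 - l)%N.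
Proof.
move=> g1p [[pE /andP[i0 iM] l0] [gy0 ry0 sz other] _].
rewrite (sum_all_but_one (M := M.-1) (pts_uniq g1 c) (a0 := y0)).
- rewrite ry0 sz /= [p in RHS]pE; have M0 : (0 < M)%N by exact: leq_ltn_trans iM.
  rewrite -[M in RHS](prednK M0) mulnS; set t := (l * _)%N.
  by move: i0 l0; clear; lia.
- by rewrite (mem_pts charKp) // gy0.
by move=> y; rewrite (mem_pts charKp) // => /eqP gy yy0; rewrite other.
Qed.

Lemma profile_bound g1 g2 c M i l y0 z0 :
  profile g1 g2 c M i l y0 z0 -> (2 * l <= p.-1)%N.
Proof.
case=> -[pE /andP[i0 iM] l0] _ _; have M2 : (2 <= M)%N by exact: leq_ltn_trans iM.
have : (l * 2 <= l * M)%N by rewrite leq_mul2l M2 orbT.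
lia.
Qed.

Lemma size_deriv_lt g1 h1 g2 h2 : collision p g1 h1 g2 h2 -> (size g1^`() < p)%N.
Proof.
move=> C; have [-> _ _ _] := collision_degrees charKp C.
have [[_ h1p _ h2p] _ sk _] := C.
by have := size_subp h2p h1p; case: (size _) sk => // n _.
Qed.

(** A critical value uses up [p.-1 - l], which is at least half of [p.-1], of the degree of the
    derivative of [g1]. That degree is at most [p - 2], too small for two critical values. *)
Lemma critical_value_unique g1 h1 g2 h2 b b' : collision p g1 h1 g2 h2 ->
  (1 < ram g1 b)%N -> (1 < ram g1 b')%N -> g1.[b] = g1.[b'].
Proof.
move=> C b1 b'1; apply/eqP; apply/negPn/negP => neq.
have [[g1p h1p g2p h2p] E _ _] := C.
have [g1'0 _ _ _] := collision_deriv charKp C.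
have [M [i [l [y0 [z0 P]]]]] := exists_profile C b1.
have [M' [i' [l' [y0' [z0' P']]]]] := exists_profile C b'1.
have sum1 := profile_sum g1p P; have sum2 := profile_sum g1p P'.
have bd1 := profile_bound P; have bd2 := profile_bound P'.
have lt := size_deriv_lt C.
set A := pts g1 g1.[b] in sum1; set A' := pts g1 g1.[b'] in sum2.
have [r Er] := closed_field_poly_normal g1^`().
pose B := [seq x <- undup r | (x \notin A) && (x \notin A')].
have uX : uniq (A ++ A' ++ B).
  rewrite !cat_uniq !pts_uniq filter_uniq ?undup_uniq // !andbT /=.
  apply/andP; split; apply/hasPn => x.
    rewrite mem_cat mem_filter => /orP[|/andP[/andP[]]//].
    by rewrite !(mem_pts charKp) // => /eqP->; rewrite eq_sym.
  by rewrite mem_filter => /andP[/andP[]].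
have cover x : root g1^`() x -> x \in A ++ A' ++ B.
  rewrite Er rootZ ?lead_coef_eq0 // root_prod_XsubC => xr.
  by rewrite !mem_cat mem_filter mem_undup xr andbT -negb_or orbA orbN.
have := sum_ram_deriv charKp g1p g1'0 uX cover; rewrite !big_cat /= sum1 sum2.
set S := (\sum_(_ <- _) _)%N; move: (prime_gt1 p_pr) lt bd1 bd2; clear; move: (size _) S => sz S. lia.
Qed.

(** A critical value of [g2] has a profile of its own, which exhibits a point of [g1] of index
    greater than 1 above it; hence it is the critical value of [g1]. *)
Lemma profile_critical g1 h1 g2 h2 b M i l y0 z0 : collision p g1 h1 g2 h2 ->
    (1 < ram g1 b)%N -> profile g1 g2 g1.[b] M i l y0 z0 ->
  [/\ size g1^`() = (p - l)%N,
      forall y, (1 < ram g1 y)%N -> g1.[y] = g1.[b]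
    & forall z, (1 < ram g2 z)%N -> g2.[z] = g1.[b]].
Proof.
move=> C b1 P; have [[g1p h1p g2p h2p] E _ _] := C.
have [g1'0 _ _ _] := collision_deriv charKp C.
have crit1 y : (1 < ram g1 y)%N -> g1.[y] = g1.[b].
  by move=> y1; apply: (critical_value_unique C).
split=> // [|z z1].
  have := sum_ram_deriv charKp g1p g1'0 (pts_uniq g1 g1.[b]).
  rewrite (profile_sum g1p P) => sumE.
  have {}sumE : (p.-1 - l = (size g1^`()).-1)%N.
    apply: sumE => x rx; rewrite (mem_pts charKp) //; apply/eqP/crit1.
    by rewrite (mup_deriv charKp) // ltnS -XsubC_dvd // dvdp_XsubCl.
  have s0 : (0 < size g1^`())%N by rewrite size_poly_gt0.
  have := profile_bound P; move: sumE s0 p_gt0; clear; move: (size _) => sz; lia.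
have [M' [i' [l' [z0' [y0' P']]]]] := exists_profile (collision_sym C) z1.
have [[pE /andP[i0 iM] l0] _ [gy0 _ sz other]] := P'.
have /hasP[y yA /= yy0] : has (fun y => y != y0') (pts g1 g2.[z]).
  apply: contraT; rewrite -all_predC => /allP all0.
  have : (size (pts g1 g2.[z]) <= 1)%N.
    apply: (@uniq_leq_size _ _ [:: y0']); rewrite ?pts_uniq // => y /all0 /=.
    by rewrite negbK inE.
  by rewrite sz ltnS leqn0 => /eqP l'0; rewrite l'0 in l0.
have gy : g1.[y] = g2.[z] by apply/eqP; rewrite -(mem_pts charKp).
by rewrite -gy crit1 // other //; apply: leq_ltn_trans iM.
Qed.

End CriticalValues.

(** * The two families of collisions *)

Section Families.
Variables (K : fieldType) (p : nat).
Hypothesis charKp : p \in [pchar K].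
Implicit Types (w c a s t : K).

Let p_pr : prime p. Proof. exact: pcharf_prime charKp. Qed.
Let p_gt0 : (0 < p)%N. Proof. exact: prime_gt0. Qed.

(* Up to additive constants, the right components of all collisions. The
   members of a collision in [Spoly] share [m] and [w] (they are shifts of the
   subadditive polynomials ['X * ('X^l + c)^m], [l * m = p - 1]); the two members
   of a collision in [Mpoly] are exchanged by [(a, s, t) -> (1 - a, t, s)]. *)
Definition Spoly m (w c : K) : {poly K} :=
  ('X - w%:P) * (('X - w%:P) ^+ (p.-1 %/ m) + c%:P) ^+ m.

Definition Mpoly m (a s t : K) : {poly K} :=
  (1 - a) *: (('X - s%:P) ^+ m * ('X - t%:P) ^+ (p - m)) + a *: 'X^p.

(** As [n = - m] in [K], the product rule leaves the factor [m ('X - t) + n ('X - s)], a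
    constant. *)
Lemma deriv_two_roots m n (s t : K) : (m + n)%N = p -> (0 < m)%N -> (0 < n)%N ->
  (('X - s%:P) ^+ m * ('X - t%:P) ^+ n)^`() =
  (m%:R * (s - t)) *: (('X - s%:P) ^+ m.-1 * ('X - t%:P) ^+ n.-1).
Proof.
move=> mn m0 n0; rewrite derivM !deriv_exp !derivXsubC !mul1r.
have nE : n%:R = - m%:R :> {poly K}.
  apply/eqP; rewrite -addr_eq0 -natrD addnC mn pcharf0 //.
  by rewrite pchar_poly.
rewrite -mul_polyC rmorphM rmorph_nat rmorphB /=.
case: m m0 nE mn => // m _ nE _; case: n n0 nE => // n _ nE.
rewrite [m.+1.-1]/= [n.+1.-1]/= !exprS -(mulr_natr _ m.+1) -(mulr_natr _ n.+1) nE.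
by ring.
Qed.

Lemma natr_predp : p.-1%:R = -1 :> K.
Proof.
by apply/eqP; rewrite -addr_eq0 natr1 prednK // (pcharf0 charKp).
Qed.

(** With [l * m = p.-1], which is -1 in [K], the powers of ['X - w%:P] cancel in the second factor
    and only [c] remains. *)
Lemma deriv_Spoly m w c : (m %| p.-1)%N -> (0 < m)%N ->
  (Spoly m w c)^`() = c *: (('X - w%:P) ^+ (p.-1 %/ m) + c%:P) ^+ m.-1.
Proof.
move=> mp m0; set l := (p.-1 %/ m)%N; rewrite /Spoly -/l.
have ml : (l * m)%N = p.-1 by rewrite divnK.
have l0 : (0 < l)%N.
  by rewrite divn_gt0 // dvdn_leq // -ltnS prednK // prime_gt1.
set A := 'X - w%:P; set B := A ^+ l + c%:P.
have dB : B^`() = A ^+ l.-1 *+ l.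
  by rewrite /B derivD derivC addr0 deriv_exp derivXsubC mul1r.
rewrite derivM derivXsubC mul1r deriv_exp dB -{1}(prednK m0) exprS.
have -> : A * (A ^+ l.-1 *+ l * B ^+ m.-1 *+ m) = (A ^+ l *+ (l * m)) * B ^+ m.-1.
  have -> : A ^+ l = A * A ^+ l.-1 by rewrite -exprS prednK.
  by rewrite mulrnA !mulrnAl !mulrnAr !mulrA.
rewrite -mulrDl ml -mulr_natr.
have -> : p.-1%:R = -1 :> {poly K} by rewrite -(rmorph_nat (@polyC K)) natr_predp rmorphN.
by rewrite mulrN1 /B addrAC subrr add0r mul_polyC.
Qed.

Lemma deriv_Mpoly m a s t : (0 < m < p)%N ->
  (Mpoly m a s t)^`() = ((1 - a) * (m%:R * (s - t))) *:
     (('X - s%:P) ^+ m.-1 * ('X - t%:P) ^+ (p - m).-1).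
Proof.
case/andP=> m0 mp; rewrite derivD !derivZ derivXn -mulr_natr.
rewrite (deriv_two_roots _ _ (subnKC (ltnW mp))) ?subn_gt0 // scalerA.
by rewrite -polyC_natr (pcharf0 charKp) mulr0 scaler0 addr0.
Qed.

Lemma monic_XsubX_addC w c l : (0 < l)%N ->
  ('X - w%:P) ^+ l + c%:P \is monic /\ size (('X - w%:P) ^+ l + c%:P) = l.+1.
Proof.
move=> l0; have lt : (size c%:P < size (('X - w%:P) ^+ l))%N.
  by rewrite size_exp_XsubC (leq_ltn_trans (size_polyC_leq1 _)).
rewrite size_polyDl // size_exp_XsubC monicE lead_coefDl // -monicE.
by rewrite rpredX ?monicXsubC.
Qed.

(** All parameters are read off the derivative: [c] is its leading coefficient and the degree gives
    [m]. For [m = 1] the derivative is constant and [w] is lost. *)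
Lemma Spoly_inj m w c d m' w' c' d' :
    (m %| p.-1)%N -> (m' %| p.-1)%N -> c != 0 -> c' != 0 ->
    Spoly m w c + d%:P = Spoly m' w' c' + d'%:P ->
  [/\ m = m', c = c' & m = 1%N \/ w = w'].
Proof.
move=> mp m'p c0 c'0 E.
have p10 : (0 < p.-1)%N by rewrite -ltnS prednK // prime_gt1.
have m0 := dvdn_gt0 p10 mp; have m'0 := dvdn_gt0 p10 m'p.
have := congr1 (@deriv K) E; rewrite !derivD !derivC !addr0 !deriv_Spoly //.
set l := (p.-1 %/ m)%N; set l' := (p.-1 %/ m')%N => dE.
have ml : (l * m)%N = p.-1 by rewrite divnK.
have ml' : (l' * m')%N = p.-1 by rewrite divnK.
have l0 : (0 < l)%N by rewrite divn_gt0 // dvdn_leq.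
have l'0 : (0 < l')%N by rewrite divn_gt0 // dvdn_leq.
have [Bm sB] := monic_XsubX_addC w c l0; have [B'm sB'] := monic_XsubX_addC w' c' l'0.
set B := _ + c%:P in dE Bm sB; set B' := _ + c'%:P in dE B'm sB'.
have cc' : c = c'.
  have := congr1 lead_coef dE; rewrite !lead_coefZ.
  by rewrite !(monicP (rpredX _ _)) ?mulr1.
have ll' : l = l'.
  have := congr1 (size \o val) dE; rewrite /= !size_scale //.
  rewrite (size_monic_exp _ Bm sB) (size_monic_exp _ B'm sB') => -[].
  have e1 : (l * m.-1 + l = p.-1)%N by rewrite -mulnSr prednK.
  have e2 : (l' * m'.-1 + l' = p.-1)%N by rewrite -mulnSr prednK.
  by move: e1 e2; move: (l * _)%N (l' * _)%N; clear; lia.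
have mm' : m = m'.
  by apply/eqP; rewrite -(eqn_pmul2l l0) ml ll' ml'.
split=> //; have [->|m1] := eqVneq m 1%N; first by left.
right; have {dE}dE : B ^+ m.-1 = B' ^+ m.-1.
  by move: dE; rewrite cc' mm' => /(scalerI c'0).
have m2 : (1 < m)%N by rewrite ltn_neqAle eq_sym m1.
have B0 := monic_neq0 Bm; have B'0 := monic_neq0 B'm.
(* Equality of logarithmic derivatives, which removes the exponent; evaluating the result at [w]
   will give [w = w']. *)
have dBB : B^`() * B' = B'^`() * B.
  have := congr1 (@deriv K) dE; rewrite !deriv_exp -[LHS]mulr_natr -[RHS]mulr_natr => /mulIf eqd.
  have {}eqd := eqd _; have m1n0 : m.-1%:R != 0 :> {poly K}.
    rewrite -polyC_natr polyC_eq0 (natf_small_neq0 charKp) //.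
    have := dvdn_leq p10 mp; move: m2 p10; clear; lia.
  have {}eqd := eqd m1n0.
  have nz : B ^+ m.-2 != 0 by rewrite expf_neq0.
  have eqE (D : {poly K}) : D ^+ m.-1 = D * D ^+ m.-2.
    by rewrite -exprS prednK // -ltnS prednK.
  apply: (mulIf nz); rewrite mulrAC eqd -[RHS]mulrA -eqE dE eqE.
  by rewrite mulrAC mulrA.
have dB : B^`() = ('X - w%:P) ^+ l.-1 *+ l.
  by rewrite /B derivD derivC addr0 deriv_exp derivXsubC mul1r.
have dB' : B'^`() = ('X - w'%:P) ^+ l.-1 *+ l.
  by rewrite /B' -ll' derivD derivC addr0 deriv_exp derivXsubC mul1r.
have lK : l%:R != 0 :> {poly K}.
  rewrite -polyC_natr polyC_eq0 (natf_small_neq0 charKp) // l0 /=.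
  have : (l <= p.-1)%N by rewrite -ml leq_pmulr.
  by move: p10; clear; lia.
have {dBB} : ('X - w%:P) ^+ l.-1 * B' = ('X - w'%:P) ^+ l.-1 * B.
  apply: (mulIf lK); rewrite !mulr_natr -!mulrnAl -dB -dB'; exact: dBB.
rewrite /B /B' -ll' -cc'; case: l l0 {ml B sB Bm B' sB' B'm dE B0 B'0 dB dB' lK ll'} => // -[|l] _ /=.
  rewrite !expr0 !mul1r !expr1 => /addIr /addrI /oppr_inj /polyC_inj -> //.
move=> /(congr1 (fun u => u.[w])); rewrite !hornerE subrr !expr0n mul0r /= add0r.
by move/esym/eqP; rewrite mulf_eq0 (negPf c0) orbF expf_eq0 /= subr_eq0 => /eqP.
Qed.

End Families.

(** * Identities of composition in the two families *)

Section FamilyLaws.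
Variables (K : fieldType) (p : nat).
Hypothesis charKp : p \in [pchar K].
Implicit Types (w c a s t : K) (g h u v : {poly K}).

Let p_pr : prime p. Proof. exact: pcharf_prime charKp. Qed.
Let p_gt0 : (0 < p)%N. Proof. exact: prime_gt0. Qed.

Lemma deriv_addC u c : (u + c%:P)^`() = u^`().
Proof. by rewrite derivD derivC addr0. Qed.

Lemma mup_two_roots (k s t x : K) i j : k != 0 ->
  mup x (k *: (('X - s%:P) ^+ i * ('X - t%:P) ^+ j)) =
  ((if s == x then i else 0) + (if t == x then j else 0))%N.
Proof.
move=> k0; rewrite -mul_polyC mupMr ?rootC // mupM ?expf_neq0 ?polyXsubC_eq0 //.
by rewrite !mup_XsubCX.
Qed.

Lemma Mpoly_coef_neq0 m a s t : (0 < m < p)%N -> s != t -> a != 1 ->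
  (1 - a) * (m%:R * (s - t)) != 0.
Proof.
move=> mp st a1; apply: mulf_neq0; first by rewrite subr_eq0 eq_sym.
by rewrite mulf_neq0 ?subr_eq0 // (natf_small_neq0 charKp).
Qed.

(** The derivative has a root of order [m.-1] at [s] and one of order [(p - m).-1] at [t]; the
    condition [2 * m < p] tells them apart. The leading coefficient then gives [a]. *)
Lemma Mpoly_inj m a s t d m' a' s' t' d' :
    (1 < m)%N -> (2 * m < p)%N -> s != t -> a != 1 ->
    (1 < m')%N -> (2 * m' < p)%N -> s' != t' -> a' != 1 ->
    Mpoly p m a s t + d%:P = Mpoly p m' a' s' t' + d'%:P ->
  [/\ m = m', a = a', s = s' & t = t'].
Proof.
move=> m1 mp st a1 m'1 m'p s't' a'1 E.
have mp' : (0 < m < p)%N by move: m1 mp; clear; lia.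
have m'p' : (0 < m' < p)%N by move: m'1 m'p; clear; lia.
have k0 := Mpoly_coef_neq0 mp' st a1; have k'0 := Mpoly_coef_neq0 m'p' s't' a'1.
have := congr1 (@deriv K) E; rewrite !deriv_addC !(deriv_Mpoly charKp) // => dE.
have mupE x : ((if s == x then m.-1 else 0) + (if t == x then (p - m).-1 else 0) =
   (if s' == x then m'.-1 else 0) + (if t' == x then (p - m').-1 else 0))%N.
  by rewrite -(mup_two_roots s t x _ _ k0) dE mup_two_roots.
have [ss' mm'] : s = s' /\ m = m'.
  have := mupE s; rewrite eqxx [t == s]eq_sym (negPf st) addn0.
  have [ss|ns] := eqVneq s' s.
    rewrite -ss [t' == _]eq_sym (negPf s't') addn0 => mE; split=> //.
    by move: mE m1 m'1; clear; lia.
  by case: (t' == s); move: m1 mp m'1 m'p; clear; lia.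
subst s' m'; have tt' : t = t'.
  have := mupE t; rewrite eqxx (negPf st) !add0n.
  by case: eqP => [//|_]; move: m1 mp; clear; lia.
subst t'; split=> //; move/eqP: dE; rewrite -subr_eq0 -scalerBl scaler_eq0.
rewrite [X in _ || X]negbTE ?orbF; last first.
  by rewrite mulf_neq0 ?expf_neq0 ?polyXsubC_eq0.
rewrite -mulrBl mulf_eq0 => /orP[|]; last first.
  by move: k0; rewrite mulf_eq0 negb_or => /andP[_ /negPf->].
by rewrite subr_eq0 => /eqP/addrI/oppr_inj.
Qed.

(** Equal degrees of the derivatives force [l = 1]; then one derivative has a single root and the
    other has the two roots [s] and [t]. *)
Lemma Spoly_neq_Mpoly m w c d m' a s t d' :
    (m %| p.-1)%N -> c != 0 ->
    (1 < m')%N -> (2 * m' < p)%N -> s != t -> a != 1 ->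
  Spoly p m w c + d%:P <> Mpoly p m' a s t + d'%:P.
Proof.
move=> mp c0 m'1 m'p st a1 E.
have p10 : (0 < p.-1)%N by rewrite -ltnS prednK // prime_gt1.
have m0 := dvdn_gt0 p10 mp.
have m'p' : (0 < m' < p)%N by move: m'1 m'p; clear; lia.
have k0 := Mpoly_coef_neq0 m'p' st a1.
have := congr1 (@deriv K) E; rewrite !deriv_addC (deriv_Spoly charKp) //.
rewrite (deriv_Mpoly charKp) //; set l := (p.-1 %/ m)%N => dE.
have ml : (l * m)%N = p.-1 by rewrite divnK.
have l0 : (0 < l)%N by rewrite divn_gt0 // dvdn_leq.
have [Bm sB] := monic_XsubX_addC w c l0.
have l1 : l = 1%N.
  have := congr1 (size \o val) dE; rewrite /= !size_scale // (size_monic_exp _ Bm sB).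
  rewrite size_monicM ?monic_neq0 ?rpredX ?monicXsubC // !size_exp_XsubC => sE.
  have e1 : (l * m.-1 + l = p.-1)%N by rewrite -mulnSr prednK.
  by move: sE e1 m'1 m'p; move: (l * m.-1)%N; clear; lia.
have rB x : mup x (((1 - a) * (m'%:R * (s - t))) *:
    (('X - s%:P) ^+ m'.-1 * ('X - t%:P) ^+ (p - m').-1)) != 0%N -> x = w - c.
  rewrite -dE -lt0n -XsubC_dvd ?scaler_eq0 ?negb_or ?c0 ?expf_neq0 ?monic_neq0 //.
  rewrite dvdp_XsubCl rootZ // l1 expr1 /root horner_exp expf_eq0 !hornerE => /andP[_ /eqP].
  by move=> /eqP; rewrite -addrA addr_eq0 opprD opprK => /eqP.
have sw : s = w - c.
  apply: rB; rewrite mup_two_roots // eqxx; move: m'1; clear; lia.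
have tw : t = w - c.
  apply: rB; rewrite mup_two_roots // eqxx (negPf st); move: m'1 m'p; clear; lia.
by rewrite sw tw eqxx in st.
Qed.

Lemma Spoly_comp m w c u : Spoly p m w c \Po u =
  (u - w%:P) * ((u - w%:P) ^+ (p.-1 %/ m) + c%:P) ^+ m.
Proof.
rewrite /Spoly comp_polyM rmorphXn /= comp_polyB comp_polyX comp_polyC.
by rewrite comp_polyD rmorphXn /= comp_polyB comp_polyX !comp_polyC.
Qed.

(** The composition depends on [c] and [c'] only through [c ^+ p + c'] and [c * c'], which is the
    source of the collisions. The reason is that [B * B ^+ (m * l)] is [B ^+ p], to which additivity
    applies. *)
Lemma comp_Spoly m w c c' : (m %| p.-1)%N -> let l := (p.-1 %/ m)%N in
  Spoly p m 0 c' \Po Spoly p m w c =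
  ('X - w%:P) * (('X - w%:P) ^+ (l * p.+1)
     + (c ^+ p + c')%:P * ('X - w%:P) ^+ l + (c * c')%:P) ^+ m.
Proof.
move=> mp l; have ml : (m * l)%N = p.-1 by rewrite mulnC divnK.
rewrite Spoly_comp subr0 /Spoly -/l; set A := 'X - w%:P; set B := A ^+ l + c%:P.
have charP : p \in [pchar {poly K}] by rewrite pchar_poly.
have Bp : B * B ^+ (m * l) = A ^+ (l * p) + (c ^+ p)%:P.
  rewrite -exprS ml prednK // /B -!(pFrobenius_autE charP) rmorphD /= !pFrobenius_autE.
  by rewrite -exprM polyC_exp.
rewrite -mulrA -exprMn; congr (_ * _ ^+ _).
rewrite exprMn -exprM mulrDr mulrCA Bp mulnSr exprD rmorphD rmorphM /= /B.
by ring.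
Qed.

Definition orig u := u - u.[0]%:P.

Lemma orig_coef0 u : (orig u)`_0 = 0.
Proof. by rewrite -horner_coef0 /orig !hornerE subrr. Qed.

Lemma orig_horner0 u : (orig u).[0] = 0.
Proof. by rewrite horner_coef0 orig_coef0. Qed.

Lemma orig_addC u c : orig (u + c%:P) = orig u.
Proof. by rewrite /orig !hornerE rmorphD /=; ring. Qed.

Lemma orig_id u : u`_0 = 0 -> orig u = u.
Proof. by rewrite /orig horner_coef0 => ->; rewrite subr0. Qed.

Lemma comp_orig u h : h.[0] = 0 -> orig u \Po h = orig (u \Po h).
Proof. by move=> h0; rewrite /orig comp_polyB comp_polyC horner_comp h0. Qed.

Definition Sright m w c := orig (Spoly p m w c).
(** The center is moved by the constant that [Sright] subtracts, so that composing restores center 0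
    on top of the unshifted [Spoly]. *)
Definition Sleft m w c' c := orig (Spoly p m (- (Spoly p m w c).[0]) c').

Lemma comp_Sleft_Sright m w c c' :
  Sleft m w c' c \Po Sright m w c = orig (Spoly p m 0 c' \Po Spoly p m w c).
Proof.
rewrite comp_orig ?orig_horner0 //; congr orig.
by rewrite !Spoly_comp /Sright /orig polyCN opprK subrK subr0.
Qed.

Lemma S_collision m w c c' d d' : (m %| p.-1)%N ->
    c ^+ p + c' = d ^+ p + d' -> c * c' = d * d' ->
  Sleft m w c' c \Po Sright m w c = Sleft m w d' d \Po Sright m w d.
Proof.
by move=> mp E1 E2; rewrite !comp_Sleft_Sright !comp_Spoly // E1 E2.
Qed.

Definition Mright m a s t := orig (Mpoly p m a s t).
(** The exponents are opposite to those of [Mpoly]: the factor of [Mright] at [t] has order [p - m]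
    and is raised to the power [m], the one at [s] has order [m] and is raised to the power
    [p - m]. *)
Definition Mleft m a s t :=
  orig (('X - (Mright m a s t).[t]%:P) ^+ m * ('X - (Mright m a s t).[s]%:P) ^+ (p - m)).

(** The identity ['X^p - t ^+ p = ('X - t) ^+ p] lets the second summand share the factor
    [('X - t) ^+ (p - m)]. *)
Lemma Mpoly_subt m a s t : (0 < m < p)%N ->
  Mpoly p m a s t - (Mpoly p m a s t).[t]%:P =
  ((1 - a) *: ('X - s%:P) ^+ m + a *: ('X - t%:P) ^+ m) * ('X - t%:P) ^+ (p - m).
Proof.
move=> /andP[m0 mp].
have charP : p \in [pchar {poly K}] by rewrite pchar_poly.
have -> : (Mpoly p m a s t).[t] = a * t ^+ p.
  by rewrite /Mpoly !hornerE subrr expr0n subn_eq0 leqNgt mp /= ?mulr0n !mulr0 add0r.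
rewrite mulrDl -!scalerAl -exprD subnKC; last exact: ltnW.
rewrite -!(pFrobenius_autE charP) rmorphB /= !pFrobenius_autE -polyC_exp.
by rewrite /Mpoly scalerBr rmorphM /= -[in RHS]mul_polyC -!mul_polyC; ring.
Qed.

Lemma Mpoly_subs m a s t : (0 < m < p)%N ->
  Mpoly p m a s t - (Mpoly p m a s t).[s]%:P =
  ((1 - a) *: ('X - t%:P) ^+ (p - m) + a *: ('X - s%:P) ^+ (p - m)) * ('X - s%:P) ^+ m.
Proof.
move=> /andP[m0 mp]; have := @Mpoly_subt (p - m) a t s.
rewrite subKn ?(ltnW mp) // => <-; first by rewrite /Mpoly subKn ?(ltnW mp) // [_ ^+ m * _]mulrC.
by rewrite subn_gt0 mp /= -[ltnRHS]subn0 ltn_sub2l.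
Qed.

(** In the factorizations at [s] and [t] the exchange preserves the two cofactors, while ['X - s]
    and ['X - t] both end up with exponent [m * (p - m)]. *)
Lemma M_collision m a s t : (0 < m < p)%N ->
  Mleft m a s t \Po Mright m a s t =
  Mleft m (1 - a) t s \Po Mright m (1 - a) t s.
Proof.
move=> mp; rewrite !comp_orig ?orig_horner0 //; congr orig.
rewrite !comp_polyM !rmorphXn /= !comp_polyB !comp_polyX !comp_polyC.
have sub b x y z : Mright m b x y - (Mright m b x y).[z]%:P =
    Mpoly p m b x y - (Mpoly p m b x y).[z]%:P.
  by rewrite /Mright /orig !hornerE rmorphB /=; ring.
rewrite !sub !Mpoly_subt ?Mpoly_subs //.
have -> : 1 - (1 - a) = a by ring.
rewrite !exprMn -!exprM [(m * (p - m))%N]mulnC.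
rewrite [a *: ('X - t%:P) ^+ m + _]addrC [a *: ('X - s%:P) ^+ (p - m) + _]addrC.
by ring.
Qed.

(** Right components determine left ones, so a left component is identified by exhibiting one
    solution. For the differences, [u \Po h1 = v \Po h2]; if [v] were not constant,
    [v \Po (h1 + k) - v \Po h1] would have degree prime to [p] although it is a polynomial in
    [h1]. *)
Lemma collision_left_unique g1 h1 g2 h2 g1' g2' :
    monic_deg p g1 -> monic_deg p g2 -> monic_deg p g1' -> monic_deg p g2' ->
    monic_deg p h1 -> monic_deg p h2 -> g2`_0 = 0 -> g2'`_0 = 0 ->
    (1 < size (h2 - h1)%R)%N ->
    g1 \Po h1 = g2 \Po h2 -> g1' \Po h1 = g2' \Po h2 ->
  g1 = g1'.
Proof.
move=> g1p g2p g1'p g2'p h1p h2p g20 g2'0 sk E E'.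
have [h1m sh1] : h1 \is monic /\ size h1 = p.+1 by case/andP: h1p => ? /eqP.
set k := h2 - h1 in sk.
have skp : (size k <= p)%N by exact: size_subp.
set v := g2 - g2'; set u := g1 - g1'.
have uv : u \Po h1 = v \Po h2 by rewrite !comp_polyB E E'.
have svp : (size v <= p)%N by exact: size_subp.
have v0 : v = 0.
  case sv : (size v) svp => [|[|n]] svp.
  - by apply/eqP; rewrite -size_poly_eq0 sv.
  - by rewrite [v]size1_polyC ?sv // coefB g20 g2'0 subr0.
  have [r sr] : exists r, size k = r.+2 by case: (size k) sk => [|[|r]] // _; exists r.
  rewrite sr in skp.
  have := size_comp_polyDB charKp h1m sh1 sr _ sv svp.
  have -> : h1 + k = h2 by rewrite /k addrC subrK.
  rewrite -uv -comp_polyB => /(_ skp).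
  have [->|uv0] := eqVneq (u - v) 0; first by rewrite comp_poly0 size_poly0.
  rewrite (size_comp_monic charKp sh1) // => -[] eq.
  have := congr1 (modn^~ p) eq; rewrite modnMr mulnC modnMDl modn_small //.
move: uv; rewrite v0 comp_poly0 => /eqP; rewrite comp_poly_eq0 ?sh1 ?ltnS //.
by rewrite subr_eq0 => /eqP.
Qed.

End FamilyLaws.

(** * Classification of collisions *)

Section Classification.
Variables (K : closedFieldType) (p : nat).
Hypothesis charKp : p \in [pchar K].
Implicit Types (q g h : {poly K}) (a b c x y z w : K).

Let p_pr : prime p. Proof. exact: pcharf_prime charKp. Qed.
Let p_gt0 : (0 < p)%N. Proof. exact: prime_gt0. Qed.

(* The coefficient of degree [i] of the left-hand side is [(1 + i M) H_i], and
   [1 + i M] is nonzero modulo [p] for [i < l]. *)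
Lemma ode_monomial (H : {poly K}) l M c : p = (1 + l * M)%N -> (0 < l)%N -> (0 < M)%N ->
    H \is monic -> size H = l.+1 -> H + M%:R *: (H^`() * 'X) = c%:P ->
  H = 'X^l + c%:P.
Proof.
move=> pE l0 M0 Hm sH ode.
have coefE i : H`_i * (1 + i * M)%:R = c *+ (i == 0%N).
  have := congr1 (fun u : {poly K} => u`_i) ode.
  rewrite coefD coefZ coefMX coef_deriv coefC natrD natrM mulr1n.
  case: i => [|i] /=; first by rewrite mulr0 addr0 => ->; rewrite mul0r addr0 mulr1.
  by move=> Ei; rewrite mulr0n -[RHS]Ei -mulr_natr; ring.
apply/polyP=> i; rewrite coefD coefXn coefC.
have [->|i0] := eqVneq i 0%N.
  by rewrite eq_sym (gtn_eqF l0) add0r; have := coefE 0%N; rewrite mul0n addn0 mulr1 mulr1n.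
rewrite addr0; have [lt|gt|->] := ltngtP i l.
- have := coefE i; rewrite (negPf i0) mulr0n => /eqP; rewrite mulf_eq0.
  case/orP=> [/eqP//|]; rewrite (negPf (natf_small_neq0 charKp _)) //.
  by rewrite pE !add1n ltnS leq0n ltnS ltn_pmul2r.
- by rewrite nth_default // sH.
by move/monicP: Hm; rewrite /lead_coef sH.
Qed.

(** All critical points of [h1] lie above [y0] and have index [M]; counting them gives
    [h1 - y0 = ('X - w) * H ^+ M] with [H] of degree [l]. The derivative has the degree of
    [H ^+ M.-1], so its cofactor is constant: a differential equation for [H], solved by
    [ode_monomial]. *)
Lemma S_component g1 h1 g2 h2 b M l y0 z0 w : collision p g1 h1 g2 h2 ->
    (1 < ram g1 b)%N -> profile p g1 g2 g1.[b] M 1 l y0 z0 ->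
    h1.[w] = y0 -> h2.[w] = z0 -> ram h1 w = 1%N ->
  exists2 c, c != 0 & h1 = Spoly p M w c + y0%:P.
Proof.
move=> C b1 P hw h2w rw; have [[g1p h1p g2p h2p] E _ _] := C.
have [_ h1'0 _ _] := collision_deriv charKp C.
have [sg1 crit1 crit2] := profile_critical charKp C b1 P.
have [[pE /andP[_ M1] l0] [gy0 ry0 sz1 other1] [gz0 rz0 sz2 other2]] := P.
have M0 : (0 < M)%N by exact: ltnW.
have sh1 := monic_deg_size_gt1 charKp h1p.
have gh x : g2.[h2.[x]] = g1.[h1.[x]] by rewrite -!horner_comp E.
(* [x] must be the exceptional point of [ram_structure], where the index of [g1] is not divisible by
   [M]; only [y0] has such an index. *)
have crit_h x : (1 < ram h1 x)%N -> h1.[x] = y0 /\ ram h1 x = M.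
  move=> rx; have r2 : (1 < ram g2 h2.[x])%N.
    have := ram_gt0 h2.[x] (monic_deg_size_gt1 charKp g2p).
    rewrite leq_eqVlt => /orP[/eqP/esym r21|//].
    by rewrite (ram_structure1 charKp C r21) in rx.
  have g2h := crit2 _ r2.
  have h2z0 : h2.[x] != z0 by apply: contraTneq r2 => ->; rewrite rz0.
  have rM := other2 _ g2h h2z0.
  have [x0 [hx0 rx0 nd _ only]] := ram_structure charKp C r2.
  have xx0 : x = x0.
    by apply/eqP; apply: contraLR rx => nx; rewrite (only x).
  rewrite -xx0 rM in rx0 nd; split=> //.
  apply/eqP; apply: contraR nd => ny; rewrite other1 ?dvdnn //.
  by rewrite -gh.
have size_h1' : size h1^`() = (p - l)%N.
  have [e1 e2 _ _] := collision_degrees charKp C.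
  by rewrite e2 -e1.
pose A := pts h1 y0.
have sumA : (\sum_(x <- A) ram h1 x = p)%N by exact: sum_ram.
have sizeA : size A = l.+1.
  have : (\sum_(x <- A) (ram h1 x).-1 = (size h1^`()).-1)%N.
    apply: (sum_ram_deriv charKp) => //; first exact: pts_uniq.
    move=> x rx; rewrite (mem_pts charKp) //; apply/eqP.
    have [] // := crit_h x; rewrite (mup_deriv charKp) // ltnS.
    by rewrite -XsubC_dvd // dvdp_XsubCl.
  have -> : (\sum_(x <- A) (ram h1 x).-1 = p - size A)%N.
    rewrite -sumA -[size A]count_predT -sum1_count -sumnB; last by move=> x _; exact: ram_gt0.
    by apply: eq_bigr => x _; rewrite subn1.
  have sA : (size A <= p)%N.
    rewrite -sumA -[size A]count_predT -sum1_count.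
    by apply: leq_sum => x _; exact: ram_gt0.
  rewrite size_h1'; have := profile_bound charKp P; move: sA (prime_gt1 p_pr).
  by clear; move: (size A) => n; lia.
have wA : w \in A by rewrite (mem_pts charKp) // hw.
have rM x : x \in rem w A -> ram h1 x = M.
  move=> xA; have ramle z : z \in rem w A -> (ram h1 z <= M)%N.
    move=> _; have := ram_gt0 z sh1; rewrite leq_eqVlt => /orP[/eqP<-//|/crit_h[_ ->//]].
  have sum0 : (\sum_(x <- rem w A) (M - ram h1 x) = 0)%N.
    rewrite big_seq sumnB // -!big_seq big_const_seq count_predT iter_addn_0.
    have := sumA; rewrite (big_rem w) //= rw pE => /eqP; rewrite eqn_add2l => /eqP->.
    by rewrite size_rem // sizeA mulnC subnn.
  have := ramle x xA; move/eqP: sum0; rewrite (big_rem x) //= addn_eq0 => /andP[+ _].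
  by rewrite subn_eq0 => ? ?; apply/eqP; rewrite eqn_leq; apply/andP.
pose H := \prod_(x <- rem w A) ('X - x%:P).
have Hm : H \is monic by exact: monic_prod_XsubC.
have sH : size H = l.+1 by rewrite (size_prod_XsubC _ id) size_rem // sizeA.
have hE : h1 - y0%:P = ('X - w%:P) * H ^+ M.
  rewrite (fiberE charKp) // -prodr_undup_exp_count -/(pts h1 y0) -/A.
  rewrite (big_rem w) //= -(ram_count charKp h1p hw) rw expr1 -prodrXl; congr (_ * _).
  apply: eq_big_seq => x xA; rewrite -(ram_count charKp h1p) ?rM //.
  by apply/eqP; rewrite -(mem_pts charKp) //; exact: mem_rem xA.
have dE : h1^`() = H ^+ M.-1 * (H + M%:R *: (H^`() * ('X - w%:P))).
  have -> : h1^`() = (h1 - y0%:P)^`() by rewrite derivB derivC subr0.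
  rewrite hE derivM derivXsubC mul1r deriv_exp -{1}(prednK M0) exprS.
  by rewrite scaler_nat -mulr_natr -[in RHS]mulr_natr; ring.
set G := H + _ in dE.
have G0 : G != 0 by apply: contraNneq h1'0; rewrite dE => ->; rewrite mulr0.
have /size_poly1P[c c0 GE] : size G == 1%N.
  have := congr1 (size \o val) dE; rewrite /= size_monicM ?rpredX // size_h1'.
  rewrite (size_monic_exp _ Hm sH) => sE; have : (0 < size G)%N by rewrite size_poly_gt0.
  move: sE; rewrite pE -{1}(prednK M0) mulnS; set t := (l * _)%N.
  by clear; move: (size G) => n; lia.
exists c => //; apply/eqP; rewrite -subr_eq hE /Spoly; apply/eqP.
have -> : (p.-1 %/ M)%N = l by rewrite pE /= mulnK.
congr (_ * _ ^+ _).
(* [ode_monomial] is centered at 0, so [w] is first translated there. *)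
have := @ode_monomial (H \Po ('X + w%:P)) l M c pE l0 M0.
have -> : size (H \Po ('X + w%:P)) = l.+1 by rewrite size_comp_poly2 ?size_XaddC.
have -> : H \Po ('X + w%:P) \is monic.
  by rewrite monicE lead_coef_comp ?size_XaddC // lead_coefXaddC expr1n mulr1 -monicE.
move=> /(_ isT erefl) => ode.
rewrite -[LHS](comp_polyXaddC_K _ w) ode.
  by rewrite comp_polyD comp_polyC rmorphXn /= comp_polyX.
rewrite deriv_comp derivD derivX derivC addr0 mulr1.
rewrite -[RHS](comp_polyC c ('X + w%:P)) -GE /G comp_polyD comp_polyZ comp_polyM.
by rewrite comp_polyB comp_polyX comp_polyC addrK.
Qed.

Lemma deriv0_shape (u : {poly K}) : u^`() = 0 -> (size u <= p.+1)%N ->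
  u = u`_p *: 'X^p + (u`_0)%:P.
Proof.
move=> u'0 su; apply/polyP => i; rewrite coefD coefZ coefXn coefC.
case: i => [|i]; first by rewrite eq_sym (gtn_eqF p_gt0) mulr0 add0r.
rewrite addr0; have [lt|gt|->] := ltngtP i.+1 p; rewrite ?mulr0 ?mulr1 //.
  have := congr1 (fun v : {poly K} => v`_i) u'0.
  rewrite coef_deriv coef0 -mulr_natr => /eqP; rewrite mulf_eq0.
  by rewrite (negPf (natf_small_neq0 charKp _)) // orbF => /eqP.
by rewrite nth_default // (leq_trans su).
Qed.

(** [r] is chosen so that [r *: B] has the same derivative as [h]; the rest has derivative 0 and
    degree at most [p], hence is a multiple of ['X^p] plus a constant. *)
Lemma Mpoly_shape h (k s t : K) m : monic_deg p h -> k != 0 -> s != t ->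
    (0 < m < p)%N ->
    h^`() = k *: (('X - s%:P) ^+ m.-1 * ('X - t%:P) ^+ (p - m).-1) ->
  exists a d, a != 1 /\ h = Mpoly p m a s t + d%:P.
Proof.
move=> hp k0 st /andP[m0 mp] hE.
pose r := k / (m%:R * (s - t)).
have ms0 : m%:R * (s - t) != 0.
  by rewrite mulf_neq0 ?subr_eq0 // (natf_small_neq0 charKp) // m0.
have r0 : r != 0 by rewrite mulf_neq0 ?invr_eq0.
set B := ('X - s%:P) ^+ m * ('X - t%:P) ^+ (p - m).
have Bm : B \is monic by rewrite rpredM ?rpredX ?monicXsubC.
have sB : size B = p.+1.
  rewrite size_monicM ?rpredX ?monicXsubC ?monic_neq0 ?rpredX ?monicXsubC //.
  by rewrite !size_exp_XsubC addSn /= addnS subnKC // ltnW.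
have [hm sh] : h \is monic /\ size h = p.+1 by case/andP: hp => ? /eqP.
have u'0 : (h - r *: B)^`() = 0.
  rewrite derivB derivZ (deriv_two_roots charKp _ _ (subnKC (ltnW mp))) ?subn_gt0 // hE.
  by rewrite scalerA divfK // subrr.
have su : (size (h - r *: B)%R <= p.+1)%N.
  by rewrite (leq_trans (size_polyD _ _)) // size_polyN size_scale // sh sB maxnn.
exists (1 - r), ((h - r *: B)`_0); split.
  by rewrite -subr_eq0 addrAC subrr add0r oppr_eq0.
rewrite /Mpoly -/B; have -> : 1 - (1 - r) = r by ring.
rewrite -addrA.
have -> : 1 - r = (h - r *: B)`_p.
  rewrite coefB coefZ; move/monicP: hm; move/monicP: Bm.
  by rewrite /lead_coef sB sh /= => -> ->; rewrite mulr1.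
by rewrite -(deriv0_shape u'0 su) addrC subrK.
Qed.

(** Here [p = i + M]. The exceptional points [s] and [t] above the two points of [g2] have indices
    [i], [M] for [h1] and, by multiplicativity, [M], [i] for [h2]. This fixes both derivatives up to
    constants and yields parameters [a] and [a']; the last task is to relate these. *)
Lemma M_component g1 h1 g2 h2 b M i y0 z0 : collision p g1 h1 g2 h2 ->
    (1 < ram g1 b)%N -> profile p g1 g2 g1.[b] M i 1 y0 z0 -> (1 < i)%N ->
  exists m a s t d1 d2, [/\ (1 < m)%N /\ (2 * m < p)%N, [/\ s != t, a != 0 & a != 1],
     h1 = Mpoly p m a s t + d1%:P & h2 = Mpoly p m (1 - a) t s + d2%:P].
Proof.
move=> C b1 P i1; have [[g1p h1p g2p h2p] E _ _] := C.
have [_ h1'0 _ h2'0] := collision_deriv charKp C.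
have [sg1 crit1 crit2] := profile_critical charKp C b1 P.
have [[pE /andP[i0 iM] _] [gy0 ry0 sz1 other1] [gz0 rz0 sz2 other2]] := P.
rewrite mul1n in pE.
have M0 : (0 < M)%N by exact: ltnW (leq_ltn_trans i0 iM).
have M1 : (1 < M)%N by exact: ltn_trans iM.
have sh1 := monic_deg_size_gt1 charKp h1p; have sh2 := monic_deg_size_gt1 charKp h2p.
have gh x : g2.[h2.[x]] = g1.[h1.[x]] by rewrite -!horner_comp E.
have rz0' : (1 < ram g2 z0)%N by rewrite rz0.
have [s [hs rs nds _ _]] := ram_structure charKp C rz0'; rewrite rz0 in rs nds.
have gs : g1.[h1.[s]] = g1.[b] by rewrite -gh hs gz0.
have hsy0 : h1.[s] != y0 by apply: contraNneq nds => ->; rewrite ry0.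
have rhs := other1 _ gs hsy0.
have /hasP[z1 z1A /= z10] : has (fun z => z != z0) (pts g2 g1.[b]).
  apply: contraT; rewrite -all_predC => /allP all0.
  have : (size (pts g2 g1.[b]) <= 1)%N.
    apply: (@uniq_leq_size _ _ [:: z0]); rewrite ?pts_uniq // => z /all0 /=.
    by rewrite negbK inE.
  by rewrite sz2.
have gz1 : g2.[z1] = g1.[b] by apply/eqP; rewrite -(mem_pts charKp).
have rz1 := other2 _ gz1 z10.
have rz1' : (1 < ram g2 z1)%N by rewrite rz1.
have [t [ht rt ndt _ _]] := ram_structure charKp C rz1'; rewrite rz1 in rt ndt.
have gt : g1.[h1.[t]] = g1.[b] by rewrite -gh ht gz1.
have hty0 : h1.[t] = y0.
  by apply/eqP; apply: contraR ndt => /(other1 _ gt) ->; exact: dvdnn.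
have st : s != t by apply: contraNneq hsy0 => ->; apply/eqP.
have r2s : ram h2 s = M.
  have := ram_collision charKp s C; rewrite rs rhs hs rz0 mulnC => /eqP.
  by rewrite eqn_pmul2r // => /eqP.
have r2t : ram h2 t = i.
  have := ram_collision charKp t C; rewrite rt hty0 ry0 ht rz1 mulnC => /eqP.
  by rewrite eqn_pmul2r // => /eqP.
have size_h1' : size h1^`() = p.-1.
  by have [e1 -> _ _] := collision_degrees charKp C; rewrite -e1 sg1 subn1.
have size_h2' : size h2^`() = p.-1.
  by have [e1 _ _ ->] := collision_degrees charKp C; rewrite -e1 sg1 subn1.
(* The orders [m.-1] and [(p - m).-1] exhaust the degree [p - 2] of the derivative. *)
have dshape h x y m : monic_deg p h -> h^`() != 0 -> size h^`() = p.-1 -> x != y ->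
    ram h x = m -> ram h y = (p - m)%N -> (0 < m < p)%N ->
  exists2 k, k != 0 & h^`() = k *: (('X - x%:P) ^+ m.-1 * ('X - y%:P) ^+ (p - m).-1).
  move=> hp h'0 sh' xy rx ry /andP[m0 mp].
  set B := _ * _; have Bm : B \is monic by rewrite rpredM ?rpredX ?monicXsubC.
  have dB : B %| h^`().
    rewrite Gauss_dvdp; last by rewrite coprimep_expl ?coprimep_expr // coprimep_XsubC2 // subr_eq0 eq_sym.
    have mx : mup x h^`() = m.-1 by rewrite -rx (mup_deriv charKp).
    have my : mup y h^`() = (p - m).-1 by rewrite -ry (mup_deriv charKp).
    by rewrite -!mup_geq // mx my !leqnn.
  have sB : size B = size h^`().
    rewrite size_monicM ?monic_neq0 ?rpredX ?monicXsubC // !size_exp_XsubC sh' addSn /=.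
    by move: m0 mp; clear; lia.
  have /eqpf_eq[k k0 ->] : h^`() %= B by rewrite eqp_sym -(dvdp_size_eqp dB) sB.
  by exists k.
have ip : (0 < i < p)%N by rewrite i0 pE -[ltnLHS]addn0 ltn_add2l.
have pi : (p - i)%N = M by rewrite pE addKn.
have [k1 k10 h1'E] : exists2 k, k != 0 & h1^`() = k *: (('X - s%:P) ^+ i.-1 * ('X - t%:P) ^+ (p - i).-1).
  by apply: dshape => //; rewrite pi.
have [k2 k20 h2'E] : exists2 k, k != 0 & h2^`() = k *: (('X - t%:P) ^+ i.-1 * ('X - s%:P) ^+ (p - i).-1).
  by apply: dshape => //; rewrite ?pi // eq_sym.
have ts : t != s by rewrite eq_sym.
have [a [d1 [a1 h1E]]] := Mpoly_shape h1p k10 st ip h1'E.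
have [a' [d2 [a'1 h2E]]] := Mpoly_shape h2p k20 ts ip h2'E.
have factor a0 x y d h : h = Mpoly p i a0 x y + d%:P -> h - h.[y]%:P =
    ((1 - a0) *: ('X - x%:P) ^+ i + a0 *: ('X - y%:P) ^+ i) * ('X - y%:P) ^+ (p - i).
  by move=> ->; rewrite -(Mpoly_subt charKp) // !hornerE rmorphD /=; ring.
have a0 : a != 0.
  apply: contraNneq hsy0 => a0; have := congr1 (fun u : {poly K} => u.[s]) (factor _ _ _ _ _ h1E).
  rewrite a0 subr0 scale0r addr0 scale1r !hornerE subrr expr0n gtn_eqF // mulr0n mul0r hty0 => /eqP.
  by rewrite subr_eq0.
exists i, a, s, t, d1, d2; split=> //; first by split=> //; rewrite pE mul2n -addnn ltn_add2l.
suff -> : 1 - a = a' by [].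
have F1 := factor _ _ _ _ _ h1E; have F2 := factor _ _ _ _ _ h2E.
(* A root [x] of [B] is a further point above [y0], simple for [h1] and [h2], so [g2] has index [i]
   at [h2.[x]], which must be [z0]. Both factorizations then give linear equations for
   [(x - s) ^+ i] and [(x - t) ^+ i] with determinant [1 - a - a'], which has to vanish. *)
set B := (_ *: _ + _) in F1.
have s1t : size (h1 - h1.[t]%:P) = p.+1.
  by have [_ /eqP] := andP (monic_deg_subC charKp h1.[t] h1p).
have B0 : B != 0.
  apply/eqP => B0; have := congr1 (size \o val) F1.
  by rewrite /= s1t B0 mul0r size_poly0.
have [x rx] : exists x, root B x.
  apply/closed_rootP; have := congr1 (size \o val) F1 => /=.
  rewrite s1t size_Mmonic ?rpredX ?monicXsubC // size_exp_XsubC addnS /= => sE.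
  apply/eqP => sB; move: sE; rewrite sB.
  by case/andP: ip => i_gt0 ip; move: i_gt0 ip; clear; lia.
have sti : (s - t) ^+ i != 0 by rewrite expf_neq0 // subr_eq0.
have xs : x != s.
  apply: contraTneq rx => ->; rewrite /root !hornerE subrr expr0n gtn_eqF // mulr0n mulr0 add0r.
  by rewrite mulf_neq0.
have xt : x != t.
  apply: contraTneq rx => ->; rewrite /root !hornerE subrr expr0n gtn_eqF // mulr0n mulr0 addr0.
  by apply: mulf_neq0; [rewrite subr_eq0 eq_sym | rewrite expf_neq0 // subr_eq0].
have noncrit h k y z m n : monic_deg p h -> h^`() != 0 -> x != y -> x != z ->
    h^`() = k *: (('X - y%:P) ^+ m * ('X - z%:P) ^+ n) -> ram h x = 1%N.
  move=> hp h'0 xy xz hE; rewrite (mup_deriv charKp) // mupNroot //.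
  have k0 : k != 0 by apply: contraNneq h'0 => k0; rewrite hE k0 scale0r.
  by rewrite hE rootZ // rootM !negb_or; apply/andP; split; rewrite /root !hornerE expf_neq0 // subr_eq0.
have r1x := noncrit _ _ _ _ _ _ h1p h1'0 xs xt h1'E.
have r2x := noncrit _ _ _ _ _ _ h2p h2'0 xt xs h2'E.
have h1x : h1.[x] = y0.
  have := congr1 (fun u : {poly K} => u.[x]) F1; rewrite hornerM (rootP rx) mul0r.
  by rewrite !hornerE hty0 => /eqP; rewrite subr_eq0 => /eqP.
have h2x : h2.[x] = z0.
  have := ram_collision charKp x C; rewrite r1x r2x !mul1n h1x ry0 => iE.
  apply/eqP; apply: contraT => nz; rewrite (other2 _ _ nz) in iE.
    by rewrite iE ltnn in iM.
  by rewrite gh h1x gy0.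
have F2x := congr1 (fun u : {poly K} => u.[x]) F2.
rewrite hs -h2x !hornerE subrr in F2x.
have : (1 - a') * (x - t) ^+ i + a' * (x - s) ^+ i = 0.
  apply/eqP; move/esym/eqP: F2x; rewrite mulf_eq0 => /orP[//|].
  by rewrite expf_eq0 subr_eq0 (negPf xs) andbF.
have : (1 - a) * (x - s) ^+ i + a * (x - t) ^+ i = 0.
  by move/rootP: rx; rewrite !hornerE.
have : (x - s) ^+ i != 0 by rewrite expf_neq0 // subr_eq0.
move: ((x - s) ^+ i) ((x - t) ^+ i) => S T S0 e1 e2.
apply/eqP; rewrite -subr_eq0; apply: contraNT S0 => D0.
have : (1 - a - a') * S = 0.
  have -> : (1 - a - a') * S = (1 - a') * ((1 - a) * S + a * T) - a * ((1 - a') * T + a' * S) by ring.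
  by rewrite e1 e2 !mulr0 subrr.
by move/eqP; rewrite mulf_eq0 (negPf D0).
Qed.

(* [X^p + c X] is the member [m = 1] of the family [Spoly]. *)
Lemma S_component_deriv_const h : monic_deg p h -> size h^`() = 1%N ->
  exists2 c, c != 0 & exists d, h = Spoly p 1 0 c + d%:P.
Proof.
move=> hp /eqP/size_poly1P[c c0 hE]; exists c => //.
have [hm sh] : h \is monic /\ size h = p.+1 by case/andP: hp => ? /eqP.
have p1 := prime_gt1 p_pr.
have u'0 : (h - c *: 'X)^`() = 0 by rewrite derivB derivZ derivX hE alg_polyC subrr.
have su : (size (h - c *: 'X)%R <= p.+1)%N.
  rewrite (leq_trans (size_polyD _ _)) // size_polyN size_scale // sh size_polyX.
  by rewrite geq_max leqnn ltnS ltnW.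
exists ((h - c *: 'X)`_0); rewrite /Spoly divn1 subr0 expr1 mulrDr -exprS prednK //.
have := deriv0_shape u'0 su; rewrite {1}coefB coefZ coefX (gtn_eqF p1) mulr0 subr0.
have -> : h`_p = 1 by move/monicP: hm; rewrite /lead_coef sh.
rewrite scale1r => /(canRL (subrK _)) {1}->.
by rewrite ['X * _]mulrC mul_polyC addrAC.
Qed.

(* If [i > 1], then [i] divides all but one of the indices [M]; as it is prime
   to [M], there is only one of those. *)
Lemma profile_l1 g1 h1 g2 h2 c M i l y0 z0 : collision p g1 h1 g2 h2 ->
  profile p g1 g2 c M i l y0 z0 -> (1 < i)%N -> l = 1%N.
Proof.
move=> C [[pE /andP[i0 iM] l0] [gy0 ry0 sz1 other1] [gz0 rz0 sz2 other2]] i1.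
have [[g1p _ _ _] _ _ _] := C.
have rz0' : (1 < ram g2 z0)%N by rewrite rz0.
have [x [_ _ _ good _]] := ram_structure charKp C rz0'; rewrite rz0 gz0 in good.
apply/eqP; apply: contraTT i1 => l1.
have /hasP[y yA /= /andP[yy0 yx]] :
    has (fun y => (y != y0) && (y != h1.[x])) (pts g1 c).
  apply: contraT; rewrite -all_predC => /allP all0.
  have : (size (pts g1 c) <= 2)%N.
    apply: (@uniq_leq_size _ _ [:: y0; h1.[x]]); rewrite ?pts_uniq // => y /all0 /=.
    by rewrite negb_and !negbK !inE.
  by rewrite sz1 ltnS; case: (l) l0 l1 => [|[]].
move: yA; rewrite (mem_pts charKp) // => /eqP gy.
have := good y gy yx; rewrite (other1 y gy yy0) => iM'.
have ip : (i %| p)%N by rewrite pE dvdn_addr ?dvdnn // dvdn_mull.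
have lt : (i < p)%N by rewrite pE -[ltnLHS]addn0 ltn_add2l muln_gt0 l0 (leq_ltn_trans _ iM).
by rewrite (dvdn_prime_lt p_pr ip lt).
Qed.

(** Without critical points the derivatives are constant, which is the case [m = 1] of [Spoly].
    Otherwise the exceptional index [i] of the profile decides: [i = 1] gives [Spoly] with [m = M],
    and [i > 1] gives [Mpoly]. *)
Theorem collision_classification g1 h1 g2 h2 : collision p g1 h1 g2 h2 ->
  (exists m w c1 c2 d1 d2, [/\ (m %| p.-1)%N /\ (0 < m)%N, c1 != 0, c2 != 0,
     h1 = Spoly p m w c1 + d1%:P & h2 = Spoly p m w c2 + d2%:P]) \/
  (exists m a s t d1 d2, [/\ (1 < m)%N /\ (2 * m < p)%N, [/\ s != t, a != 0 & a != 1],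
     h1 = Mpoly p m a s t + d1%:P & h2 = Mpoly p m (1 - a) t s + d2%:P]).
Proof.
move=> C; have [[g1p h1p g2p h2p] E _ _] := C.
have [e1 e2 _ e3] := collision_degrees charKp C.
have [s1|/closed_rootP[b rb]] := eqVneq (size g1^`()) 1%N.
  have [c1 c10 [d1 h1E]] : exists2 c, c != 0 & exists d, h1 = Spoly p 1 0 c + d%:P.
    by apply: S_component_deriv_const => //; rewrite e2 -e1.
  have [c2 c20 [d2 h2E]] : exists2 c, c != 0 & exists d, h2 = Spoly p 1 0 c + d%:P.
    by apply: S_component_deriv_const => //; rewrite e3 -e1.
  by left; exists 1%N, 0, c1, c2, d1, d2; split; rewrite ?dvd1n.
have [g1'0 h1'0 g2'0 _] := collision_deriv charKp C.
have b1 : (1 < ram g1 b)%N.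
  by rewrite (mup_deriv charKp) // ltnS -XsubC_dvd // dvdp_XsubCl.
have [M [i [l [y0 [z0 P]]]]] := exists_profile charKp C b1.
have [[pE /andP[i0 iM] l0] [gy0 ry0 sz1 other1] [gz0 rz0 sz2 other2]] := P.
have [i1|i1] := leqP i 1; last first.
  right; apply: (M_component C b1 (M := M) (i := i) (y0 := y0) (z0 := z0)) => //.
  by rewrite -(profile_l1 C P i1).
have {}i1 : i = 1%N by apply/eqP; rewrite eqn_leq i1.
rewrite {}i1 in P pE ry0 rz0 iM i0.
(* Since [g2] has index 1 at [z0], the indices of [h1] at the points above [(y0, z0)] add up to 1:
   there is exactly one such point. *)
have [w /andP[/eqP hw /eqP h2w] rw] : exists2 w, (h1.[w] == y0) && (h2.[w] == z0) & ram h1 w = 1%N.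
  have := sum_ram_fiber charKp C (etrans gy0 (esym gz0)); rewrite rz0.
  rewrite -big_filter; case fE: [seq x <- pts h1 y0 | h2.[x] == z0] => [|w s].
    by rewrite big_nil.
  have : w \in [seq x <- pts h1 y0 | h2.[x] == z0] by rewrite fE mem_head.
  rewrite mem_filter (mem_pts charKp) // andbC => wE.
  rewrite big_cons => rE; exists w => //; apply/eqP; rewrite eqn_leq -{1}rE leq_addr /=.
  by rewrite ram_gt0 // (monic_deg_size_gt1 charKp).
have r2w : ram h2 w = 1%N.
  by have := ram_collision charKp w C; rewrite rw hw ry0 h2w rz0 !muln1.
have [c1 c10 h1E] := S_component C b1 P hw h2w rw.
have [b' b'1 gb'] : exists2 b', (1 < ram g2 b')%N & g2.[b'] = g1.[b].
  have /hasP[z zA /= zz0] : has (fun z => z != z0) (pts g2 g1.[b]).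
    apply: contraT; rewrite -all_predC => /allP all0.
    have : (size (pts g2 g1.[b]) <= 1)%N.
      apply: (@uniq_leq_size _ _ [:: z0]); rewrite ?pts_uniq // => z /all0 /=.
      by rewrite negbK inE.
    by rewrite sz2 ltnS leqNgt l0.
  move: zA; rewrite (mem_pts charKp) // => /eqP gz.
  by exists z => //; rewrite other2.
have P' : profile p g2 g1 g2.[b'] M 1 l z0 y0 by rewrite gb'; apply: profile_sym.
have [c2 c20 h2E] := S_component (collision_sym C) b'1 P' h2w hw r2w.
left; exists M, w, c1, c2, y0, z0; split=> //.
by rewrite pE /= dvdn_mull // (leq_ltn_trans _ iM).
Qed.

End Classification.

(** * Descent from the algebraic closure to the finite field *)

Section MapFamilies.
Variables (F K : fieldType) (f : {rmorphism F -> K}) (p : nat).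
Local Notation "u ^f" := (map_poly f u) : ring_scope.

Lemma map_XsubC_exp (w : F) n : (('X - w%:P) ^+ n)^f = ('X - (f w)%:P) ^+ n.
Proof. by rewrite rmorphXn rmorphB /= map_polyX map_polyC. Qed.

Lemma map_Spoly m w c : (Spoly p m w c)^f = Spoly p m (f w) (f c).
Proof.
rewrite /Spoly rmorphM rmorphXn rmorphB rmorphD /= map_XsubC_exp.
by rewrite map_polyX !map_polyC.
Qed.

Lemma map_Mpoly m a s t : (Mpoly p m a s t)^f = Mpoly p m (f a) (f s) (f t).
Proof.
rewrite /Mpoly rmorphD /= !map_polyZ /= rmorphM /= !map_XsubC_exp map_polyXn.
by rewrite rmorphB rmorph1.
Qed.

Lemma map_orig u : (orig u)^f = orig u^f.
Proof. by rewrite /orig rmorphB /= map_polyC !horner_coef0 coef_map. Qed.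

Lemma map_monic_deg u : monic_deg p u^f = monic_deg p u.
Proof. by rewrite /monic_deg map_monic size_map_poly. Qed.

Lemma map_collision g1 h1 g2 h2 : collision p g1 h1 g2 h2 ->
  collision p g1^f h1^f g2^f h2^f.
Proof.
case=> -[g1p h1p g2p h2p] E sk f'; split; rewrite ?map_monic_deg //.
- by rewrite -!map_comp_poly E.
- by rewrite -rmorphB size_map_poly.
by rewrite -map_comp_poly deriv_map map_poly_eq0.
Qed.

End MapFamilies.

Section Descent.
Variables (F : finFieldType) (p : nat).
Hypothesis charFp : p \in [pchar F].

Let p_pr : prime p. Proof. exact: pcharf_prime charFp. Qed.

Lemma exists_frobenius (K : fieldType) n : p \in [pchar K] ->
  exists sigma : {rmorphism K -> K}, forall x, sigma x = x ^+ (p ^ n).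
Proof.
move=> charKp; elim: n => [|n [s sE]]; first by exists idfun => x; rewrite expr1.
exists (pFrobenius_aut charKp \o s : {rmorphism K -> K}) => x /=.
by rewrite sE pFrobenius_autE -exprM expnSr.
Qed.

Lemma fixed_by_card (K : fieldType) (f : {rmorphism F -> K}) y :
  y ^+ #|F| = y -> exists x, y = f x.
Proof.
move=> yq; have := congr1 (map_poly f) (finField_genPoly F).
rewrite rmorphB /= map_polyXn map_polyX rmorph_prod /= => E.
have : root ('X^#|F| - 'X) y by rewrite /root !hornerE yq subrr.
rewrite E /root horner_prod prodf_seq_eq0 => /hasP[x _ /=].
rewrite rmorphB /= map_polyX map_polyC !hornerE subr_eq0 => /eqP yE.
by exists x.
Qed.

(** For [m = 1] the polynomial is an additive polynomial up to a constant, so moving its center only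
    changes the constant. *)
Lemma Spoly1 (K : fieldType) (w c : K) : p \in [pchar K] ->
  orig (Spoly p 1 w c) = orig (Spoly p 1 0 c).
Proof.
move=> charKp; have charP : p \in [pchar {poly K}] by rewrite pchar_poly.
have E x : Spoly p 1 x c = 'X^p + c%:P * 'X - (x ^+ p + c * x)%:P.
  rewrite /Spoly divn1 expr1 mulrDr -exprS prednK ?prime_gt0 //.
  rewrite -!(pFrobenius_autE charP) rmorphB /= !pFrobenius_autE -polyC_exp.
  by rewrite rmorphD rmorphM /=; ring.
by rewrite !E -!polyCN !orig_addC.
Qed.

Theorem collision_classification_fin (g1 h1 g2 h2 : {poly F}) :
    collision p g1 h1 g2 h2 -> h1`_0 = 0 -> h2`_0 = 0 ->
  (exists m w c1 c2, [/\ (m %| p.-1)%N, (m == 1%N) ==> (w == 0), c1 != 0, c2 != 0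
     & h1 = Sright p m w c1 /\ h2 = Sright p m w c2]) \/
  (exists m a s t, [/\ (1 < m)%N, (2 * m < p)%N, [/\ s != t, a != 0 & a != 1],
     h1 = Mright p m a s t & h2 = Mright p m (1 - a) t s]).
Proof.
move=> C h10 h20; have [K [f _]] := countable_algebraic_closure F.
have charKp : p \in [pchar K] by rewrite (fmorph_pchar f).
have [n qE] : exists n, #|F| = (p ^ n)%N.
  by exists (logn p #|F|); exact: (card_pprimeChar charFp).
have [sigma sE] := exists_frobenius n charKp.
have fixF x : sigma (f x) = f x by rewrite sE -qE -rmorphXn expf_card.
have fixed y : sigma y = y -> exists x, y = f x.
  by move=> sy; apply: fixed_by_card; rewrite qE -sE.
have fixP (u : {poly F}) : map_poly sigma (map_poly f u) = map_poly f u.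
  by apply/polyP => i; rewrite !coef_map /= fixF.
have inj : injective (map_poly f) by exact: map_poly_inj.
have [|] := collision_classification charKp (map_collision f C).
  move=> [m [w [c1 [c2 [d1 [d2 [[mp m0] c10 c20 h1E h2E]]]]]]].
  have sS (h : {poly F}) c d : c != 0 -> map_poly f h = Spoly p m w c + d%:P ->
      sigma c = c /\ (m = 1%N \/ sigma w = w).
    move=> c0 hE; have := fixP h; rewrite hE rmorphD /= map_Spoly map_polyC.
    by move=> /(Spoly_inj charKp mp mp)[]; rewrite ?fmorph_eq0.
  have [/fixed[c1' c1E] wE] := sS _ _ _ c10 h1E.
  have [/fixed[c2' c2E] _] := sS _ _ _ c20 h2E.
  left; exists m.
  (* For [m = 1], [sigma] need not fix [w], but by [Spoly1] the center may be replaced by 0. *)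
  have [w' w'1 hS] : exists2 w', (m == 1%N) ==> (w' == 0) &
      forall c, orig (Spoly p m w c) = orig (Spoly p m (f w') c).
    have [->|m1] := eqVneq m 1%N.
      by exists 0; rewrite ?eqxx // => c; rewrite rmorph0 Spoly1.
    have [w' ->] : exists w', w = f w' by case: wE => [m1'|/fixed //]; rewrite m1' in m1.
    by exists w'.
  exists w', c1', c2'; split=> //.
  - by apply: contraNneq c10 => c0; rewrite c1E c0 rmorph0.
  - by apply: contraNneq c20 => c0; rewrite c2E c0 rmorph0.
  split; apply: inj; rewrite map_orig map_Spoly -hS.
    by rewrite -c1E -(orig_addC _ d1) -h1E -map_orig orig_id.
  by rewrite -c2E -(orig_addC _ d2) -h2E -map_orig orig_id.
move=> [m [a [s [t [d1 [d2 [[m1 mp] [st a0 a1] h1E h2E]]]]]]].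
have := fixP h1; rewrite h1E rmorphD /= map_Mpoly map_polyC.
move=> /(Mpoly_inj charKp m1 mp)[] //; rewrite ?(inj_eq (fmorph_inj _)) //.
  by rewrite fmorph_eq1.
move=> _ /fixed[a' aE] /fixed[s' sE'] /fixed[t' tE].
right; exists m, a', s', t'; split=> //.
- split.
  + by apply: contraNneq st => st; rewrite sE' st tE.
  + by apply: contraNneq a0 => a'0; rewrite aE a'0 rmorph0.
  by apply: contraNneq a1 => a'1; rewrite aE a'1 rmorph1.
- apply: inj; rewrite map_orig map_Mpoly -aE -sE' -tE.
  by rewrite -(orig_addC _ d1) -h1E -map_orig orig_id.
apply: inj; rewrite map_orig map_Mpoly rmorphB rmorph1 /= -aE -sE' -tE.
by rewrite -(orig_addC _ d2) -h2E -map_orig orig_id.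
Qed.

End Descent.

(** * Counting collisions of the first family *)

Section AdditiveFibers.
Variables (F : finFieldType) (p : nat).
Hypothesis charFp : p \in [pchar F].
Implicit Types (b c d s : F).

Let p_pr : prime p. Proof. exact: pcharf_prime charFp. Qed.
Let p_gt0 : (0 < p)%N. Proof. exact: prime_gt0. Qed.

(** The right parameters of the partners of the pair with left parameter [b] and right parameter
    [c]: eliminate [b'] from [c ^+ p + b = d ^+ p + b'] and [c * b = d * b'], then cancel
    [d - c]. *)
Definition Ssol b c := [set d : F | [&& d != 0, d != c & b == d * (d - c) ^+ p.-1]].
Definition affsol b c := [set s : F | b * s ^+ p - c * s == 1].
Definition affker b c := [set s : F | b * s ^+ p - c * s == 0].

Lemma exprB_char s1 s2 : (s1 - s2) ^+ p = s1 ^+ p - s2 ^+ p.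
Proof. by rewrite -!(pFrobenius_autE charFp) rmorphB. Qed.

Lemma affsol_neq0 b c s : s \in affsol b c -> s != 0.
Proof.
rewrite inE; apply: contraTneq => ->.
by rewrite expr0n gtn_eqF // mulr0n !mulr0 subr0 eq_sym oner_eq0.
Qed.

(* The substitution [d = c + 1 / s] makes the equation affine over the prime field. *)
Lemma card_Ssol b c : b != 0 -> #|Ssol b c| = #|affsol b c|.
Proof.
move=> b0; rewrite -(card_imset (affsol b c) (f := fun s => c + s^-1)); last first.
  by move=> s1 s2 /addrI/invr_inj.
apply: eq_card => d; rewrite !inE; apply/idP/imsetP => [/and3P[d0 dc /eqP bE]|[s sA ->]].
  have dc0 : d - c != 0 by rewrite subr_eq0.
  exists (d - c)^-1; last by rewrite invrK addrC subrK.
  rewrite inE bE exprVn -{2}(prednK p_gt0) exprS invfM mulrCA -mulrA.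
  by rewrite [_ / _]mulrC mulrA mulrACA; apply/eqP; field; rewrite dc0 expf_neq0.
have s0 := affsol_neq0 sA; move: sA; rewrite inE => /eqP sE.
have e1 : c * s + 1 = b * s ^+ p by rewrite -sE; ring.
have e2 : c + s^-1 = b * s ^+ p.-1.
  by apply: (mulIf s0); rewrite mulrDl mulVf // e1 -mulrA -exprSr prednK.
rewrite {1}e2 mulf_neq0 ?expf_neq0 //= -subr_eq0 addrAC subrr add0r invr_neq0 //=.
by rewrite e2 exprVn mulfK ?expf_neq0.
Qed.

Lemma affker0 b c : 0 \in affker b c.
Proof. by rewrite inE expr0n gtn_eqF // mulr0n !mulr0 subr0. Qed.

Lemma card_affker_le b c : b != 0 -> (#|affker b c| <= p)%N.
Proof.
move=> b0; pose P : {poly F} := b *: 'X^p - c *: 'X.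
have sP : size P = p.+1.
  rewrite /P size_polyDl size_scale // ?size_polyXn // size_polyN.
  by rewrite (leq_ltn_trans (size_scale_leq _ _)) // size_polyX ltnS prime_gt1.
have P0 : P != 0 by rewrite -size_poly_gt0 sP.
rewrite cardE -ltnS -sP max_poly_roots ?enum_uniq //.
by apply/allP => s; rewrite mem_enum inE /root /P !hornerE.
Qed.

(** The kernel consists of roots of a polynomial of degree [p] and is stable under the prime field,
    so one nonzero element already yields [p] of them. *)
Lemma card_affker b c : b != 0 -> #|affker b c| = 1%N \/ #|affker b c| = p.
Proof.
move=> b0; have [E|] := eqVneq (affker b c) [set 0]; first by left; rewrite E cards1.
rewrite eqEsubset sub1set affker0 andbT => /subsetPn[s sK]; rewrite inE => s0.
right; apply/eqP; rewrite eqn_leq card_affker_le //=.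
have <- : #|[set (j%:R * s : F) | j : 'I_p]| = p.
  rewrite card_imset ?card_ord // => i j /(mulIf s0) /eqP ij; apply/val_inj/eqP => /=.
  move: ij; wlog le : i j / (i <= j)%N.
    by move=> H; have [/H//|/ltnW/H {}H] := leqP i j; rewrite eq_sym [(_ == _ :> nat)]eq_sym.
  rewrite eq_sym -subr_eq0 -natrB // -(dvdn_pcharf charFp) => dv.
  rewrite eqn_leq le /= -subn_eq0; move: dv; apply: contraTT; rewrite -lt0n => ?.
  by rewrite gtnNdvd // ltn_subLR // ltn_addl.
apply/subset_leq_card/subsetP => _ /imsetP[j _ ->]; rewrite inE exprMn.
rewrite -(pFrobenius_autE charFp j%:R) rmorph_nat.
by move: sK; rewrite inE => /eqP sK; rewrite mulrCA [c * _]mulrCA -mulrBr sK mulr0.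
Qed.

Lemma card_affsol b c : b != 0 ->
  #|affsol b c| = 0%N \/ #|affsol b c| = #|affker b c|.
Proof.
move=> b0; have [->|[s0 s0A]] := set_0Vmem (affsol b c); first by left; rewrite cards0.
right; rewrite -[RHS](card_imset _ (addrI s0)).
apply: eq_card => s; apply/idP/imsetP => [sA|[k kK ->]].
  exists (s - s0); last by rewrite addrC subrK.
  move: sA s0A; rewrite !inE exprB_char => /eqP sA /eqP s0A.
  have -> : b * (s ^+ p - s0 ^+ p) - c * (s - s0) =
     (b * s ^+ p - c * s) - (b * s0 ^+ p - c * s0) by ring.
  by rewrite sA s0A subrr.
move: s0A kK; rewrite !inE => /eqP s0A /eqP kK.
rewrite -(opprK k) exprB_char -[k in _ - (- k)](opprK k).
have -> : (- k) ^+ p = - k ^+ p by rewrite -sub0r exprB_char expr0n gtn_eqF // sub0r.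
rewrite !opprK.
have -> : b * (s0 ^+ p + k ^+ p) - c * (s0 + k) =
   (b * s0 ^+ p - c * s0) + (b * k ^+ p - c * k) by ring.
by rewrite s0A kK addr0.
Qed.

(** An injective additive map of a finite field is surjective. *)
Lemma card_affsol1 b c : b != 0 -> #|affker b c| = 1%N -> #|affsol b c| = 1%N.
Proof.
move=> b0 k1; have [|->//] := card_affsol c b0.
move=> A0; have /eqP/cards1P[z Kz] := k1.
have z0 : z = 0 by have := affker0 b c; rewrite Kz inE => /eqP.
have inj : injective (fun s => b * s ^+ p - c * s).
  move=> s1 s2 E; apply/eqP; rewrite -subr_eq0 -in_set1 -z0 -Kz inE exprB_char.
  have -> : b * (s1 ^+ p - s2 ^+ p) - c * (s1 - s2) =
     (b * s1 ^+ p - c * s1) - (b * s2 ^+ p - c * s2) by ring.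
  by rewrite E subrr.
have /imsetP[s _ sE] : 1 \in [set b * s ^+ p - c * s | s : F].
  have /eqP -> : [set b * s ^+ p - c * s | s : F] == [set: F].
    by rewrite eqEcard subsetT cardsT (card_imset _ inj) /= leqnn.
  exact: in_setT.
by move/eqP: A0; rewrite cards_eq0 => /eqP/setP/(_ s); rewrite !inE -sE eqxx.
Qed.

(* The possible values of ([#|affsol|], [#|affker|]) are (1, 1), (0, p) and (p, p);
   on these the left-hand side is affine. *)
Lemma deficiency_affsol b c : b != 0 ->
  1 - (1 + #|Ssol b c|%:R)^-1 =
  (2 * #|affsol b c|%:R + p%:R - #|affker b c|%:R) / (2 * (p%:R + 1)) :> rat.
Proof.
move=> b0; rewrite card_Ssol //.
have p1 : p%:R + 1 != 0 :> rat by rewrite natr1 Num.Theory.pnatr_eq0.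
have p1' : 1 + p%:R != 0 :> rat by rewrite addrC.
have [k1|kp] := card_affker c b0.
  by rewrite card_affsol1 // k1; field; rewrite p1.
have [->|->] := card_affsol c b0; rewrite kp; field; rewrite ?p1 ?p1' //.
Qed.

Lemma card_neq0 : #|[pred b : F | b != 0]| = (#|F| - 1)%N.
Proof. by rewrite subn1 -(cardC1 (0 : F)); apply: eq_card => b; rewrite !inE. Qed.

Lemma sum_linear_eq (x s e : F) : s != 0 ->
  (\sum_(c | c != 0%R) (x - c * s == e)%R = (x != e))%N.
Proof.
move=> s0; pose c0 := (x - e) / s.
have eqc c : (x - c * s == e) = (c == c0).
  rewrite /c0 -(inj_eq (mulIf s0) c) divfK // [RHS]eq_sym -[RHS]subr_eq0 -[LHS]subr_eq0.
  by congr (_ == 0); ring.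
under eq_bigr do rewrite eqc.
have -> : (x != e) = (c0 != 0) by rewrite /c0 mulf_eq0 invr_eq0 (negPf s0) orbF subr_eq0.
rewrite big_mkcond (bigD1 c0) //= eqxx big1 ?addn0; first by case: ifP.
by move=> c /negPf->; case: ifP.
Qed.

(** Count triples by [s], which is nonzero: [s] and [b] determine [c], and [c] is nonzero unless
    [b = s ^- p]. This leaves [#|F| - 2] values of [b]. *)
Lemma sum_card_affsol :
  (\sum_(b : F | b != 0%R) \sum_(c : F | c != 0%R) #|affsol b c| = (#|F| - 1) * (#|F| - 2))%N.
Proof.
under eq_bigr do under eq_bigr do rewrite -sum1dep_card big_mkcond /=.
under eq_bigr do rewrite exchange_big /=.
rewrite exchange_big /= (bigID (fun s => s == 0)) /= big_pred1_eq [X in (X + _)%N]big1 ?add0n; last first.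
  move=> b _; rewrite big1 // => c _.
  by rewrite expr0n gtn_eqF // mulr0n !mulr0 subr0 eq_sym oner_eq0.
rewrite -card_neq0 -sum_nat_const; apply: eq_bigr => s s0.
rewrite (eq_bigr (fun b => (b * s ^+ p != 1) : nat)); last first.
  by move=> b _; exact: (sum_linear_eq _ _ s0).
have sp0 : s ^+ p != 0 by rewrite expf_neq0.
have eqb b : (b * s ^+ p == 1) = (b == s ^- p).
  by rewrite -(inj_eq (mulIf sp0) b) mulVf.
under eq_bigr do rewrite eqb.
rewrite -big_mkcondr sum1_card /=.
have -> : (#|F| - 2)%N = #|predC (pred2 (0 : F) (s ^- p))|.
  rewrite -[in LHS](cardC (pred2 0 (s ^- p : F))) card2 eq_sym invr_eq0 sp0.
  by rewrite addKn.
by apply: eq_card => b; rewrite !inE negb_or.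
Qed.

(** [s = 0] solves every equation; for [s != 0], each [b] determines a nonzero [c]. Both parts
    contribute the same number. *)
Lemma sum_card_affker :
  (\sum_(b : F | b != 0%R) \sum_(c : F | c != 0%R) #|affker b c| =
     2 * ((#|F| - 1) * (#|F| - 1)))%N.
Proof.
under eq_bigr do under eq_bigr do rewrite -sum1dep_card big_mkcond /=.
under eq_bigr do rewrite exchange_big /=.
rewrite exchange_big /= (bigID (fun s => s == 0)) /= big_pred1_eq mul2n -addnn; congr addn.
  rewrite -card_neq0 -!sum_nat_const; apply: eq_bigr => b _; rewrite -sum1_card.
  by apply: eq_bigr => c _; rewrite expr0n gtn_eqF // mulr0n !mulr0 subr0 eqxx.
rewrite -card_neq0 -!sum_nat_const; apply: eq_bigr => s s0; rewrite -sum1_card.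
apply: eq_bigr => b b0; rewrite -[RHS]/(nat_of_bool true).
have <- : (b * s ^+ p != 0) = true by rewrite mulf_neq0 ?expf_neq0.
exact: (sum_linear_eq _ _ s0).
Qed.

(** With [q = #|F|], the factor [q p - p - 2] arises from [2 (q - 2) + p (q - 1) - 2 (q - 1)]. *)
Lemma sum_deficiency :
  \sum_(b : F | b != 0) \sum_(c : F | c != 0) (1 - (1 + #|Ssol b c|%:R)^-1) =
  (#|F|%:R - 1) * (#|F|%:R * p%:R - p%:R - 2) / (2 * (p%:R + 1)) :> rat.
Proof.
have q1 : (1 < #|F|)%N by exact: finNzRing_gt1.
have nA := congr1 (fun n => n%:R : rat) sum_card_affsol.
have nK := congr1 (fun n => n%:R : rat) sum_card_affker.
rewrite /= !natrM !natrB ?(ltnW q1) // in nA nK.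
under eq_bigr => b b0 do under eq_bigr => c c0 do rewrite (deficiency_affsol c b0).
under eq_bigr => b b0 do rewrite -mulr_suml !(sumrB, big_split) /= -mulr_sumr.
rewrite -mulr_suml !(sumrB, big_split) /= -mulr_sumr; congr (_ / _).
move: nA nK; rewrite !natr_sum => nA nK.
under [X in 2 * X]eq_bigr do rewrite -natr_sum.
under [X in _ - X]eq_bigr do rewrite -natr_sum.
rewrite nA nK.
under eq_bigr do rewrite sumr_const; rewrite sumr_const card_neq0.
rewrite -[_ *+ (_ - 1) *+ _]mulr_natr -[_ *+ (_ - 1)]mulr_natr natrB ?(ltnW q1) //.
ring.
Qed.

End AdditiveFibers.

(** * The two families as monic original polynomials *)

Section MonicOriginalFamilies.
Variables (K : fieldType) (p : nat).
Hypothesis charKp : p \in [pchar K].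
Implicit Types (w b c a s t : K) (u v g : {poly K}).

Let p_pr : prime p. Proof. exact: pcharf_prime charKp. Qed.
Let p_gt0 : (0 < p)%N. Proof. exact: prime_gt0. Qed.

Lemma monic_deg_orig u : monic_deg p u -> monic_deg p (orig u).
Proof. exact: (monic_deg_subC charKp). Qed.

Lemma monic_deg_Spoly m w c : (m %| p.-1)%N -> monic_deg p (Spoly p m w c).
Proof.
move=> mp; have p10 : (0 < p.-1)%N by rewrite -ltnS prednK // prime_gt1.
have m0 := dvdn_gt0 p10 mp; set l := (p.-1 %/ m)%N.
have l0 : (0 < l)%N by rewrite divn_gt0 // dvdn_leq.
have [Bm sB] := monic_XsubX_addC w c l0.
rewrite /monic_deg /Spoly -/l rpredM ?rpredX ?monicXsubC //=.
rewrite size_monicM ?monicXsubC ?monic_neq0 ?rpredX // size_XsubC.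
by rewrite (size_monic_exp _ Bm sB) /= divnK // prednK.
Qed.

Lemma monic_deg_XsubC_exp m s t : (m <= p)%N ->
  monic_deg p (('X - s%:P) ^+ m * ('X - t%:P) ^+ (p - m)).
Proof.
move=> mp; rewrite /monic_deg rpredM ?rpredX ?monicXsubC //=.
rewrite size_monicM ?rpredX ?monicXsubC ?monic_neq0 ?rpredX ?monicXsubC //.
by rewrite !size_exp_XsubC addnS /= addSn subnKC.
Qed.

Lemma monic_deg_Mpoly m a s t : (m <= p)%N -> monic_deg p (Mpoly p m a s t).
Proof.
move=> mp; have /andP[Bm /eqP sB] := monic_deg_XsubC_exp s t mp.
have coefp : (Mpoly p m a s t)`_p = 1.
  rewrite coefD !coefZ coefXn eqxx mulr1.
  by move/monicP: Bm; rewrite /lead_coef sB /= => ->; rewrite mulr1 subrK.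
have sle : (size (Mpoly p m a s t) <= p.+1)%N.
  rewrite (leq_trans (size_polyD _ _)) // geq_max.
  rewrite (leq_trans (size_scale_leq _ _)) ?sB //=.
  by rewrite (leq_trans (size_scale_leq _ _)) ?size_polyXn.
have sM : size (Mpoly p m a s t) = p.+1.
  apply/eqP; rewrite eqn_leq sle ltnNge; apply/negP => /leq_sizeP/(_ _ (leqnn _)).
  by rewrite coefp => /eqP; rewrite oner_eq0.
by rewrite /monic_deg sM eqxx andbT monicE /lead_coef sM /= coefp.
Qed.

Lemma monic_deg_Sright m w c : (m %| p.-1)%N -> monic_deg p (Sright p m w c).
Proof. by move=> mp; apply/monic_deg_orig/monic_deg_Spoly. Qed.

Lemma monic_deg_Sleft m w b c : (m %| p.-1)%N -> monic_deg p (Sleft p m w b c).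
Proof. by move=> mp; apply/monic_deg_orig/monic_deg_Spoly. Qed.

Lemma monic_deg_Mright m a s t : (m <= p)%N -> monic_deg p (Mright p m a s t).
Proof. by move=> mp; apply/monic_deg_orig/monic_deg_Mpoly. Qed.

Lemma monic_deg_Mleft m a s t : (m <= p)%N -> monic_deg p (Mleft p m a s t).
Proof. by move=> mp; apply/monic_deg_orig/monic_deg_XsubC_exp. Qed.

Lemma orig_eq u v : orig u = orig v -> u + (- u.[0])%:P = v + (- v.[0])%:P.
Proof. by rewrite !polyCN. Qed.

Lemma Sright_inj m w c m' w' c' : (m %| p.-1)%N -> (m' %| p.-1)%N ->
    c != 0 -> c' != 0 -> Sright p m w c = Sright p m' w' c' ->
  [/\ m = m', c = c' & m = 1%N \/ w = w'].
Proof. by move=> mp m'p c0 c'0 /orig_eq; apply: (Spoly_inj charKp). Qed.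

Lemma Mright_inj m a s t m' a' s' t' :
    (1 < m)%N -> (2 * m < p)%N -> s != t -> a != 1 ->
    (1 < m')%N -> (2 * m' < p)%N -> s' != t' -> a' != 1 ->
    Mright p m a s t = Mright p m' a' s' t' ->
  [/\ m = m', a = a', s = s' & t = t'].
Proof. by move=> m1 mp st a1 m'1 m'p s't' a'1 /orig_eq; apply: (Mpoly_inj charKp). Qed.

Lemma Sright_neq_Mright m w c m' a s t :
    (m %| p.-1)%N -> c != 0 -> (1 < m')%N -> (2 * m' < p)%N -> s != t -> a != 1 ->
  Sright p m w c <> Mright p m' a s t.
Proof. by move=> mp c0 m'1 m'p st a1 /orig_eq; apply: (Spoly_neq_Mpoly charKp). Qed.

Lemma Sleft_inj m w b c b' : (m %| p.-1)%N -> b != 0 -> b' != 0 ->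
  Sleft p m w b c = Sleft p m w b' c -> b = b'.
Proof. by move=> mp b0 b'0 /orig_eq /(Spoly_inj charKp mp mp b0 b'0)[]. Qed.

Lemma monic_deg_sub_size u v : u`_0 = 0 -> v`_0 = 0 -> u != v -> (1 < size (u - v)%R)%N.
Proof.
move=> u0 v0; apply: contraNT; rewrite -leqNgt => /size1_polyC E.
by rewrite -subr_eq0 E coefB u0 v0 subrr.
Qed.

(** [c2 * (c2 - c1) ^+ p.-1] and [c1 * (c2 - c1) ^+ p.-1] solve the two equations of [S_collision];
    [collision_left_unique] excludes any other left component. *)
Lemma S_collision_left g1 g2 m w c1 c2 : (m %| p.-1)%N -> c1 != c2 ->
    c1 != 0 -> c2 != 0 ->
    monic_deg p g1 -> monic_deg p g2 -> g2`_0 = 0 ->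
    g1 \Po Sright p m w c1 = g2 \Po Sright p m w c2 ->
  g1 = Sleft p m w (c2 * (c2 - c1) ^+ p.-1) c1.
Proof.
move=> mp c12 c10 c20 g1p g2p g20 E.
apply: (collision_left_unique charKp (h1 := Sright p m w c1) (h2 := Sright p m w c2)
  (g2 := g2) (g2' := Sleft p m w (c1 * (c2 - c1) ^+ p.-1) c2)) => //.
- exact: monic_deg_Sleft.
- exact: monic_deg_Sleft.
- exact: monic_deg_Sright.
- exact: monic_deg_Sright.
- exact: orig_coef0.
- apply: monic_deg_sub_size; rewrite ?orig_coef0 // eq_sym.
  by apply: contraNneq c12 => /(Sright_inj mp mp c10 c20)[_ ->].
apply: (S_collision charKp) => //; last by rewrite mulrCA.
apply/eqP; rewrite -subr_eq0.
have -> : c1 ^+ p + c2 * (c2 - c1) ^+ p.-1 - (c2 ^+ p + c1 * (c2 - c1) ^+ p.-1) =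
  (c2 - c1) * (c2 - c1) ^+ p.-1 - (c2 ^+ p - c1 ^+ p) by ring.
by rewrite -exprS prednK // -!(pFrobenius_autE charKp) rmorphB subrr.
Qed.

Lemma M_collision_left g1 g2 m a s t : (1 < m)%N -> (2 * m < p)%N -> s != t ->
    a != 0 -> a != 1 -> monic_deg p g1 -> monic_deg p g2 -> g2`_0 = 0 ->
    g1 \Po Mright p m a s t = g2 \Po Mright p m (1 - a) t s ->
  g1 = Mleft p m a s t.
Proof.
move=> m1 mp st a0 a1 g1p g2p g20 E.
have mlep : (m <= p)%N by move: mp; clear; lia.
have a'1 : 1 - a != 1 by rewrite -subr_eq0 addrAC subrr add0r oppr_eq0.
have ts : t != s by rewrite eq_sym.
apply: (collision_left_unique charKp (h1 := Mright p m a s t) (h2 := Mright p m (1 - a) t s)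
  (g2 := g2) (g2' := Mleft p m (1 - a) t s)) => //.
- exact: monic_deg_Mleft.
- exact: monic_deg_Mleft.
- exact: monic_deg_Mright.
- exact: monic_deg_Mright.
- exact: orig_coef0.
- apply: monic_deg_sub_size; rewrite ?orig_coef0 //.
  by apply/eqP => /(Mright_inj m1 mp ts a'1 m1 mp st a1)[_ _ ts']; rewrite ts' eqxx in st.
apply: (M_collision charKp); move: m1 mp; clear; lia.
Qed.

End MonicOriginalFamilies.

(** * Counting compositions *)

Lemma sum_inv_fibers (T : finType) (U : eqType) (f : T -> U) :
  \sum_(x : T) (#|[set y | f y == f x]|%:R)^-1 =
    (size (undup [seq f x | x : T]))%:R :> rat.
Proof.
set s := undup _; rewrite -sum1_size natr_sum.
have fs x : f x \in s by rewrite mem_undup map_f ?mem_enum.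
have -> : \sum_(x : T) (#|[set y | f y == f x]|%:R)^-1 =
    \sum_(x : T) \sum_(u <- s | u == f x) (#|[set y | f y == u]|%:R)^-1 :> rat.
  apply: eq_bigr => x _; rewrite big_mkcond (bigD1_seq (f x)) ?undup_uniq //= eqxx.
  by rewrite big1 ?addr0 // => u /negPf->.
under [LHS]eq_bigr do rewrite big_mkcond.
rewrite exchange_big /=; apply: eq_big_seq => u; rewrite mem_undup => /mapP[x _ ->].
rewrite -big_mkcond (eq_bigl (fun y => y \in [set y | f y == f x])); last first.
  by move=> y; rewrite inE eq_sym.
rewrite sumr_const -[LHS]mulr_natr mulVf // Num.Theory.pnatr_eq0 cards_eq0.
by apply/set0Pn; exists x; rewrite inE.
Qed.

Section Pairs.
Variables (F : finFieldType) (p : nat).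
Hypothesis charFp : p \in [pchar F].

Let p_pr : prime p. Proof. exact: pcharf_prime charFp. Qed.
Let p_gt0 : (0 < p)%N. Proof. exact: prime_gt0. Qed.

(* The monic original polynomials of degree [p], encoded by their coefficients
   of degrees [1, ..., p - 1]. *)
Definition mop (v : 'rV[F]_(p.-1)) : {poly F} := 'X^p + 'X * rVpoly v.
Definition mop_inv (u : {poly F}) : 'rV[F]_(p.-1) := \row_i u`_i.+1.

Lemma mop_coef0 v : (mop v)`_0 = 0.
Proof. by rewrite coefD coefXn coefXM eq_sym gtn_eqF // add0r. Qed.

Lemma mop_monic_deg v : monic_deg p (mop v).
Proof.
have lt : (size ('X * rVpoly v)%R < size ('X^p : {poly F}))%N.
  rewrite size_polyXn ltnS; have [->|v0] := eqVneq (rVpoly v) 0; first by rewrite mulr0 size_poly0.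
  rewrite mulrC size_mulX // -[X in (_ <= X)%N](prednK p_gt0) ltnS.
  by rewrite size_poly.
by rewrite /monic_deg /mop size_polyDl // size_polyXn eqxx andbT monicE lead_coefDl // lead_coefXn.
Qed.

Lemma mopK : cancel mop mop_inv.
Proof.
move=> v; apply/rowP => i; rewrite mxE coefD coefXn coefXM /= coef_rVpoly_ord.
by rewrite ltn_eqF ?add0r // -[X in (_ < X)%N](prednK p_gt0) ltnS.
Qed.

Lemma mop_invK u : monic_deg p u -> u`_0 = 0 -> mop (mop_inv u) = u.
Proof.
case/andP=> um /eqP su u0; apply/polyP => -[|i].
  by rewrite mop_coef0 u0.
rewrite coefD coefXn coefXM /= coef_rVpoly.
case: insubP => [j ji jE|].
  by rewrite mxE jE ltn_eqF ?add0r // -[X in (_ < X)%N](prednK p_gt0) ltnS.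
rewrite -leqNgt addr0 leq_eqVlt => /orP[/eqP ip|ip].
  by rewrite -ip prednK // eqxx; move/monicP: um; rewrite /lead_coef su.
by rewrite gtn_eqF ?nth_default ?su //= -[X in (X < _)%N](prednK p_gt0).
Qed.

Lemma mop_inj : injective mop. Proof. exact: can_inj mopK. Qed.

Lemma mop0 : mop 0 = 'X^p.
Proof. by rewrite /mop raddf0 mulr0 addr0. Qed.

Lemma deriv_mop_eq0 v : (mop v)^`() = 0 -> v = 0.
Proof.
move=> v'; apply: mop_inj; rewrite mop0; apply/eqP; rewrite -subr_eq0; apply/eqP.
have sv := size_subXp (mop_monic_deg v).
have : size (mop v - 'X^p)^`() = (size (mop v - 'X^p)).-1 by apply: (size_deriv_small charFp).
rewrite (deriv_subXp charFp) v' size_poly0 => sE.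
have -> : mop v - 'X^p = ((mop v - 'X^p)`_0)%:P.
  by apply: size1_polyC; move: sE; case: (size _) => [|[]].
by rewrite coefB mop_coef0 coefXn eq_sym gtn_eqF // subr0.
Qed.

Definition compp (x : 'rV[F]_(p.-1) * 'rV[F]_(p.-1)) : {poly F} := mop x.1 \Po mop x.2.
Definition same x := [set y | compp y == compp x].

Lemma mop_comp_inj u v w : mop u \Po mop w = mop v \Po mop w -> u = v.
Proof.
have [_ /eqP sw] := andP (mop_monic_deg w).
move=> /eqP; rewrite -subr_eq0 -comp_polyB comp_poly_eq0 ?sw ?ltnS //.
by rewrite subr_eq0 => /eqP/mop_inj.
Qed.

Definition frobv (v : 'rV[F]_(p.-1)) : 'rV[F]_(p.-1) := map_mx (pFrobenius_aut charFp) v.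

Lemma frobv_inj : injective frobv.
Proof. by apply: map_mx_inj; exact: fmorph_inj. Qed.

Lemma mop_expp v : mop v ^+ p = mop (frobv v) \Po mop 0.
Proof.
rewrite (poly_expp charFp) mop0; congr (_ \Po _).
rewrite /mop rmorphD rmorphM /= map_polyXn map_polyX; congr (_ + _ * _).
by rewrite /frobv map_rVpoly.
Qed.

Lemma compp_Frobenius v : compp (0, v) = compp (frobv v, 0).
Proof. by rewrite /compp /= -mop_expp mop0 comp_Xn_poly. Qed.

Lemma deriv_compp_eq0 y : (compp y)^`() = 0 -> y.1 = 0 \/ y.2 = 0.
Proof.
rewrite /compp deriv_comp => /eqP; rewrite mulf_eq0 comp_poly_eq0.
  by case/orP=> /eqP/deriv_mop_eq0; [left | right].
by have [_ /eqP->] := andP (mop_monic_deg y.2); rewrite ltnS.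
Qed.

(** The derivative vanishes, so one component is ['X^p]; injectivity of [p]-th powers, or
    cancellation on the right, determines the other. *)
Lemma same_Frobenius v : same (0, v) = [set (0, v); (frobv v, 0)].
Proof.
have charP : p \in [pchar {poly F}] by rewrite pchar_poly.
apply/setP => -[y1 y2]; rewrite !inE; apply/eqP/orP => [E|[]/eqP[-> ->]//]; last first.
  by rewrite compp_Frobenius.
have d0 : (compp (y1, y2))^`() = 0.
  by rewrite E /compp deriv_comp /= mop0 derivXn -mulr_natr -polyC_natr
             (pcharf0 charFp) mulr0 comp_poly0 mul0r.
case: (deriv_compp_eq0 d0) => /= y0; rewrite y0 in E *; last first.
  right; rewrite compp_Frobenius in E.
  by have /= -> := mop_comp_inj E.
left; move: E; rewrite /compp /= mop0 !comp_Xn_poly => E.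
have : (mop y2 - mop v) ^+ p = 0.
  by rewrite -(pFrobenius_autE charP) rmorphB /= !pFrobenius_autE E subrr.
by move/eqP; rewrite expf_eq0 p_gt0 subr_eq0 => /eqP/mop_inj->.
Qed.

Lemma card_same_Frobenius v : #|same (0, v)| = if v == 0 then 1%N else 2%N.
Proof.
rewrite same_Frobenius cards2 xpair_eqE.
have [->|v0] := eqVneq v 0; first by rewrite /frobv map_mx0 eqxx.
by rewrite andbF.
Qed.

Lemma same_eq x y : compp x = compp y -> same x = same y.
Proof. by move=> E; apply/setP => z; rewrite !inE E. Qed.

Lemma card_same_right0 v : #|same (v, 0)| = if v == 0 then 1%N else 2%N.
Proof.
have [g _ gK] : bijective frobv by exact: injF_bij frobv_inj.
rewrite -(gK v) -(same_eq (compp_Frobenius (g v))) card_same_Frobenius.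
by rewrite -{2}(map_mx0 (pFrobenius_aut charFp)) (inj_eq frobv_inj).
Qed.

Lemma same_collision x y : compp x = compp y -> x != y -> x.1 != 0 -> x.2 != 0 ->
  collision p (mop x.1) (mop x.2) (mop y.1) (mop y.2).
Proof.
move=> E xy x1 x2; split=> //; first by split; exact: mop_monic_deg.
  apply: monic_deg_sub_size; rewrite ?mop_coef0 //.
  apply: contraNneq xy => /mop_inj y2.
  have y1 : x.1 = y.1 by apply: (@mop_comp_inj _ _ x.2); rewrite -{2}y2.
  by rewrite [x]surjective_pairing [y]surjective_pairing y1 y2.
apply/eqP => /deriv_compp_eq0[] /eqP; first by rewrite (negPf x1).
by rewrite (negPf x2).
Qed.

Definition pairS (m : nat) (w b c : F) := (mop_inv (Sleft p m w b c), mop_inv (Sright p m w c)).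
Definition pairM (m : nat) (a s t : F) := (mop_inv (Mleft p m a s t), mop_inv (Mright p m a s t)).

(** For [m = 1] the center has no effect; fixing it to 0 makes the parameters unique. *)
Definition paramS m (w b c : F) :=
  [&& (m %| p.-1)%N, (m == 1%N) ==> (w == 0), b != 0 & c != 0].
(** The bound [2 * m < p] breaks the symmetry between [(m, s, t)] and [(p - m, t, s)]. *)
Definition paramM m (a s t : F) :=
  [&& (1 < m)%N, (2 * m < p)%N, s != t, a != 0 & a != 1].

Lemma mop_pairS m w b c : (m %| p.-1)%N ->
  mop (pairS m w b c).1 = Sleft p m w b c /\ mop (pairS m w b c).2 = Sright p m w c.
Proof.
by move=> mp; split; apply: mop_invK; rewrite ?orig_coef0 //;
  [exact: monic_deg_Sleft | exact: monic_deg_Sright].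
Qed.

Lemma mop_pairM m a s t : (m <= p)%N ->
  mop (pairM m a s t).1 = Mleft p m a s t /\ mop (pairM m a s t).2 = Mright p m a s t.
Proof.
by move=> mp; split; apply: mop_invK; rewrite ?orig_coef0 //;
  [exact: monic_deg_Mleft | exact: monic_deg_Mright].
Qed.

End Pairs.

(** * Sizes of the fibers of composition *)

Section Fibers.
Variables (F : finFieldType) (p : nat).
Hypothesis charFp : p \in [pchar F].
Implicit Types (w b c d a s t : F).

Let p_pr : prime p. Proof. exact: pcharf_prime charFp. Qed.
Let p_gt0 : (0 < p)%N. Proof. exact: prime_gt0. Qed.
Local Notation T := ('rV[F]_(p.-1) * 'rV[F]_(p.-1))%type.
Implicit Types (x y : T).

Lemma pair_mop x (u v : {poly F}) : mop x.1 = u -> mop x.2 = v ->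
  x = (mop_inv p u, mop_inv p v).
Proof. by move=> <- <-; rewrite !(mopK charFp) -surjective_pairing. Qed.

Lemma same_cases x y : compp x = compp y -> x != y -> x.1 != 0 -> x.2 != 0 ->
  (exists m w c1 c2, [/\ (m %| p.-1)%N, (m == 1%N) ==> (w == 0),
     [/\ c1 != 0, c2 != 0 & c1 != c2],
     x = pairS p m w (c2 * (c2 - c1) ^+ p.-1) c1
   & y = pairS p m w (c1 * (c1 - c2) ^+ p.-1) c2]) \/
  (exists m a s t, [/\ paramM p m a s t, x = pairM p m a s t
     & y = pairM p m (1 - a) t s]).
Proof.
move=> E xy x1 x2; have C := same_collision charFp E xy x1 x2.
have [[X1 X2 Y1 Y2] EE sk _] := C.
have o v := mop_coef0 charFp v.
have [|] := collision_classification_fin charFp C (o _) (o _).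
  move=> [m [w [c1 [c2 [mp mw c10 c20 [xE yE]]]]]].
  have c12 : c1 != c2.
    by apply/eqP => cc; move: sk; rewrite xE yE cc subrr size_poly0.
  left; exists m, w, c1, c2; split=> //.
    apply: pair_mop => //; rewrite xE yE in EE.
    by apply: (S_collision_left charFp mp c12 _ _ X1 Y1 _ EE).
  apply: pair_mop => //; rewrite xE yE in EE.
  by apply: (S_collision_left charFp mp _ _ _ Y1 X1 _ (esym EE)); rewrite // eq_sym.
move=> [m [a [s [t [m1 mp [st a0 a1] xE yE]]]]].
right; exists m, a, s, t; split; first by rewrite /paramM m1 mp st a0 a1.
  apply: pair_mop => //; rewrite xE yE in EE.
  by apply: (M_collision_left charFp m1 mp st a0 a1 X1 Y1 _ EE).
apply: pair_mop => //; rewrite xE yE in EE.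
have ts : t != s by rewrite eq_sym.
have a'0 : 1 - a != 0 by rewrite subr_eq0 eq_sym.
have a'1 : 1 - a != 1 by rewrite -subr_eq0 addrAC subrr add0r oppr_eq0.
apply: (M_collision_left charFp m1 mp ts a'0 a'1 Y1 X1 _ _) => //.
by rewrite -EE; congr (_ \Po Mright _ _ _ _ _); ring.
Qed.

(** Read off from additivity of the [p]-th power, which treats [p = 2] along with odd [p]. *)
Lemma signr_predp : (-1) ^+ p.-1 = 1 :> F.
Proof.
have : (-1) ^+ p = -1 :> F by rewrite -(pFrobenius_autE charFp) rmorphN1.
by rewrite -{1}(prednK p_gt0) exprS mulN1r => /oppr_inj.
Qed.

Lemma exprB_predp (c d : F) : (c - d) ^+ p.-1 = (d - c) ^+ p.-1.
Proof. by rewrite -opprB exprNn signr_predp mul1r. Qed.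

Lemma paramS_gt0 m w b c : paramS p m w b c -> (m %| p.-1)%N.
Proof. by case/and4P. Qed.

Lemma paramM_le m a s t : paramM p m a s t -> (m <= p)%N.
Proof. by case/and5P=> _ mp _ _ _; move: mp; clear; lia. Qed.

Lemma pairS_inj m w b c m' w' b' c' : paramS p m w b c -> paramS p m' w' b' c' ->
  pairS p m w b c = pairS p m' w' b' c' -> [/\ m = m', w = w', b = b' & c = c'].
Proof.
move=> P P' E; have mp := paramS_gt0 P; have m'p := paramS_gt0 P'.
have [L R] := mop_pairS charFp w b c mp; have [L' R'] := mop_pairS charFp w' b' c' m'p.
rewrite E in L R; move: P P' => /and4P[_ mw b0 c0] /and4P[_ m'w' b'0 c'0].
have [mm cc ww] := Sright_inj charFp mp m'p c0 c'0 (etrans (esym R) R').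
have ww' : w = w'.
  case: ww => // m1; rewrite -mm m1 eqxx /= in mw m'w'.
  by rewrite (eqP mw) (eqP m'w').
subst m' c' w'; split=> //.
exact: (Sleft_inj charFp mp b0 b'0 (etrans (esym L) L')).
Qed.

Lemma pairM_inj m a s t m' a' s' t' : paramM p m a s t -> paramM p m' a' s' t' ->
  pairM p m a s t = pairM p m' a' s' t' -> [/\ m = m', a = a', s = s' & t = t'].
Proof.
move=> P P' E; have [_ R] := mop_pairM charFp a s t (paramM_le P).
have [_ R'] := mop_pairM charFp a' s' t' (paramM_le P').
rewrite E in R; move: P P' => /and5P[m1 mp st a0 a1] /and5P[m'1 m'p s't' a'0 a'1].
exact: (Mright_inj charFp m1 mp st a1 m'1 m'p s't' a'1 (etrans (esym R) R')).
Qed.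

Lemma pairS_neq_pairM m w b c m' a s t : paramS p m w b c -> paramM p m' a s t ->
  pairS p m w b c <> pairM p m' a s t.
Proof.
move=> P P' E; have mp := paramS_gt0 P; have [_ R] := mop_pairS charFp w b c mp.
have [_ R'] := mop_pairM charFp a s t (paramM_le P').
rewrite E in R; move: P P' => /and4P[_ mw b0 c0] /and5P[m'1 m'p st a0 a1].
exact: (Sright_neq_Mright charFp mp c0 m'1 m'p st a1 (etrans (esym R) R')).
Qed.

Lemma orig_Spoly_neq0 m w' c (v : 'rV[F]_(p.-1)) : (m %| p.-1)%N -> c != 0 ->
  mop v = orig (Spoly p m w' c) -> v != 0.
Proof.
move=> mp c0 E; apply/eqP => v0; move: E; rewrite v0 mop0 => /(congr1 (@deriv F)).
have p10 : (0 < p.-1)%N by rewrite -ltnS prednK // prime_gt1.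
have m0 := dvdn_gt0 p10 mp.
rewrite derivXn -mulr_natr -polyC_natr (pcharf0 charFp) mulr0 /orig derivB derivC subr0.
rewrite (deriv_Spoly charFp) //; move/esym/eqP; apply/negP.
rewrite scaler_eq0 negb_or c0 expf_neq0 // monic_neq0 //.
by have [] := monic_XsubX_addC w' c (_ : (0 < p.-1 %/ m)%N); rewrite ?divn_gt0 // dvdn_leq.
Qed.

Lemma pairS_neq0 m w b c : paramS p m w b c ->
  (pairS p m w b c).1 != 0 /\ (pairS p m w b c).2 != 0.
Proof.
case/and4P=> mp _ b0 c0; have [L R] := mop_pairS charFp w b c mp.
by split; [apply: orig_Spoly_neq0 L | apply: orig_Spoly_neq0 R].
Qed.

Lemma pairM_right_neq0 m a s t : paramM p m a s t -> (pairM p m a s t).2 != 0.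
Proof.
move=> P; have [_ R] := mop_pairM charFp a s t (paramM_le P).
case/and5P: P => m1 mp st a0 a1; apply/eqP => v0; move: R; rewrite v0 mop0.
have mp' : (0 < m < p)%N by move: m1 mp; clear; lia.
move=> /(congr1 (@deriv F)).
rewrite derivXn -mulr_natr -polyC_natr (pcharf0 charFp) mulr0 /Mright /orig derivB derivC subr0.
rewrite (deriv_Mpoly charFp) //; move/esym/eqP; apply/negP.
rewrite scaler_eq0 negb_or (Mpoly_coef_neq0 charFp mp' st a1).
by rewrite mulf_neq0 ?expf_neq0 ?polyXsubC_eq0.
Qed.

Lemma paramM_swap m a s t : paramM p m a s t -> paramM p m (1 - a) t s.
Proof.
case/and5P=> m1 mp st a0 a1; rewrite /paramM m1 mp eq_sym st.
by rewrite subr_eq0 eq_sym a1 -subr_eq0 addrAC subrr add0r oppr_eq0.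
Qed.

Lemma compp_pairM m a s t : paramM p m a s t ->
  compp (pairM p m a s t) = compp (pairM p m (1 - a) t s).
Proof.
move=> P; have [L R] := mop_pairM charFp a s t (paramM_le P).
have [L' R'] := mop_pairM charFp (1 - a) t s (paramM_le (paramM_swap P)).
rewrite /compp L R L' R'; apply: (M_collision charFp).
by case/and5P: P => m1 mp _ _ _; move: m1 mp; clear; lia.
Qed.

Lemma pairM_swap_neq m a s t : paramM p m a s t ->
  pairM p m a s t != pairM p m (1 - a) t s.
Proof.
move=> P; apply/eqP => /(pairM_inj P (paramM_swap P))[_ _ E _].
by case/and5P: P => _ _; rewrite E eqxx.
Qed.

(** Avoids computing [Mleft]: with left component ['X^p], the swapped pair would belong to a
    Frobenius fiber and have right component ['X^p]. *)
Lemma pairM_left_neq0 m a s t : paramM p m a s t -> (pairM p m a s t).1 != 0.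
Proof.
move=> P; apply/eqP => x1; set x := pairM p m a s t in x1.
have : pairM p m (1 - a) t s \in same x by rewrite inE /x (compp_pairM P).
have -> : x = (0, x.2) by rewrite -x1 -surjective_pairing.
rewrite (same_Frobenius charFp) !inE => /orP[/eqP E|/eqP E].
  have := pairM_swap_neq P; rewrite -/x E.
  by rewrite {1}[x]surjective_pairing x1 eqxx.
by have := pairM_right_neq0 (paramM_swap P); rewrite E eqxx.
Qed.

Lemma card_same_pairM m a s t : paramM p m a s t -> #|same (pairM p m a s t)| = 2%N.
Proof.
move=> P; set x := pairM _ _ _ _ _.
suff -> : same x = [set x; pairM p m (1 - a) t s] by rewrite cards2 pairM_swap_neq.
apply/setP => y; rewrite in_set2 inE; apply/eqP/orP => [E|[/eqP->//|/eqP->]]; last first.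
  by rewrite /x (compp_pairM P).
have [->|yx] := eqVneq y x; [by left | right].
have [] := same_cases (esym E) _ (pairM_left_neq0 P) (pairM_right_neq0 P).
- by rewrite eq_sym.
- move=> [m' [w [c1 [c2 [mp mw [c10 c20 c12] xE _]]]]].
  have P' : paramS p m' w (c2 * (c2 - c1) ^+ p.-1) c1.
    by rewrite /paramS mp mw c10 mulf_neq0 ?expf_neq0 ?subr_eq0 // eq_sym.
  by case: (pairS_neq_pairM P' P (esym xE)).
move=> [m' [a' [s' [t' [P' xE yE]]]]].
by have [-> -> -> ->] := pairM_inj P P' xE; rewrite yE.
Qed.

Lemma card_same_pairS m w b c : paramS p m w b c ->
  #|same (pairS p m w b c)| = (1 + #|Ssol p b c|)%N.
Proof.
move=> P; set x := pairS _ _ _ _ _; have [x1 x2] := pairS_neq0 P.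
have mp := paramS_gt0 P; have /and4P[_ mw b0 c0] := P.
(* The partner with right parameter [d]; its left parameter is the one forced by
   [S_collision_left]. *)
pose f d := pairS p m w (c * (c - d) ^+ p.-1) d.
have Pf d : d != 0 -> c != d -> paramS p m w (c * (c - d) ^+ p.-1) d.
  by move=> d0 cd; rewrite /paramS mp mw d0 mulf_neq0 ?expf_neq0 ?subr_eq0.
have Sd d : d \in Ssol p b c -> [/\ d != 0, c != d & b = d * (d - c) ^+ p.-1].
  by rewrite inE => /and3P[d0 dc /eqP bE]; split=> //; rewrite eq_sym.
have f_inj : {in Ssol p b c &, injective f}.
  move=> d1 d2 /Sd[d10 cd1 _] /Sd[d20 cd2 _].
  by move=> /(pairS_inj (Pf _ d10 cd1) (Pf _ d20 cd2))[].
have xf : x \notin f @: Ssol p b c.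
  apply/imsetP => -[d /Sd[d0 cd _] /(pairS_inj P (Pf _ d0 cd))[_ _ _ cE]].
  by rewrite cE eqxx in cd.
suff -> : same x = x |: f @: Ssol p b c by rewrite cardsU1 xf card_in_imset.
apply/setP => y; rewrite in_setU1 inE; apply/eqP/orP => [E|[/eqP->//|/imsetP[d dS ->]]].
  have [->|yx] := eqVneq y x; [by left | right].
  have [] := same_cases (esym E) _ x1 x2; first by rewrite eq_sym.
    move=> [m' [w' [c1 [c2 [m'p m'w' [c10 c20 c12] xE yE]]]]].
    have P' : paramS p m' w' (c2 * (c2 - c1) ^+ p.-1) c1.
      by rewrite /paramS m'p m'w' c10 mulf_neq0 ?expf_neq0 ?subr_eq0 // eq_sym.
    have [mE wE bE cE] := pairS_inj P P' xE; apply/imsetP; exists c2.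
      by rewrite inE c20 bE cE eqxx andbT eq_sym.
    by rewrite yE /f mE wE cE.
  move=> [m' [a' [s' [t' [P' xE _]]]]].
  by case: (pairS_neq_pairM P P' xE).
have [d0 cd bE] := Sd _ dS.
have [L R] := mop_pairS charFp w b c mp.
have [L' R'] := mop_pairS charFp w (c * (c - d) ^+ p.-1) d mp.
rewrite /compp L R L' R'; apply: (S_collision charFp) => //; last first.
  by rewrite bE exprB_predp mulrCA.
apply/eqP; rewrite bE exprB_predp -subr_eq0.
have -> : d ^+ p + c * (d - c) ^+ p.-1 - (c ^+ p + d * (d - c) ^+ p.-1) =
  (d ^+ p - c ^+ p) - (d - c) * (d - c) ^+ p.-1 by ring.
by rewrite -exprS prednK // exprB_char // subrr.
Qed.

Lemma card_same_other x : (x.1 == 0 -> x.2 = 0) -> (x.2 == 0 -> x.1 = 0) ->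
    (forall m w b c, paramS p m w b c -> x <> pairS p m w b c) ->
    (forall m a s t, paramM p m a s t -> x <> pairM p m a s t) ->
  #|same x| = 1%N.
Proof.
move=> x12 x21 nS nM.
have [x1|x1] := eqVneq x.1 0.
  have -> : x = (0, 0) by rewrite [x]surjective_pairing x1 x12 // x1.
  by rewrite (card_same_Frobenius charFp) eqxx.
have x2 : x.2 != 0 by apply: contraNneq x1 => x2; rewrite x21 // x2.
suff -> : same x = [set x] by rewrite cards1.
apply/setP => y; rewrite in_set1 inE; apply/eqP/eqP => [E|->//].
apply/eqP; apply/negPn/negP => yx.
have [] := same_cases (esym E) _ x1 x2; first by rewrite eq_sym.
  move=> [m' [w' [c1 [c2 [m'p m'w' [c10 c20 c12] xE yE]]]]].
  apply: nS xE.
  by rewrite /paramS m'p m'w' c10 mulf_neq0 ?expf_neq0 ?subr_eq0 // eq_sym.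
by move=> [m' [a' [s' [t' [P' xE _]]]]]; apply: nM xE.
Qed.

End Fibers.

Lemma card_half_range p : prime p ->
  (2 * #|[set m : 'I_p | (1 < m)%N && (2 * m < p)%N]|%:R =
   (1 - (p == 2)%N%:R) * (p%:R - 3) :> rat).
Proof.
move=> p_pr.
(* The set is the interval from 2 to [uphalf p - 1]; for [p = 2] the truncated subtraction gives 0,
   where [p - 3] would be negative. *)
have cardE : #|[set m : 'I_p | (1 < m)%N && (2 * m < p)%N]| = (uphalf p - 2)%N.
  have le i : (i < uphalf p - 2)%N -> (i + 2 < p)%N.
    by have := odd_double_half p; rewrite uphalf_half; lia.
  have bound i : (i < uphalf p - 2)%N -> (1 < i + 2)%N && (2 * (i + 2) < p)%N.
    by have := odd_double_half p; rewrite uphalf_half; lia.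
  have <- : #|[set (Ordinal (le i (ltn_ord i))) | i : 'I_(uphalf p - 2)]| = (uphalf p - 2)%N.
    rewrite card_imset ?card_ord // => i j [] /eqP; rewrite eqn_add2r => /eqP.
    exact: val_inj.
  apply: eq_card => m; rewrite inE; apply/idP/imsetP => [mP|[i _ ->]] /=.
    have mi : (m - 2 < uphalf p - 2)%N.
      by move: mP; have := odd_double_half p; rewrite uphalf_half; lia.
    exists (Ordinal mi) => //; apply: val_inj => /=; move: mP; lia.
  exact: bound (ltn_ord i).
rewrite cardE; have [->|p2] := eqVneq p 2%N; first by rewrite subrr mul0r mulr0.
have podd : odd p by move: (even_prime p_pr) p2 => [->|].
have p3 : (2 < p)%N by rewrite ltn_neqAle eq_sym p2 prime_gt1.
rewrite subr0 mul1r -natrM -natrB //; congr (_%:R).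
by have := odd_double_half p; rewrite podd uphalf_half podd; lia.
Qed.

(** * Summation of the defects *)

Section Count.
Variables (F : finFieldType) (p : nat).
Hypothesis charFp : p \in [pchar F].
Implicit Types (w b c d a s t : F).

Let p_pr : prime p. Proof. exact: pcharf_prime charFp. Qed.
Let p_gt0 : (0 < p)%N. Proof. exact: prime_gt0. Qed.
Local Notation V := 'rV[F]_(p.-1).
Local Notation q := #|F|.

(** The divisor 1 admits only the center 0, every other divisor admits all [q] centers. *)
Lemma card_paramS_left :
  #|[set u : 'I_p * F | (u.1 %| p.-1)%N && ((u.1 == 1%N :> nat) ==> (u.2 == 0))]| =
  (1 + (size (divisors p.-1) - 1) * q)%N.
Proof.
have p10 : (0 < p.-1)%N by rewrite -ltnS prednK // prime_gt1.
have lt1 : (1 < p)%N by exact: prime_gt1.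
have cardD : #|[set m : 'I_p | m %| p.-1]%N| = size (divisors p.-1).
  rewrite cardE -(size_map val); apply/perm_size/uniq_perm.
  - by rewrite (map_inj_uniq val_inj) enum_uniq.
  - exact: divisors_uniq.
  move=> n; rewrite -dvdn_divisors //; apply/mapP/idP => [[m]|np].
    by rewrite mem_enum inE => mp ->.
  have lt : (n < p)%N by rewrite (leq_ltn_trans (dvdn_leq p10 np)) // prednK.
  by exists (Ordinal lt) => //; rewrite mem_enum inE.
rewrite -sum1_card (eq_bigl (fun u : 'I_p * F =>
  (u.1 %| p.-1)%N && ((u.1 == 1%N :> nat) ==> (u.2 == 0)))); last first.
  by move=> u; rewrite inE.
rewrite -(pair_big_dep (fun m : 'I_p => (m %| p.-1)%N)
  (fun (m : 'I_p) (u : F) => (m == 1%N :> nat) ==> (u == 0)) (fun _ _ => 1%N)) /=.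
rewrite (bigD1 (Ordinal lt1)) ?dvd1n //= (big_pred1 (0 : F)) //; congr addn.
rewrite (eq_bigr (fun=> q)); last first.
  move=> m /andP[_ m1]; rewrite (eq_bigl predT) ?sum1_card // => u.
  by rewrite -[(m == 1%N :> nat)]/(m == Ordinal lt1) (negPf m1).
rewrite sum_nat_const -cardD; congr muln.
rewrite [in RHS](cardD1 (Ordinal lt1)) inE dvd1n addKn.
by apply: eq_card => m; rewrite !inE andbC.
Qed.

(** The sum of the defects is the number of pairs minus the number of compositions, and only pairs
    with a partner contribute. *)
Definition defect (x : V * V) : rat := 1 - (#|same x|%:R)^-1.

Definition paramS_pair (u : 'I_p * F * (F * F)) := pairS p u.1.1 u.1.2 u.2.1 u.2.2.
Definition domS := [set u : 'I_p * F * (F * F) | paramS p u.1.1 u.1.2 u.2.1 u.2.2].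
Definition paramM_pair (u : 'I_p * F * (F * F)) := pairM p u.1.1 u.1.2 u.2.1 u.2.2.
Definition domM := [set u : 'I_p * F * (F * F) | paramM p u.1.1 u.1.2 u.2.1 u.2.2].

Lemma card_nonzero_row : #|[set v : V | v != 0]| = (q ^ p.-1 - 1)%N.
Proof.
have -> : (q ^ p.-1 = #|{: V}|)%N by rewrite card_mx mul1n.
by rewrite subn1 -(cardC1 (0 : V)); apply: eq_card => v; rewrite !inE.
Qed.

Lemma sum_defect_left : \sum_(x in [set (0, v) | v in [set v : V | v != 0]]) defect x =
  (q ^ p.-1 - 1)%:R / 2.
Proof.
rewrite big_imset /=; last by move=> v v' _ _ [].
rewrite (eq_bigr (fun=> 1 / 2)).
  by rewrite sumr_const card_nonzero_row -[LHS]mulr_natl mul1r.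
move=> v; rewrite inE /defect (card_same_Frobenius charFp) => /negPf->.
by field.
Qed.

Lemma sum_defect_right : \sum_(x in [set (v, 0) | v in [set v : V | v != 0]]) defect x =
  (q ^ p.-1 - 1)%:R / 2.
Proof.
rewrite big_imset /=; last by move=> v v' _ _ [].
rewrite (eq_bigr (fun=> 1 / 2)).
  by rewrite sumr_const card_nonzero_row -[LHS]mulr_natl mul1r.
move=> v; rewrite inE /defect (card_same_right0 charFp) => /negPf->.
by field.
Qed.

Lemma sum_defectS : \sum_(x in paramS_pair @: domS) defect x =
  (1 + (size (divisors p.-1) - 1) * q)%:R *
  ((q%:R - 1) * (q%:R * p%:R - p%:R - 2) / (2 * (p%:R + 1))).
Proof.
rewrite big_imset /=; last first.
  move=> [[m w] [b c]] [[m' w'] [b' c']]; rewrite !inE /= => P P'.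
  by move=> /(pairS_inj charFp P P')[/val_inj -> -> -> ->].
rewrite (eq_bigr (fun u => 1 - (1 + #|Ssol p u.2.1 u.2.2|%:R)^-1)); last first.
  by move=> u; rewrite inE => P; rewrite /defect (card_same_pairS charFp) // natrD.
pose Q (u : 'I_p * F) := (u.1 %| p.-1)%N && ((u.1 == 1%N :> nat) ==> (u.2 == 0)).
rewrite (eq_bigl (fun u => Q u.1 && ((u.2.1 != 0) && (u.2.2 != 0)))); last first.
  by move=> u; rewrite inE /paramS /Q -!andbA.
rewrite -(pair_big Q (fun u : F * F => (u.1 != 0) && (u.2 != 0))
  (fun _ u => 1 - (1 + #|Ssol p u.1 u.2|%:R)^-1)) /=.
rewrite -(pair_big (fun b : F => b != 0) (fun c : F => c != 0)
  (fun b c => 1 - (1 + #|Ssol p b c|%:R)^-1)) /= sum_deficiency //.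
rewrite sumr_const -[LHS]mulr_natl -card_paramS_left; congr (_%:R * _).
by apply: eq_card => u; rewrite inE.
Qed.

Lemma card_domM : #|domM| =
  (#|[set m : 'I_p | (1 < m)%N && (2 * m < p)%N]| * ((q - 2) * (q * (q - 1))))%N.
Proof.
pose A := [set a : F | (a != 0) && (a != 1)]; pose B := [set u : F * F | u.1 != u.2].
have -> : domM = setX (setX [set m : 'I_p | (1 < m)%N && (2 * m < p)%N] A) B.
  apply/setP => -[[m a] [s t]]; rewrite !inE /paramM /=.
  by case: (_ < _)%N; case: (_ < _)%N; case: (a != 0); case: (a != 1); case: (s != t).
have cA : #|A| = (q - 2)%N.
  rewrite -[in RHS](cardC (pred2 (0 : F) 1)) card2 eq_sym oner_neq0 addKn.
  by apply: eq_card => a; rewrite !inE negb_or.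
have cB : #|B| = (q * (q - 1))%N.
  rewrite -sum1_card (eq_bigl (fun u : F * F => predT u.1 && (u.2 != u.1))); last first.
    by move=> u; rewrite inE /= eq_sym.
  rewrite -(pair_big_dep predT (fun s t : F => t != s) (fun _ _ => 1%N)) /=.
  rewrite -[RHS]sum_nat_const; apply: eq_bigr => s _.
  by rewrite sum1_card subn1 -(cardC1 s).
by rewrite !cardsX cA cB -mulnA.
Qed.

Lemma sum_defectM : \sum_(x in paramM_pair @: domM) defect x = #|domM|%:R / 2.
Proof.
rewrite big_imset /=; last first.
  move=> [[m a] [s t]] [[m' a'] [s' t']]; rewrite !inE /= => P P'.
  by move=> /(pairM_inj charFp P P')[/val_inj -> -> -> ->].
rewrite (eq_bigr (fun=> 1 / 2)); first by rewrite sumr_const -[LHS]mulr_natl mul1r.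
by move=> u; rewrite inE => P; rewrite /defect (card_same_pairM charFp) //; field.
Qed.

Lemma sum_disjoint (I : finType) (A B : {set I}) (f : I -> rat) : [disjoint A & B] ->
  \sum_(x in A :|: B) f x = \sum_(x in A) f x + \sum_(x in B) f x.
Proof.
by move=> AB; rewrite -bigU //; apply: eq_bigl => x; rewrite !inE.
Qed.

(** Pairs with nonzero defect fall into four disjoint sets: the two kinds of Frobenius pairs, whose
    halves add up to [q ^ p.-1 - 1], and the two families. *)
Lemma sum_defect : \sum_(x : V * V) defect x =
  (q ^ p.-1 - 1)%:R +
  (1 + (size (divisors p.-1) - 1) * q)%:R *
    ((q%:R - 1) * (q%:R * p%:R - p%:R - 2) / (2 * (p%:R + 1))) +
  #|domM|%:R / 2.
Proof.
pose A1 := [set (0, v) | v in [set v : V | v != 0]] : {set V * V}.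
pose A2 := [set (v, 0) | v in [set v : V | v != 0]] : {set V * V}.
pose A3 := paramS_pair @: domS; pose A4 := paramM_pair @: domM.
have memS m w b c : paramS p m w b c -> pairS p m w b c \in A3.
  move=> P; have mlt : (m < p)%N.
    have p10 : (0 < p.-1)%N by rewrite -ltnS prednK // prime_gt1.
    have mp := paramS_gt0 P.
    by rewrite (leq_ltn_trans (dvdn_leq p10 mp)) // prednK.
  by apply/imsetP; exists ((Ordinal mlt, w), (b, c)); rewrite // inE.
have memM m a s t : paramM p m a s t -> pairM p m a s t \in A4.
  move=> P; have mlt : (m < p)%N.
    by case/and5P: P => _ + _ _ _; clear; lia.
  by apply/imsetP; exists ((Ordinal mlt, a), (s, t)); rewrite // inE.
have d12 : [disjoint A1 & A2].
  apply/pred0P => x; apply/negP => /andP[/imsetP[v + ->] /imsetP[w _ [_ v0]]].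
  by rewrite inE v0 eqxx.
have d123 : [disjoint A1 :|: A2 & A3].
  apply/pred0P => x; apply/negP => /andP[/setUP[]/imsetP[v _ ->] /imsetP[u]];
    rewrite inE => /(pairS_neq0 charFp)[u1 u2] E.
    by move: u1; rewrite -/(paramS_pair u) -E eqxx.
  by move: u2; rewrite -/(paramS_pair u) -E eqxx.
have d1234 : [disjoint A1 :|: A2 :|: A3 & A4].
  apply/pred0P => x; apply/negP => /andP[/setUP[/setUP[]/imsetP[v + ->]|/imsetP[v + ->]]].
  - move=> _ /imsetP[u]; rewrite inE => /(pairM_left_neq0 charFp) u1 E.
    by move: u1; rewrite -/(paramM_pair u) -E eqxx.
  - move=> _ /imsetP[u]; rewrite inE => /(pairM_right_neq0 charFp) u2 E.
    by move: u2; rewrite -/(paramM_pair u) -E eqxx.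
  rewrite inE => P /imsetP[u]; rewrite inE => P'.
  exact: (pairS_neq_pairM charFp P P').
rewrite (bigID (mem (A1 :|: A2 :|: A3 :|: A4))) /= [X in _ + X]big1 ?addr0.
  rewrite !sum_disjoint // sum_defect_left sum_defect_right sum_defectS sum_defectM.
  by congr (_ + _ + _); field.
move=> x; rewrite !in_setU !negb_or => /andP[/andP[/andP[n1 n2] n3] n4].
rewrite /defect (card_same_other charFp) ?invr1 ?subrr //.
- move=> /eqP x1; apply/eqP; apply: contraNT n1 => x2; apply/imsetP.
  by exists x.2; rewrite ?inE // -x1 -surjective_pairing.
- move=> /eqP x2; apply/eqP; apply: contraNT n2 => x1; apply/imsetP.
  by exists x.1; rewrite ?inE // -x2 -surjective_pairing.
- by move=> m w b c P E; rewrite E memS in n3.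
by move=> m a s t P E; rewrite E memM in n4.
Qed.

Theorem card_compositions :
  (size (undup [seq compp x | x : V * V]))%:R =
    q%:R ^+ (2 * p - 2) - q%:R ^+ (p - 1) + 1
    - ((size (divisors p.-1))%:R * q%:R - q%:R + 1) * (q%:R - 1) * (q%:R * p%:R - p%:R - 2)
        / (2 * (p%:R + 1))
    - (1 - (p == 2)%N%:R) * (q%:R * (q%:R - 1) * (q%:R - 2) * (p%:R - 3) / 4)
    :> rat.
Proof.
have q1 : (1 < q)%N by exact: finNzRing_gt1.
have p10 : (0 < p.-1)%N by rewrite -ltnS prednK // prime_gt1.
have cV : #|{: V * V}| = (q ^ p.-1 * q ^ p.-1)%N by rewrite card_prod !card_mx !mul1n.
have d0 : (0 < size (divisors p.-1))%N.
  have : 1%N \in divisors p.-1 by rewrite -dvdn_divisors // dvd1n.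
  by case: (divisors _).
have := sum_defect; rewrite /defect sumrB sumr_const cV sum_inv_fibers => sumE.
have := card_half_range p_pr; move: sumE; rewrite card_domM.
set D := size (undup _); set n := #|[set m : 'I_p | _]|.
rewrite !(natrM, natrD, natrB) ?expn_gt0 ?(ltnW q1) //.
rewrite !natrX => sumE nE.
have -> : (2 * p - 2 = p.-1 + p.-1)%N by move: p_gt0; clear; lia.
rewrite subn1 exprD.
move: sumE nE; move: (_ ^+ p.-1) (size _) q1 d0 => Q tau q1 d0 sumE nE.
have p1 : p%:R + 1 != 0 :> rat by rewrite natr1 Num.Theory.pnatr_eq0.
have -> : D%:R = Q * Q - (Q * Q - D%:R) by ring.
rewrite sumE.
have -> : (1 - (p == 2)%N%:R) * (q%:R * (q%:R - 1) * (q%:R - 2) * (p%:R - 3) / 4) =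
   ((1 - (p == 2)%N%:R) * (p%:R - 3)) * (q%:R * (q%:R - 1) * (q%:R - 2) / 4) :> rat by ring.
by rewrite -nE; field.
Qed.

End Count.

(** * From decomposable polynomials to pairs of components *)

Section DecomposablePolynomials.
Variables (F : finFieldType) (p : nat).
Hypothesis charFp : p \in [pchar F].

Let p_pr : prime p. Proof. exact: pcharf_prime charFp. Qed.
Let p_gt0 : (0 < p)%N. Proof. exact: prime_gt0. Qed.

Lemma compp_decomposable (x : 'rV[F]_(p.-1) * 'rV[F]_(p.-1)) :
  [/\ monic_original (compp x), size (compp x) = (p ^ 2).+1 & decomposable (compp x)].
Proof.
have [m1 /eqP s1] := andP (mop_monic_deg charFp x.1).
have [m2 /eqP s2] := andP (mop_monic_deg charFp x.2).
have p2 : (2 < p.+1)%N by rewrite ltnS prime_gt1.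
split.
- split; first by rewrite monicE lead_coef_comp ?s2 ?ltnS // (monicP m1) (monicP m2) expr1n mulr1.
  rewrite -horner_coef0 /compp horner_comp (horner_coef0 (mop x.2)).
  by rewrite (mop_coef0 charFp) horner_coef0 (mop_coef0 charFp).
- rewrite /compp (size_comp_monic charFp s2) ?monic_neq0 // s1 -mulnn //.
by exists (mop x.1), (mop x.2); rewrite s1 s2.
Qed.

(* If [f = g \Po h] then also [f = (g \Po (a X + b)) \Po ((h - b) / a)], where
   [a] is the leading coefficient and [b] the constant coefficient of [h]. *)
Lemma decomposable_compp (f : {poly F}) : monic_original f ->
  size f = (p ^ 2).+1 -> decomposable f ->
  exists x : 'rV[F]_(p.-1) * 'rV[F]_(p.-1), f = compp x.
Proof.
move=> [fm f0] sf [g [h [sg sh fE]]].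
have pp : ((size g).-1 * (size h).-1 = p * p)%N by rewrite -size_comp_poly -fE sf mulnn.
(* The degree of [g] divides [p ^ 2]; the values 1 and [p ^ 2] are excluded because both components
   have degree at least 2. *)
have sgp : (size g).-1 = p.
  have dv : ((size g).-1 %| p ^ 2)%N by rewrite -mulnn -pp dvdn_mulr.
  have /(dvdn_pfactor _ _ p_pr)[[|[|[|k]]] // _ E] := dv; move: sg sh pp; rewrite E.
  - by case: (size g) E => // n /= ->.
  move=> _ sh /eqP; rewrite -[(p * p)%N]muln1 mulnn eqn_pmul2l ?expn_gt0 ?p_gt0 //.
  by case: (size h) sh => [|[|[|]]].
have shp : (size h).-1 = p by apply/eqP; rewrite -(eqn_pmul2l p_gt0) -[X in (X * _)%N]sgp pp.
have sgE : size g = p.+1 by rewrite -sgp prednK // (ltn_trans _ sg).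
have shE : size h = p.+1 by rewrite -shp prednK // (ltn_trans _ sh).
pose a := lead_coef h; pose b := h`_0.
have a0 : a != 0 by rewrite lead_coef_eq0 -size_poly_gt0 shE.
pose h1 := a^-1 *: (h - b%:P); pose g1 := g \Po (a *: 'X + b%:P).
have ltb : (size (- b%:P : {poly F}) < size h)%N.
  by rewrite size_polyN shE (leq_ltn_trans (size_polyC_leq1 _)) // ltnS.
have h1m : monic_deg p h1.
  rewrite /monic_deg monicE lead_coefZ lead_coefDl // mulVf // eqxx /=.
  by rewrite size_scale ?invr_eq0 // size_polyDl // shE.
have h10 : h1`_0 = 0 by rewrite coefZ coefB coefC subrr mulr0.
have sX : size (a *: 'X + b%:P) = 2%N.
  by rewrite size_polyDl size_scale ?size_polyX // size_polyC; case: (b != 0).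
have fE1 : f = g1 \Po h1.
  rewrite fE -comp_polyA comp_polyD comp_polyZ comp_polyX comp_polyC.
  by rewrite scalerA mulfV // scale1r subrK.
have sg1 : size g1 = p.+1 by rewrite size_comp_poly2.
have g1m : monic_deg p g1.
  rewrite /monic_deg sg1 eqxx andbT; have [hm /eqP sh1] := andP h1m.
  have := monicP fm; rewrite fE1 lead_coef_comp ?sh1 ?ltnS // (monicP hm) expr1n mulr1.
  by rewrite monicE => ->.
have g10 : g1`_0 = 0.
  by move: f0; rewrite fE1 -!horner_coef0 horner_comp (horner_coef0 h1) h10.
exists (mop_inv p g1, mop_inv p h1).
by rewrite /compp /= !(mop_invK charFp).
Qed.

End DecomposablePolynomials.

From mathcomp Require Import finmap.
From mathcomp Require Import all_classical.

Local Open Scope classical_set_scope.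

(* The fset_set of an infinite set is empty, hence the finiteness clause. *)
Theorem theorem6p2 (F : finFieldType) (p q tau : nat) (hp : prime p)
    (hF : p \in [pchar F]) (hq : q = #|F|) (htau : tau = size (divisors p.-1)) :
  finite_set (decomposables F (p ^ 2)) /\
  (#|` fset_set (decomposables F (p ^ 2)) |%fset)%:R =
    q%:R ^+ (2 * p - 2) - q%:R ^+ (p - 1) + 1
    - (tau%:R * q%:R - q%:R + 1) * (q%:R - 1) * (q%:R * p%:R - p%:R - 2)
        / (2 * (p%:R + 1))
    - (1 - (p == 2)%N%:R) * (q%:R * (q%:R - 1) * (q%:R - 2) * (p%:R - 3) / 4)
    :> rat.
Proof.
pose s := [seq compp x | x : 'rV[F]_(p.-1) * 'rV[F]_(p.-1)].
have decE : decomposables F (p ^ 2) = [set` seq_fset tt s].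
  apply/seteqP; split=> [f [fm sf fd]|f fs].
    suff : f \in seq_fset tt s by [].
    rewrite seq_fsetE; have [x ->] := decomposable_compp hF fm sf fd.
    by rewrite map_f ?mem_enum.
  have : f \in seq_fset tt s by [].
  by rewrite seq_fsetE => /mapP[x _ ->]; apply: compp_decomposable.
split; first by rewrite decE; apply: finite_fset.
by rewrite decE set_fsetK size_seq_fset hq htau card_compositions.
Qed.
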